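(* Let $X=(X_{ij})$ be an $n\times n$ complex-valued random matrix such that (i) $\{(X_{ij},X_{ji}):1\le i<j\le n\}$ is a collection of independent random tuples; (ii) the diagonal entries $\{X_{ii}:1\le i\le n\}$ are independent of the off-diagonal entries (but can be dependent on each other); (iii) there exists $a>0$ such that the events $\mathcal{E}_{ij}:=\{|X_{ij}|\le a,\ |X_{ji}|\le a\}$, defined for $i\ne j$, satisfy $$b:=\min_{i<j}\mathbb{P}(\mathcal{E}_{ij})>0,\qquad \sigma^2:=\min_{i\ne j}\mathrm{Var}(X_{ij}\mid\mathcal{E}_{ij})>0,$$ and $$\rho:=\max_{i<j}\left|\mathrm{Corr}(X_{ij}\mid\mathcal{E}_{ij},\,X_{ji}\mid\mathcal{E}_{ji})\right|<1 .$$ Then there exists $C=C(a,b,\sigma)>0$, depending only on $a,b,\sigma$, such that for $n\ge C$, any $M\in\mathrm{Mat}_n(\mathbb{C})$, any $s\ge1$ and any $0<t\le1$, $$\mathbb{P}\left(s_n(X+M)\le\frac{t}{\sqrt n},\ s_1(X+M)\le s\right)\le C\left(\frac{\log(Cns)}{\sqrt{1-\rho}}\left(\sqrt{s^5t}+\frac1{\sqrt n}\right)\right)^{1/4}.$$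
   Context: $s_1(A)\ge\dots\ge s_n(A)$ denote the singular values of $A\in\mathrm{Mat}_n(\mathbb{C})$. $M$ is deterministic. For complex square-integrable $\xi,\psi$: $\mathrm{Cov}(\xi,\psi)=\mathbb{E}[(\xi-\mathbb{E}\xi)\overline{(\psi-\mathbb{E}\psi)}]$, $\mathrm{Var}(\xi)=\mathbb{E}|\xi-\mathbb{E}\xi|^2$, $\mathrm{Corr}(\xi,\psi)=\mathrm{Cov}(\xi,\psi)/\sqrt{\mathrm{Var}(\xi)\mathrm{Var}(\psi)}$. $\mathrm{Var}(\cdot\mid\mathcal{E})$ is the variance under the conditional probability given $\mathcal{E}$, and (since $\mathcal{E}_{ij}=\mathcal{E}_{ji}$) $\mathrm{Corr}(X_{ij}\mid\mathcal{E}_{ij},X_{ji}\mid\mathcal{E}_{ji})$ is the correlation of $X_{ij}$ and $X_{ji}$ under the conditional probability given $\mathcal{E}_{ij}$. *)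

(* Defs.v *)
From HB Require Import structures.
From mathcomp Require Import all_boot all_order all_algebra.
From mathcomp Require Import spectral.
From mathcomp Require Import finmap.
From mathcomp Require Import all_classical all_reals all_analysis.
From mathcomp Require Import measurable_realfun.
From mathcomp.real_closed Require Import complex.
Set Implicit Arguments.
Unset Strict Implicit.
Unset Printing Implicit Defensive.
Import Order.TTheory GRing.Theory Num.Theory ComplexField.Normc.
Import numFieldNormedType.Exports.
Local Open Scope classical_set_scope.
Local Open Scope ring_scope.
Local Open Scope complex_scope.
Local Open Scope sesquilinear_scope.

(* The Borel sigma-algebra of the complex plane, transported from R * R. *)
Section complex_measurable.
Variable R : realType.

Definition reim (z : R[i]) : R * R := (complex.Re z, complex.Im z).

HB.instance Definition _ := isPointed.Build R[i] (0 : R[i]).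
HB.instance Definition _ :=
  Measurable.copy R[i] (g_sigma_algebra_preimageType reim).

Lemma measurable_reim : measurable_fun [set: R[i]] reim.
Proof. by move=> _ B mB; exists B. Qed.

Lemma measurable_normc : measurable_fun [set: R[i]] (@normc R).
Proof.
rewrite (_ : @normc R =
  (fun p : R * R => Num.sqrt (p.1 ^+ 2 + p.2 ^+ 2)) \o reim); last first.
  by apply/funext => -[x y].
apply: measurableT_comp measurable_reim.
apply: (measurableT_comp (continuous_measurable_fun (@sqrt_continuous R))).
by apply: measurable_funD; apply: measurable_funX;
   [exact: measurable_fst | exact: measurable_snd].
Qed.

End complex_measurable.

Section singular_values.
Variables (R : realType) (n : nat).

(* [spectral_diag] lists the eigenvalues, with multiplicity, of a normal
   matrix; the Gram matrix is one by [gram_normal]. *)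
Definition singular_values (A : 'M[R[i]]_n) : seq R :=
  sort (fun x y => y <= x)
    [seq Num.sqrt (complex.Re (spectral_diag (A^t* *m A) 0 k)) | k <- enum 'I_n].

(* 1-based: [singular_value A 1] is the largest, [singular_value A n] the
   smallest. *)
Definition singular_value (A : 'M[R[i]]_n) (k : nat) : R :=
  nth 0 (singular_values A) k.-1.

Lemma gram_normal (A : 'M[R[i]]_n) : A^t* *m A \is normalmx.
Proof.
by apply/normalmxP; rewrite trmx_mul map_mxM /= trmxCK.
Qed.

End singular_values.

Section extrema.
Variable R : realType.

Definition is_min (S : set R) (m : R) := S m /\ lbound S m.
Definition is_max (S : set R) (m : R) := S m /\ ubound S m.

End extrema.

Section independence.
Context d (T : measurableType d) (R : realType) (P : probability T R).

Definition sigma_of d' (T' : measurableType d') (f : T -> T') : set (set T) :=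
  preimage_set_system setT f measurable.

Definition mutually_independent (I : choiceType) (D : set I)
    (F : I -> set (set T)) :=
  forall J : {fset I}, [set` J] `<=` D ->
  forall E : I -> set T, (forall k, k \in J -> F k (E k)) ->
  P (\bigcap_(k in [set` J]) E k) = (\prod_(k <- J) P (E k))%E.

Definition independent2 (F G : set (set T)) :=
  forall A B, F A -> G B -> P (A `&` B) = (P A * P B)%E.

End independence.

Section complex_moments.
Context d (T : measurableType d) (R : realType) (P : probability T R).

Definition cexpect (f : T -> R[i]) : R[i] :=
  fine 'E_P[fun w => complex.Re (f w)] +i* fine 'E_P[fun w => complex.Im (f w)].

Definition ccov (f g : T -> R[i]) : R[i] :=
  cexpect (fun w => (f w - cexpect f) * (g w - cexpect g)^*).

Definition cvar (f : T -> R[i]) : R :=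
  fine 'E_P[fun w => normc (f w - cexpect f) ^+ 2].

Definition ccorr (f g : T -> R[i]) : R[i] :=
  ccov f g / (Num.sqrt (cvar f * cvar g))%:C.

(* The probability A |-> P (A `&` E) / P E; when P E = 0 it is P itself. *)
Definition cond_prob (E : set T) (mE : measurable E) : probability T R :=
  mnormalize (mrestr P mE) P.

End complex_moments.

Section random_matrix.
Context d (T : measurableType d) (R : realType) (P : probability T R).
Variables (n : nat) (X : 'I_n -> 'I_n -> {RV P >-> R[i]}).

Definition random_matrix (w : T) : 'M[R[i]]_n := \matrix_(i, j) X i j w.

Definition bounded_event (a : R) (i j : 'I_n) : set T :=
  [set w | normc (X i j w) <= a /\ normc (X j i w) <= a].

Lemma measurable_bounded_event (a : R) (i j : 'I_n) :
  measurable (bounded_event a i j).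
Proof.
have m k l : measurable [set w | normc (X k l w) <= a].
  rewrite [X in measurable X](_ : _ =
      setT `&` ((@normc R) \o X k l) @^-1` `]-oo, a]); last first.
    by rewrite setTI; apply/seteqP; split => w /=; rewrite in_itv.
  apply: (measurableT_comp (@measurable_normc R)) => //.
exact: measurableI (m i j) (m j i).
Qed.

(* For all pairs (i, j), not only i < j: the event is symmetric in i and j. *)
Definition cond_bounded (a : R) (i j : 'I_n) : probability T R :=
  cond_prob P (measurable_bounded_event a i j).

Definition pairs_independent :=
  mutually_independent P [set ij : 'I_n * 'I_n | (ij.1 < ij.2)%N]
    (fun ij => sigma_of (fun w => (X ij.1 ij.2 w, X ij.2 ij.1 w))).

Definition diagonal_independent :=
  independent2 P
    <<s \bigcup_(i in [set: 'I_n]) sigma_of (X i i) >>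
    <<s \bigcup_(ij in [set ij : 'I_n * 'I_n | ij.1 != ij.2])
          sigma_of (X ij.1 ij.2) >>.

End random_matrix.

(* Main.v *)
(* Rounding the entries to a fine grid and shifting the diagonal slightly reduces
   the theorem to a matrix A with finitely supported entries and invertible
   principal minors of size n - 1.

   With overwhelming probability A is "tall": every submatrix formed by few of its
   columns is well conditioned, even after deleting a few rows.  Indeed, if a column
   were near the span of the others for too many outcomes of a symmetrized sample,
   these outcomes would, by Pajor's form of the Sauer-Shelah lemma, shatter a set
   too large for an orthogonality argument to allow it.  Tallness forces approximate
   null vectors to be spread over many coordinates, so a unit vector x with A x small
   has many sizable coordinates x_k.  For such k the Schur complement shows that
   a_kk - v^T B^-1 u is small, where B is the minor of A at k and (u, v) are the
   removed column and row.  Decoupling, i.e. resampling the pairs (u_i, v_i) for i in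
   a set I, turns this quadratic form into a linear form in the other pairs; its
   coefficient vector y is such that B y vanishes off I, hence is spread, and the
   Littlewood-Offord bound applies.  The correlation enters only through
     E|p X_ij + q X_ji - c|^2 >= sigma^2 (1 - rho) (|p|^2 + |q|^2)
   conditionally on E_ij, which Paley-Zygmund turns into a lower bound for the
   probability that a symmetrized pair is not small in the direction (p, q). *)
Require Import Defs.
From mathcomp Require Import all_boot all_order all_algebra.
From mathcomp Require Import ring lra zify.
From mathcomp Require Import boolp reals sequences exp.
From mathcomp Require Import spectral sesquilinear.
From mathcomp.real_closed Require Import complex.
Set Implicit Arguments.
Unset Strict Implicit.
Unset Printing Implicit Defensive.
Import Order.TTheory GRing.Theory Num.Theory.
Local Open Scope ring_scope.
Local Open Scope complex_scope.
Local Open Scope sesquilinear_scope.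

(** * Shattering and antichains *)

(** The Schur complement estimate grows like [1 + s^2 / sg^2], where [sg] is the least singular
    value of the minor [B], and no lower bound on [sg] is available. The decoupling weights are
    therefore matched to [sg]. If [sg] is small, they are coordinates of a unit vector [w] with
    [|B^T w| = sg]; then [|w^T B y| <= sg |y|], so [w^T B y] of ordinary size forces [y] to be
    longer by the factor by which the threshold has grown, and [sg] cancels. Invertibility of [B] is
    only ever used qualitatively.

    The exponents arise as follows. With [j] usable coordinates the small ball bound is of order
    [1 / sqrt (j (1 - rho))], and decoupling takes a square root. The threshold allows [j] of order
    [sqrt (1 - rho) / (t s^4)]. A tall matrix of norm at most [s] exists only if [s^2] is at least
    of order [n], and then [s sqrt (1 - rho) >= 1] whenever the claimed bound is not trivial; this
    trades [1 / sqrt (1 - rho)] for a fifth factor [s].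

    Single entries spread with constants free of [rho], which keeps tallness, and with it the final
    constant, independent of [rho]. *)

Section Shattering.
Variable T : finType.
Implicit Types (F : {set {set T}}) (S U A R : {set T}).

Definition shatters F S :=
  [forall U : {set T}, (U \subset S) ==> [exists A in F, A :&: S == U]].

Lemma shattersP F S :
  reflect (forall U, U \subset S -> exists2 A, A \in F & A :&: S = U)
          (shatters F S).
Proof.
apply: (iffP forallP) => [h U US|h U].
  by have /implyP/(_ US)/exists_inP[A AF /eqP] := h U; exists A.
by apply/implyP => /h[A AF <-]; apply/exists_inP; exists A.
Qed.

Lemma shatters_sub F S U : U \subset S -> shatters F S -> shatters F U.
Proof.
move=> US /shattersP h; apply/shattersP => V VU.
have [A AF AS] := h V (subset_trans VU US).
by exists A => //; rewrite -[U](setIidPr US) setIA AS; apply/setIidPl.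
Qed.

(** Induction on the ground set. Splitting by an element [x] gives the sets avoiding [x] and the
    sets containing it, the latter with [x] removed. A set shattered by one of these families is
    shattered by [F]; one shattered by both counts twice, since adding [x] to it again gives a set
    shattered by [F]. *)
Lemma pajor F : (#|F| <= #|[set S | shatters F S]|)%N.
Proof.
suff gen n R F' : (#|R| <= n)%N -> F' \subset powerset R ->
    (#|F'| <= #|[set S | shatters F' S]|)%N.
  by apply: (gen #|T| [set: T]); rewrite ?cardsT //;
     apply/subsetP => A _; rewrite inE subsetT.
elim: n R F' => [|n IH] R {}F Rn FR.
  have {Rn}R0 : R = set0 by apply/eqP; rewrite -cards_eq0 -leqn0.
  have [->|[A AF]] := set_0Vmem F; first by rewrite cards0.
  rewrite R0 in FR.
  have F1 : (#|F| <= 1)%N.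
    by rewrite -(cards1 (set0 : {set T})) subset_leq_card // -powerset0.
  apply: leq_trans F1 _; rewrite card_gt0; apply/set0Pn; exists set0.
  rewrite inE; apply/shattersP => U; rewrite subset0 => /eqP ->.
  by exists A => //; rewrite setI0.
have [R0|[x xR]] := set_0Vmem R.
  by apply: (IH R) => //; rewrite R0 cards0.
pose F0 := [set A in F | x \notin A].
pose Fx := [set A in F | x \in A].
pose F1 : {set {set T}} := [set (A : {set T}) :\ x | A in Fx].
have cF : (#|F| = #|F0| + #|F1|)%N.
  rewrite card_in_imset; last first.
    move=> A B; rewrite !inE => /andP[_ xA] /andP[_ xB] AB.
    by rewrite -(setD1K xA) AB setD1K.
  rewrite -(cardsID [set A : {set T} | x \in A] F) addnC; congr (_ + _)%N;
    by apply: eq_card => A; rewrite !inE // andbC.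
have cR : (#|R :\ x| <= n)%N by rewrite (cardsD1 x R) xR in Rn.
have sub0 : F0 \subset powerset (R :\ x).
  apply/subsetP => A; rewrite !inE => /andP[AF xA].
  by rewrite subsetD1 xA andbT -powersetE (subsetP FR).
have sub1 : F1 \subset powerset (R :\ x).
  apply/subsetP => _ /imsetP[A /setIdP[AF xA] ->].
  by rewrite powersetE setSD // -powersetE (subsetP FR).
pose Sh F := [set S | shatters F S].
have x0 S : S \in Sh F0 -> x \notin S.
  rewrite inE => /shattersP h; apply/negP => xS.
  have [|A] := h [set x]; first by rewrite sub1set.
  rewrite inE => /andP[_ /negP xA] AS; apply: xA.
  by have := set11 x; rewrite -AS inE => /andP[].
have x1 S : S \in Sh F1 -> x \notin S.
  rewrite inE => /shattersP h; apply/negP => xS.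
  have [|B /imsetP[A _ ->] AS] := h [set x]; first by rewrite sub1set.
  by have := set11 x; rewrite -AS !inE eqxx.
have S0 : Sh F0 \subset Sh F.
  apply/subsetP => S; rewrite !inE => /shattersP h; apply/shattersP => U /h[A].
  by rewrite inE => /andP[AF _] <-; exists A.
have S1 : Sh F1 \subset Sh F.
  apply/subsetP => S SS; have xS := x1 _ SS.
  move: SS; rewrite !inE => /shattersP h; apply/shattersP => U /h[B /imsetP[A]].
  rewrite inE => /andP[AF _] -> <-; exists A => //.
  apply/setP => y; rewrite !inE; case: eqVneq => [->|//].
  by rewrite (negPf xS) !andbF.
(* These sets contain [x], unlike those shattered by [F0] or [F1], so they supply exactly the
   overlap lost in the union of the two collections. *)
pose Shx : {set {set T}} := [set x |: (S : {set T}) | S in Sh F0 :&: Sh F1].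
have S01 : Shx \subset Sh F.
  apply/subsetP => _ /imsetP[S /setIP[SS0 SS1] ->].
  have xS := x0 _ SS0.
  move: SS0 SS1; rewrite !inE => /shattersP h0 /shattersP h1.
  apply/shattersP => U US; have [xU|xU] := boolP (x \in U).
    have [|B /imsetP[A /setIdP[AF xA] ->] AS] := h1 (U :\ x).
      by rewrite subDset.
    exists A => //; apply/setP => y; move/setP/(_ y): AS; rewrite !inE.
    by case: eqVneq => [->|//]; rewrite xA xU.
  have [|A /setIdP[AF xA] AS] := h0 U.
    apply/subsetP => y yU; have := subsetP US _ yU; rewrite !inE.
    by case: eqVneq => // yx; rewrite -yx yU in xU.
  exists A => //; apply/setP => y; move/setP/(_ y): AS; rewrite !inE.
  by case: eqVneq => [->|//]; rewrite (negPf xA) (negPf xU).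
rewrite cF; apply: (@leq_trans (#|Sh F0| + #|Sh F1|)).
  by apply: leq_add; [apply: (IH (R :\ x))|apply: (IH (R :\ x))].
rewrite -cardsUI.
have -> : #|Sh F0 :&: Sh F1| = #|Shx|.
  rewrite card_in_imset // => A B /setIP[/x0 xA _] /setIP[/x0 xB _] AB.
  by rewrite -(setU1K xA) AB setU1K.
rewrite -cardsUI.
have -> : (Sh F0 :|: Sh F1) :&: Shx = set0; last first.
  by rewrite cards0 addn0 subset_leq_card // !subUset S0 S1 S01.
apply/setP => A; rewrite !in_set0; apply/negP => /setIP[/setUP h /imsetP[S _ AS]].
have xA : x \in A by rewrite AS setU11.
by case: h => [/x0|/x1]; rewrite xA.
Qed.

End Shattering.

Section Antichains.

Lemma le_of_eq d (T : porderType d) (x y : T) : x = y -> (x <= y)%O.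
Proof. by move->. Qed.

Lemma leq_bin_step n j : (j.*2 < n)%N -> ('C(n, j) <= 'C(n, j.+1))%N.
Proof.
move=> jn; rewrite -(leq_pmul2l (ltn0Sn j)) mul_bin_left leq_mul2r.
by apply/orP; right; lia.
Qed.

Lemma leq_bin_half n j : ('C(n, j) <= 'C(n, n./2))%N.
Proof.
have half_le k : (k <= n./2)%N -> ('C(n, k) <= 'C(n, n./2))%N.
  move=> kn; have [d] := ubnP (n./2 - k)%N; elim: d k kn => // d IH k kn kd.
  move: kn; rewrite leq_eqVlt => /predU1P[->//|kn].
  apply: (leq_trans (leq_bin_step _)); first by lia.
  by apply: IH => //; lia.
have [|jn] := leqP j n./2; first exact: half_le.
have [nj|nj] := ltnP n j; first by rewrite bin_small.
by rewrite -bin_sub //; apply: half_le; lia.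
Qed.

Lemma bin_odd_half m : ('C(m.+1.*2, m.+1) = 2 * 'C(m.*2.+1, m.+1))%N.
Proof.
rewrite doubleS binS (_ : 'C(m.*2.+1, m) = 'C(m.*2.+1, m.+1)) ?addnn ?mul2n //.
by rewrite -(@bin_sub m.*2.+1 m.+1); [congr 'C(_, _); lia|lia].
Qed.

Lemma central_bin_bound m : ('C(m.*2, m) ^ 2 * m.*2.+1 <= 4 ^ m.*2)%N.
Proof.
elim: m => // m IH.
have e : (m.+1 * 'C(m.+1.*2, m.+1) = 2 * m.*2.+1 * 'C(m.*2, m))%N.
  have h := mul_bin_diag m.*2.+1 m; rewrite /= in h.
  rewrite bin_odd_half mulnCA -h; lia.
rewrite -(leq_pmul2l (_ : 0 < m.+1 ^ 2)%N) ?expn_gt0 //.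
have -> : (m.+1 ^ 2 * ('C(m.+1.*2, m.+1) ^ 2 * m.+1.*2.+1) =
          4 * m.*2.+1 * m.+1.*2.+1 * ('C(m.*2, m) ^ 2 * m.*2.+1))%N.
  by rewrite mulnA -expnMn e; ring.
apply: (leq_trans (leq_mul (leqnn _) IH)).
rewrite doubleS !expnS !mulnA leq_mul2r; apply/orP; right; lia.
Qed.

(** The estimate ['C(n, j) <= 2^n / sqrt (n + 1)], squared to remain in [nat]. An odd middle
    coefficient is half of the next even one. *)
Lemma bin_bound n j : ('C(n, j) ^ 2 * n.+1 <= 4 ^ n)%N.
Proof.
apply: (@leq_trans ('C(n, n./2) ^ 2 * n.+1)).
  by rewrite leq_mul2r leq_exp2r // leq_bin_half orbT.
have := odd_double_half n; set m := n./2; case: (odd n) => /= <-; last first.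
  by rewrite add0n central_bin_bound.
rewrite add1n; have := central_bin_bound m.+1; rewrite bin_odd_half.
rewrite (_ : 'C(m.*2.+1, m) = 'C(m.*2.+1, m.+1)); last first.
  by rewrite -(@bin_sub m.*2.+1 m.+1); [congr 'C(_, _); lia|lia].
set c := 'C(_, _); rewrite doubleS expnMn [in X in (_ <= X)%N -> _]expnS.
rewrite (_ : 2 ^ 2 = 4)%N // -mulnA leq_pmul2l // => /(leq_trans _); apply.
by rewrite leq_mul2l; apply/orP; right; lia.
Qed.

Variables (R : realFieldType) (T : finType).
Implicit Types (F : {set {set T}}) (A B J S : {set T}).

(* The sum is the probability that a random maximal chain starting at [S] meets
   [F]; it averages over the first step of the chain. *)
Lemma lym J F : F \subset powerset J ->
  (forall A B, A \in F -> B \in F -> A \subset B -> A = B) ->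
  forall S, S \subset J ->
  \sum_(A in F | S \subset A)
    ('C(#|J| - #|S|, #|A| - #|S|)%:R : R)^-1 <= 1.
Proof.
move=> FJ Fanti S; have [n] := ubnP (#|J| - #|S|)%N.
elim: n S => // n IH S nS SJ.
have [SF|SF] := boolP (S \in F).
  rewrite (big_pred1 S) ?subnn ?bin0 ?invr1 // => A /=.
  apply/andP/eqP => [[AF SA]|->]; last by rewrite SF.
  by rewrite (Fanti S A).
have [SeJ|neSJ] := eqVneq S J.
  rewrite big1 // => A /andP[AF SA]; move/subsetP: FJ => /(_ _ AF).
  rewrite powersetE -SeJ => AS; rewrite (_ : A = S) in AF; last first.
    by apply/eqP; rewrite eqEsubset AS.
  by rewrite AF in SF.
have SpJ : S \proper J by rewrite properEneq neSJ.
have cS := proper_card SpJ.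
(* With [N = #|J| - #|S|] and [k = #|A| - #|S|], each of the [k] first steps towards [A] has
   probability [1 / N], and [k 'C(N, k) = N 'C(N - 1, k - 1)]. *)
have step A : A \in F -> S \subset A ->
  ('C(#|J| - #|S|, #|A| - #|S|)%:R : R)^-1 =
  \sum_(x in A :\: S) (#|J| - #|S|)%:R^-1 *
     ('C(#|J| - #|S| - 1, #|A| - #|S| - 1)%:R)^-1.
  move=> AF SA; rewrite sumr_const.
  have AJ : A \subset J by rewrite -powersetE (subsetP FJ).
  have SA' : (#|S| < #|A|)%N.
    apply: proper_card; rewrite properEneq SA andbT.
    by apply: contraNneq SF => ->.
  have cAJ := subset_leq_card AJ.
  rewrite cardsD (setIidPr SA).
  have := mul_bin_diag (#|J| - #|S| - 1).+1 (#|A| - #|S| - 1).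
  rewrite (_ : (#|J| - #|S| - 1).+1 = #|J| - #|S|)%N; last lia.
  rewrite (_ : (#|A| - #|S| - 1).+1 = #|A| - #|S|)%N; last lia.
  rewrite (_ : (#|J| - #|S|).-1 = (#|J| - #|S| - 1))%N; last lia.
  move/(congr1 (fun k => k%:R : R)); rewrite !natrM => e.
  have b1 : ('C(#|J| - #|S|, #|A| - #|S|)%:R : R) != 0.
    by rewrite pnatr_eq0 -lt0n bin_gt0; lia.
  have b2 : ('C(#|J| - #|S| - 1, #|A| - #|S| - 1)%:R : R) != 0.
    by rewrite pnatr_eq0 -lt0n bin_gt0; lia.
  have b3 : ((#|J| - #|S|)%:R : R) != 0 by rewrite pnatr_eq0 -lt0n subn_gt0.
  rewrite -[RHS]mulr_natr; apply: (mulIf b1); rewrite mulVf // -[RHS]mulrA -e.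
  by field; rewrite b2 b3.
rewrite (eq_bigr _ (fun A h => step A (andP h).1 (andP h).2)).
rewrite (exchange_big_dep (fun x => x \in J :\: S)) /=; last first.
  move=> A x /andP[AF SA]; rewrite !inE => /andP[-> xA] /=.
  by move/subsetP: FJ => /(_ _ AF); rewrite powersetE => /subsetP; apply.
apply: (@le_trans _ _ (\sum_(x in J :\: S) (#|J| - #|S|)%:R^-1)); last first.
  rewrite sumr_const cardsD (setIidPr SJ) -[leLHS]mulr_natr mulVf //.
  by rewrite pnatr_eq0; lia.
apply: ler_sum => x; rewrite inE => /andP[xS xJ].
rewrite -big_distrr /= -[leRHS]mulr1 ler_wpM2l ?invr_ge0 ?ler0n //.
have xSJ : x |: S \subset J by rewrite subUset sub1set xJ.
apply: le_trans (IH (x |: S) _ xSJ); rewrite ?cardsU1 ?xS /=; last lia.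
rewrite add1n !subnS !subn0 [leRHS](eq_bigl
  (fun A => [&& A \in F, S \subset A & x \in A :\: S])) //.
  apply: le_of_eq.
  by apply: eq_big => A; rewrite ?andbA // !subn1 !subnS.
by move=> A; rewrite subUset sub1set !inE xS /= [(x \in A) && _]andbC.
Qed.

(** Sperner's theorem: in the sum of [lym] started at the empty set every term is at least the
    inverse of the middle binomial coefficient. *)
Lemma antichain_card J F : F \subset powerset J ->
  (forall A B, A \in F -> B \in F -> A \subset B -> A = B) ->
  (#|F| ^ 2 * #|J|.+1 <= 4 ^ #|J|)%N.
Proof.
move=> FJ Fanti; apply: leq_trans (bin_bound #|J| #|J|./2).
rewrite leq_mul2r leq_exp2r //; apply/orP; right.
have := lym FJ Fanti (sub0set J).
rewrite cards0 !subn0 (eq_bigl (fun A => A \in F)); last first.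
  by move=> A; rewrite sub0set andbT.
set b := 'C(_, _); have b0 : (0 < b)%N by rewrite bin_gt0; lia.
move=> h; rewrite -(ler_nat R); apply: le_trans (_ : b%:R * 1 <= _); last by rewrite mulr1.
rewrite -ler_pdivrMl ?ltr0n //; apply: le_trans h.
rewrite mulr_natr -sumr_const; apply: ler_sum => A AF.
have A0 : (0 < 'C(#|J|, #|A|))%N.
  by rewrite bin_gt0 subset_leq_card // -powersetE (subsetP FJ).
by rewrite subn0 lef_pV2 ?posrE ?ltr0n // ler_nat leq_bin_half.
Qed.

End Antichains.

(** * Littlewood-Offord bounds for subset sums *)

Section LittlewoodOfford.
Variables (R : rcfType) (T : finType).
Implicit Types (A J S U : {set T}).

(** Erdős's argument. Toggling membership of the indices with negative coefficient replaces each
    [d i] by its absolute value, up to a constant shift of the sum. Two nested distinct sets then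
    have sums more than [2 * th] apart, so the counted sets form an antichain after the toggle. *)
Lemma littlewood_offord_real (d : T -> R) J (th z : R) :
  (forall i, i \in J -> 2 * th < `|d i|) ->
  #|[set U : {set T} | (U \subset J) && (`|\sum_(i in U) d i - z| <= th)]|%:R
    <= 2 ^+ #|J| / Num.sqrt (#|J|.+1%:R : R).
Proof.
move=> dJ; set F := [set U | _]; pose N := [set i in J | d i < 0].
pose fl U := (U :\: N) :|: (N :\: U).
have flK : involutive fl.
  move=> U; apply/setP => i; rewrite /fl !inE.
  by case: (i \in U); case: (d i < 0); case: (i \in J).
have NJ : N \subset J by apply/subsetP => i; rewrite inE => /andP[].
have flE U : U \subset J ->
    \sum_(i in fl U) `|d i| = \sum_(i in U) d i - \sum_(i in N) d i.
  move=> UJ; rewrite (big_mkcond (mem (fl U))) (big_mkcond (mem U)).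
  rewrite (big_mkcond (mem N)) -sumrB; apply: eq_bigr => i _.
  rewrite /fl !inE; have := subsetP UJ i.
  case: (i \in U) => [/(_ isT) ->|_]; last case: (i \in J);
    case: ltP => /= di0; rewrite ?subrr ?subr0 ?sub0r //.
    by rewrite ger0_norm.
  by rewrite ltr0_norm.
have flJ U : U \subset J -> fl U \subset J.
  move=> UJ; rewrite subUset (subset_trans (subsetDl _ _)) //.
  exact: subset_trans (subsetDl _ _) NJ.
have cF : #|F| = #|fl @: F| by rewrite card_imset //; exact: inv_inj.
have flF : fl @: F \subset powerset J.
  apply/subsetP => V /imsetP[U]; rewrite !inE => /andP[UJ _] ->.
  exact: flJ.
have anti A B : A \in fl @: F -> B \in fl @: F -> A \subset B -> A = B.
  case/imsetP => U; rewrite inE => /andP[UJ Uz] ->{A}.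
  case/imsetP => V; rewrite inE => /andP[VJ Vz] -> UV.
  apply/eqP; rewrite eqEproper UV /=; apply/negP => UVp.
  have [_ [i iV iU]] := properP UVp.
  have : \sum_(i in U) d i + 2 * th < \sum_(i in V) d i.
    rewrite -(ltrD2r (- \sum_(i in N) d i)) -flE // addrAC -flE //.
    rewrite [X in _ < X](big_setID (fl U)) /= (setIidPr UV) ltrD2l.
    rewrite (bigD1 i) /=; last by rewrite inE iU.
    apply: ltr_wpDr; first by apply: sumr_ge0 => *.
    by apply: dJ; apply: (subsetP (flJ _ VJ)).
  by move: Uz Vz; rewrite !ler_norml => /andP[? ?] /andP[? ?]; lra.
have := antichain_card R flF anti; rewrite -cF.
rewrite -(ler_nat R) natrM !natrX => h.
rewrite ler_pdivlMr ?sqrtr_gt0 ?ltr0n //.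
rewrite -(@ler_pXn2r _ 2) ?nnegrE ?mulr_ge0 ?sqrtr_ge0 ?exprn_ge0 ?ler0n //.
rewrite exprMn sqr_sqrtr ?ler0n //; apply: le_trans h _.
by rewrite exprAC -[2 ^+ 2]natrX.
Qed.

(** Once the part of [U] outside [J] is fixed, it only moves the centre [z]; the bound of the
    previous lemma is uniform in the centre. *)
Lemma littlewood_offord_sub (d : T -> R) J J0 (th z : R) : J \subset J0 ->
  (forall i, i \in J -> 2 * th < `|d i|) ->
  #|[set U : {set T} | (U \subset J0) && (`|\sum_(i in U) d i - z| <= th)]|%:R
    <= 2 ^+ #|J0| / Num.sqrt (#|J|.+1%:R : R).
Proof.
move=> JJ0 dJ; set F := [set U | _].
have cJ0 : (#|J0| = #|J0 :\: J| + #|J|)%N.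
  by rewrite cardsD (setIidPr JJ0) subnK // subset_leq_card.
rewrite cJ0 exprD -mulrA -sum1_card.
rewrite (partition_big (fun U => U :\: J) (fun V => V \in powerset (J0 :\: J)));
  last by move=> U; rewrite !inE => /andP[UJ _]; apply: setSD.
rewrite natr_sum -natrX -card_powerset mulr_natl -sumr_const.
apply: ler_sum => V _; rewrite sum1_card.
apply: le_trans (littlewood_offord_real (z - \sum_(i in V) d i) dJ).
rewrite ler_nat -(card_in_imset (f := fun U => U :&: J)); last first.
  move=> A B /andP[_ /eqP AV] /andP[_ /eqP BV] AB.
  by rewrite -(setID A J) -(setID B J) AV BV AB.
apply: subset_leq_card; apply/subsetP => W /imsetP[U /andP[UF /eqP UV] ->].
move: UF; rewrite !inE subsetIr => /andP[UJ0 h] /=.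
by rewrite opprB addrA -UV -big_setID.
Qed.

End LittlewoodOfford.

(** * Squared norms of complex vectors *)

Section SquaredNorm.
Variable R : rcfType.
Implicit Types (z w : R[i]).

(** The squared modulus as a real number: estimates become polynomial inequalities, without square
    roots. *)
Definition nsq z : R := complex.Re z ^+ 2 + complex.Im z ^+ 2.

Lemma nsq_ge0 z : 0 <= nsq z.
Proof. by rewrite addr_ge0 ?sqr_ge0. Qed.

Lemma nsq0 : nsq 0 = 0.
Proof. by rewrite /nsq /= expr0n addr0. Qed.

Lemma nsq_eq0 z : (nsq z == 0) = (z == 0).
Proof.
by case: z => x y; rewrite /nsq paddr_eq0 ?sqr_ge0 //= !sqrf_eq0 eq_complex.
Qed.

Lemma nsqM z w : nsq (z * w) = nsq z * nsq w.
Proof. by case: z w => [a b] [c d]; rewrite /nsq /=; ring. Qed.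

Lemma nsqN z : nsq (- z) = nsq z.
Proof. by case: z => a b; rewrite /nsq /= !sqrrN. Qed.

Lemma nsqC z : nsq (z^*)%C = nsq z.
Proof. by case: z => a b; rewrite /nsq /= sqrrN. Qed.

Lemma nsq_real (x : R) : nsq (x%:C) = x ^+ 2.
Proof. by rewrite /nsq /= expr0n addr0. Qed.

Lemma nsq1 : nsq 1 = 1.
Proof. by rewrite (nsq_real 1) expr1n. Qed.

Lemma nsqD_le z w : nsq (z + w) <= 2 * nsq z + 2 * nsq w.
Proof.
by case: z w => [a b] [c d]; rewrite /nsq /=;
   have := sqr_ge0 (a - c); have := sqr_ge0 (b - d); nra.
Qed.

Lemma nsqB_le z w : nsq (z - w) <= 2 * nsq z + 2 * nsq w.
Proof. by rewrite -(nsqN w) nsqD_le. Qed.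

Lemma nsq_parallelogram z w :
  nsq (z + w) + nsq (z - w) = 2 * nsq z + 2 * nsq w.
Proof. by case: z w => [a b] [c d]; rewrite /nsq /=; ring. Qed.

Lemma mul_conj_nsq z : z * (z^*)%C = (nsq z)%:C.
Proof.
by case: z => a b; apply/eqP; rewrite eq_complex /nsq /=; apply/andP; split;
   apply/eqP; ring.
Qed.

Lemma nsq_normc z : nsq z = ComplexField.Normc.normc z ^+ 2.
Proof. by case: z => a b; rewrite /= sqr_sqrtr ?addr_ge0 ?sqr_ge0. Qed.

Lemma Re_sum (I : Type) (r : seq I) (P : pred I) (F : I -> R[i]) :
  complex.Re (\sum_(i <- r | P i) F i) = \sum_(i <- r | P i) complex.Re (F i).
Proof. by apply: (big_morph (@complex.Re R)) => // -[a b] [c d]. Qed.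

Lemma Im_sum (I : Type) (r : seq I) (P : pred I) (F : I -> R[i]) :
  complex.Im (\sum_(i <- r | P i) F i) = \sum_(i <- r | P i) complex.Im (F i).
Proof. by apply: (big_morph (@complex.Im R)) => // -[a b] [c d]. Qed.

Lemma ReB z w : complex.Re (z - w) = complex.Re z - complex.Re w.
Proof. by case: z w => [a b] [c d]. Qed.

Lemma ImB z w : complex.Im (z - w) = complex.Im z - complex.Im w.
Proof. by case: z w => [a b] [c d]. Qed.

End SquaredNorm.

Section ComplexLittlewoodOfford.
Variables (R : rcfType) (T : finType).
Implicit Types (J U : {set T}).

(** Each coefficient has a real or an imaginary part with square above [4 * t2], so one of the two
    kinds covers half of [J]. Halving [J] costs the factor [sqrt 2]. *)
Lemma littlewood_offord (d : T -> R[i]) J J0 (t2 : R) (z : R[i]) :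
  0 <= t2 -> J \subset J0 -> (forall i, i \in J -> 8 * t2 < nsq (d i)) ->
  #|[set U : {set T} | (U \subset J0) && (nsq (\sum_(i in U) d i - z) <= t2)]|%:R
    <= 2 ^+ #|J0| * Num.sqrt (2 : R) / Num.sqrt (#|J|.+1%:R : R).
Proof.
move=> t0 JJ0 dJ; set F := [set U | _].
have half (g : R[i] -> R) :
    (forall U, g (\sum_(i in U) d i - z) = \sum_(i in U) g (d i) - g z) ->
    (forall x, g x ^+ 2 <= nsq x) ->
    (#|J| <= #|[set i in J | (4 * t2 < g (d i) ^+ 2)%R]|.*2)%N ->
    #|F|%:R <= 2 ^+ #|J0| * Num.sqrt (2 : R) / Num.sqrt (#|J|.+1%:R : R).
  move=> gD gn; set J1 := [set i in J | _] => cJ1.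
  have sJ1 : J1 \subset J0.
    by apply: subset_trans JJ0; apply/subsetP => i; rewrite inE => /andP[].
  apply: le_trans (_ : 2 ^+ #|J0| / Num.sqrt (#|J1|.+1%:R : R) <= _); last first.
    rewrite -mulrA ler_wpM2l ?exprn_ge0 //.
    rewrite -[leLHS]mul1r ler_pdivrMr ?sqrtr_gt0 ?ltr0n // mulrAC.
    rewrite ler_pdivlMr ?sqrtr_gt0 ?ltr0n // mul1r -sqrtrM // ler_wsqrtr //.
    by rewrite -natrM ler_nat; lia.
  have dJ1 i : i \in J1 -> 2 * Num.sqrt t2 < `|g (d i)|.
    rewrite inE => /andP[_ h]; rewrite -(@ltr_pXn2r _ 2) ?nnegrE ?mulr_ge0 ?sqrtr_ge0 //.
    rewrite exprMn sqr_sqrtr // -normrX ger0_norm ?sqr_ge0 //.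
    by apply: le_lt_trans h; rewrite -natrX.
  apply: le_trans (littlewood_offord_sub (g z) sJ1 dJ1).
  rewrite ler_nat; apply: subset_leq_card; apply/subsetP => U.
  rewrite !inE => /andP[-> /= h]; rewrite -gD -(@ler_pXn2r _ 2) ?nnegrE ?sqrtr_ge0 //.
  by rewrite -normrX sqr_sqrtr // ger0_norm ?sqr_ge0 // (le_trans (gn _)).
pose J1 := [set i in J | 4 * t2 < complex.Re (d i) ^+ 2].
pose J2 := [set i in J | 4 * t2 < complex.Im (d i) ^+ 2].
have cJ : (#|J| <= #|J1| + #|J2|)%N.
  rewrite -cardsUI; apply: leq_trans (leq_addr _ _).
  apply/subset_leq_card/subsetP => i iJ; rewrite !inE iJ /= -implyNb -leNgt.
  by apply/implyP => h; have := dJ _ iJ; rewrite /nsq; lra.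
have [h|h] := leqP #|J| #|J1|.*2.
  apply: (half (@complex.Re R)) => // [U|x]; last by rewrite lerDl sqr_ge0.
  by rewrite ReB Re_sum.
apply: (half (@complex.Im R)) => // [U|x|].
- by rewrite ImB Im_sum.
- by rewrite lerDr sqr_ge0.
- by rewrite -/J2; lia.
Qed.

End ComplexLittlewoodOfford.

Section VectorNorm.
Variable R : rcfType.
Local Notation C := R[i].

Definition N2on n (S : {set 'I_n}) (x : 'cV[C]_n) : R :=
  \sum_(i in S) nsq (x i 0).
Definition N2 n (x : 'cV[C]_n) : R := \sum_i nsq (x i 0).
(** An operator norm bound, with [s2] the square of the norm bound. *)
Definition opb m n (A : 'M[C]_(m, n)) (s2 : R) :=
  forall x : 'cV[C]_n, N2 (A *m x) <= s2 * N2 x.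

Lemma N2_ge0 n (x : 'cV[C]_n) : 0 <= N2 x.
Proof. by apply: sumr_ge0 => i _; apply: nsq_ge0. Qed.

Lemma N2on_ge0 n S (x : 'cV[C]_n) : 0 <= N2on S x.
Proof. by apply: sumr_ge0 => i _; apply: nsq_ge0. Qed.

Lemma N2on_le n S (x : 'cV[C]_n) : N2on S x <= N2 x.
Proof.
by rewrite /N2 (bigID (mem S)) /= lerDl; apply: sumr_ge0 => i _; apply: nsq_ge0.
Qed.

Lemma N2on_sub n (S S' : {set 'I_n}) (x : 'cV[C]_n) :
  S \subset S' -> N2on S x <= N2on S' x.
Proof.
move=> SS'; rewrite /N2on [leRHS](big_setID S) /= (setIidPr SS') lerDl.
by apply: sumr_ge0 => i _; apply: nsq_ge0.
Qed.

Lemma N20 n : N2 (0 : 'cV[C]_n) = 0.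
Proof. by rewrite /N2 big1 // => i _; rewrite mxE nsq0. Qed.

Lemma N2_eq0 n (x : 'cV[C]_n) : (N2 x == 0) = (x == 0).
Proof.
apply/eqP/eqP => [|->]; last exact: N20.
move/eqP; rewrite psumr_eq0 => [/allP h|i _]; last exact: nsq_ge0.
apply/matrixP => i j; rewrite ord1 mxE; apply/eqP.
by rewrite -nsq_eq0; apply: h; rewrite mem_index_enum.
Qed.

Lemma N2N n (x : 'cV[C]_n) : N2 (- x) = N2 x.
Proof. by apply: eq_bigr => i _; rewrite mxE nsqN. Qed.

Lemma N2Z n a (x : 'cV[C]_n) : N2 (a *: x) = nsq a * N2 x.
Proof. by rewrite /N2 mulr_sumr; apply: eq_bigr => i _; rewrite mxE nsqM. Qed.

Lemma N2onZ n S a (x : 'cV[C]_n) : N2on S (a *: x) = nsq a * N2on S x.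
Proof. by rewrite /N2on mulr_sumr; apply: eq_bigr => i _; rewrite mxE nsqM. Qed.

Lemma N2onD_le n S (x y : 'cV[C]_n) :
  N2on S (x + y) <= 2 * N2on S x + 2 * N2on S y.
Proof.
rewrite /N2on !mulr_sumr -big_split; apply: ler_sum => i _ /=.
by rewrite mxE nsqD_le.
Qed.

Lemma N2onB_le n S (x y : 'cV[C]_n) :
  N2on S (x - y) <= 2 * N2on S x + 2 * N2on S y.
Proof.
rewrite /N2on !mulr_sumr -big_split; apply: ler_sum => i _ /=.
by rewrite !mxE nsqB_le.
Qed.

Lemma N2onT n (x : 'cV[C]_n) : N2on [set: 'I_n] x = N2 x.
Proof. by apply: eq_bigl => i; rewrite inE. Qed.

Lemma N2D_le n (x y : 'cV[C]_n) : N2 (x + y) <= 2 * N2 x + 2 * N2 y.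
Proof. by rewrite -!N2onT N2onD_le. Qed.

Lemma N2_parallelogram n (x y : 'cV[C]_n) :
  N2 (x + y) + N2 (x - y) = 2 * N2 x + 2 * N2 y.
Proof.
rewrite /N2 !mulr_sumr -!big_split; apply: eq_bigr => i _ /=.
by rewrite !mxE nsq_parallelogram.
Qed.

(** The cross term [2 Re (a conj(z w))] has square at most [4 A B |z|^2 |w|^2], hence is at most
    [A |w|^2 + B |z|^2] by the inequality between the arithmetic and geometric means. *)
Lemma cauchy_schwarz_step (a z w : C) (A B : R) : 0 <= A -> 0 <= B ->
  nsq a <= A * B -> nsq (a + z * w) <= (A + nsq z) * (B + nsq w).
Proof.
move=> A0 B0 aAB.
have := nsq_ge0 a; have := nsq_ge0 z; have := nsq_ge0 w.
have key : nsq (a + z * w) <= nsq a + nsq z * nsq w + (A * nsq w + B * nsq z).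
  set X := 2 * complex.Re (a * (z * w)^*%C).
  have -> : nsq (a + z * w) = nsq a + nsq z * nsq w + X.
    rewrite /X -nsqM; move: (z * w) => [c d]; case: (a) => x y.
    by rewrite /nsq /=; ring.
  rewrite lerD2l; set Y := A * nsq w + B * nsq z.
  have Y0 : 0 <= Y by rewrite addr_ge0 ?mulr_ge0 ?nsq_ge0.
  apply: le_trans (ler_norm _) _.
  rewrite -(@ler_pXn2r _ 2) ?nnegrE // -normrX ger0_norm ?sqr_ge0 //.
  apply: le_trans (_ : 4 * (nsq a * (nsq z * nsq w)) <= _).
    rewrite /X -(nsqM z); move: (z * w) => [c d]; case: (a) => x y.
    by rewrite /nsq /=; have := sqr_ge0 (x * d - y * c); nra.
  have := ler_wpM2r (mulr_ge0 (nsq_ge0 z) (nsq_ge0 w)) aAB.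
  have := sqr_ge0 (A * nsq w - B * nsq z); rewrite /Y.
  by move: (nsq a) (nsq z) (nsq w) => p q r; nra.
by move=> _ _ _; apply: le_trans key _; lra.
Qed.

Lemma cauchy_schwarz (I : Type) (r : seq I) (P : pred I) (z w : I -> C) :
  nsq (\sum_(i <- r | P i) z i * w i) <=
  (\sum_(i <- r | P i) nsq (z i)) * (\sum_(i <- r | P i) nsq (w i)).
Proof.
suff : [/\ 0 <= \sum_(i <- r | P i) nsq (z i),
    0 <= \sum_(i <- r | P i) nsq (w i) &
  nsq (\sum_(i <- r | P i) z i * w i) <=
  (\sum_(i <- r | P i) nsq (z i)) * (\sum_(i <- r | P i) nsq (w i))] by case.
split; try by apply: sumr_ge0 => i _; apply: nsq_ge0.
elim: r => [|i r IH]; first by rewrite !big_nil nsq0 mulr0.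
rewrite !big_cons; case: ifP => // _.
rewrite addrC [X in _ <= X * _]addrC [X in _ <= _ * X]addrC.
by apply: cauchy_schwarz_step => //; apply: sumr_ge0 => j _; apply: nsq_ge0.
Qed.

Lemma conjCE (z : C) : Num.conj z = (z^*)%C. Proof. by []. Qed.

Lemma N2E n (x : 'cV[C]_n) : (N2 x)%:C = (x^t* *m x) 0 0.
Proof.
rewrite mxE /N2 rmorph_sum; apply: eq_bigr => i _ /=.
by rewrite !mxE -mul_conj_nsq mulrC.
Qed.

(** With [y = A v], [|y|^4] is the squared pairing of the adjoint image of [y] with [v], hence at
    most [s2 |y|^2 |v|^2]; then divide by [|y|^2]. *)
Lemma opb_adj m n (A : 'M[C]_(m, n)) s2 : 0 <= s2 -> opb (A^t*) s2 -> opb A s2.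
Proof.
move=> s0 h v; set y := A *m v.
have [->|y0] := eqVneq (N2 y) 0; first by rewrite mulr_ge0 ?N2_ge0.
have ygt0 : 0 < N2 y by rewrite lt_neqAle eq_sym y0 N2_ge0.
rewrite -(ler_pM2l ygt0) -expr2.
have -> : N2 y ^+ 2 = nsq (\sum_i (((A^t*) *m y)^t* 0 i) * v i 0).
  rewrite -nsq_real N2E; congr nsq.
  rewrite {2}/y mulmxA [LHS]mxE; apply: eq_bigr => i _; congr (_ * _).
  by rewrite [in RHS]trmx_mul [in RHS]map_mxM /= trmxCK.
apply: le_trans (cauchy_schwarz _ _ _ _) _; rewrite -/(N2 v).
rewrite (mulrA (N2 y)) (mulrC (N2 y)); apply: ler_wpM2r; first exact: N2_ge0.
apply: le_trans (h y).
by rewrite /N2; apply: le_of_eq; apply: eq_bigr => i _;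
  rewrite !mxE conjCE nsqC.
Qed.

Lemma N2_unitary m n (Q : 'M[C]_(m, n)) : Q^t* *m Q = 1%:M ->
  forall x, N2 (Q *m x) = N2 x.
Proof.
move=> QQ x; apply: (@complexI R); rewrite !N2E trmx_mul map_mxM /=.
by rewrite -mulmxA [Q^t* *m _]mulmxA QQ mul1mx.
Qed.

Lemma bessel m n (Q : 'M[C]_(m, n)) : Q *m Q^t* = 1%:M ->
  forall x, N2 (Q *m x) <= N2 x.
Proof.
move=> QQ x; rewrite -[leRHS]mul1r; apply: opb_adj => // y.
by rewrite mul1r (@N2_unitary n m) ?lexx // trmxCK.
Qed.

Lemma opb_tr m n (A : 'M[C]_(m, n)) s2 : 0 <= s2 -> opb A s2 -> opb (A^T) s2.
Proof.
move=> s0 h; apply: opb_adj => // x; rewrite trmxK.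
have cj k (z : 'cV[C]_k) : N2 (map_mx Num.conj z) = N2 z.
  by apply: eq_bigr => i _; rewrite mxE conjCE nsqC.
have -> : map_mx Num.conj A *m x = map_mx Num.conj (A *m map_mx Num.conj x).
  rewrite map_mxM /=; congr (_ *m _); apply/matrixP => i j.
  by rewrite !mxE conjCK.
by rewrite cj -(cj _ x).
Qed.

Lemma rank_sum (I : Type) (r : seq I) (P : pred I) m n (F : I -> 'M[C]_(m, n)) :
  (\rank (\sum_(i <- r | P i) F i)%R <= \sum_(i <- r | P i) \rank (F i))%N.
Proof.
elim/big_rec2: _ => [|i k A _ IH]; first by rewrite mxrank0.
by apply: leq_trans (mxrank_add _ _) _; rewrite leq_add2l.
Qed.

Definition ind_mx n (S : {set 'I_n}) : 'M[C]_n := \sum_(i in S) delta_mx i i.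

Lemma rank_ind_mx n (S : {set 'I_n}) : (\rank (ind_mx S) <= #|S|)%N.
Proof.
apply: leq_trans (rank_sum _ _ _) _; rewrite -sum1_card.
by apply: leq_sum => i _; rewrite mxrank_delta.
Qed.

Lemma ind_mxE n (S : {set 'I_n}) i j :
  ind_mx S i j = if (i == j) && (i \in S) then 1 else 0.
Proof.
rewrite summxE; have [iS|iS] := boolP (i \in S); rewrite ?andbT ?andbF.
  rewrite (bigD1 i) //= mxE eqxx eq_sym big1 ?addr0 => [|k /andP[_ ki]].
    by rewrite eq_sym; case: eqP.
  by rewrite mxE eq_sym (negPf ki).
rewrite big1 // => k kS; rewrite mxE; case: eqVneq => // ik.
by rewrite ik kS in iS.
Qed.

Lemma mul_ind_mx m n (A : 'M[C]_(m, n)) (S : {set 'I_n}) i j :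
  (A *m ind_mx S) i j = if j \in S then A i j else 0.
Proof.
rewrite mxE (bigD1 j) //= ind_mxE eqxx /= big1 ?addr0 => [|k kj].
  by case: ifP; rewrite ?mulr1 ?mulr0.
by rewrite ind_mxE (negPf kj) mulr0.
Qed.

(** The row vectors supported on [D] and orthogonal to the at most [#|S|] nonzero columns of [H]
    form a kernel of dimension at least [#|D| - #|S|]; the rows of [Q] are an orthonormal basis of
    it. *)
Lemma orthonormal_annihilator n (H : 'M[C]_n) (D S : {set 'I_n}) m :
  (forall i j, j \notin S -> H i j = 0) -> (m + #|S| <= #|D|)%N ->
  exists l (Q : 'M[C]_(l, n)), [/\ (m <= l)%N, Q *m Q^t* = 1%:M,
    forall k i, i \notin D -> Q k i = 0 & Q *m H = 0].
Proof.
move=> HS mSD; set K := row_mx H (ind_mx (~: D)).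
have HE : H = H *m ind_mx S.
  apply/matrixP => i j; rewrite mul_ind_mx; case: ifPn => // /HS -> //.
have rK : (\rank K <= #|S| + #|~: D|)%N.
  have -> : K = H *m row_mx 1%:M 0 + ind_mx (~: D) *m row_mx 0 1%:M.
    by rewrite !mul_mx_row !mulmx1 !mulmx0 add_row_mx addr0 add0r.
  apply: leq_trans (mxrank_add _ _) _; apply: leq_add.
    apply: leq_trans (mxrankM_maxl _ _) _; rewrite HE.
    by apply: leq_trans (mxrankM_maxr _ _) (rank_ind_mx _).
  by apply: leq_trans (mxrankM_maxl _ _) (rank_ind_mx _).
have cD := cardsC D; rewrite card_ord in cD.
have rker : (m <= \rank (kermx K))%N by rewrite mxrank_ker; lia.
set V := row_base (kermx K).
have ln : (\rank (kermx K) <= n)%N by apply: rank_leq_row.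
exists (\rank (kermx K)), (schmidt V).
have QK : schmidt V *m K = 0.
  apply/sub_kermxP; rewrite (eqmx_schmidt_free (row_base_free _)).
  by rewrite eq_row_base.
have [QH QD] : schmidt V *m H = 0 /\ schmidt V *m ind_mx (~: D) = 0.
  by apply/eq_row_mx; rewrite -mul_mx_row QK row_mx0.
split => //; first by apply/eqP; have := schmidt_unitarymx V ln; rewrite qualifE.
move=> k i iD; have /matrixP/(_ k i) := QD.
by rewrite mul_ind_mx inE iD mxE.
Qed.

(** Greedy choice of signs: by the parallelogram identity, one of [a + c x] and [a - c x] has
    squared norm at least [N2 a + N2 (c x)]. *)
Lemma exists_signs n l (c : 'I_n -> 'cV[C]_l) (D : {set 'I_n}) :
  exists2 U : {set 'I_n}, U \subset D &
  \sum_(i in D) N2 (c i) <= N2 (\sum_(i in U) c i - \sum_(i in D :\: U) c i).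
Proof.
have [k] := ubnP #|D|; elim: k D => // k IH D kD.
have [->|[x xD]] := set_0Vmem D.
  by exists set0; rewrite ?sub0set // !big_set0 N2_ge0.
have [|U UD hU] := IH (D :\ x); first by move: kD; rewrite (cardsD1 x D) xD.
have xU : x \notin U by apply/negP => /(subsetP UD); rewrite !inE eqxx.
have {}UD' : U \subset D := subset_trans UD (subsetDl _ _).
set a := \sum_(i in U) c i - _ in hU.
have := N2_parallelogram a (c x) => par.
have [h|h] := leP (N2 a + N2 (c x)) (N2 (a + c x)).
  exists (x |: U); first by rewrite subUset sub1set xD.
  rewrite (big_setD1 x xD) /= addrC big_setU1 //=.
  rewrite (_ : D :\: (x |: U) = D :\ x :\: U); last by rewrite setDDl.
  apply: le_trans (_ : N2 a + N2 (c x) <= _); first by rewrite lerD2r.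
  by apply: le_trans h _; rewrite [a + c x]addrC /a addrA.
exists U => //.
have xDU : x \in D :\: U by rewrite inE xU.
rewrite (big_setD1 x xD) /= (big_setD1 x xDU) /=.
rewrite (_ : D :\: U :\ x = D :\ x :\: U); last by rewrite setDDl setDDl setUC.
have -> : \sum_(i in U) c i - (c x + \sum_(i in D :\ x :\: U) c i) = a - c x.
  by rewrite /a opprD addrA addrAC.
by clear -par h hU; lra.
Qed.

End VectorNorm.

(** * Finite product probability spaces *)

Section FiniteProduct.
Variables (R : rcfType) (K W : finType) (mu : K -> W -> R).
Hypothesis mu_ge0 : forall k w, 0 <= mu k w.
Hypothesis mu_sum : forall k, \sum_w mu k w = 1.
Local Notation Om := {ffun K -> W}.
Implicit Types (o : Om) (F G : Om -> R) (E : Om -> Prop) (D : {set K}).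

Definition pw o : R := \prod_k mu k (o k).
Definition Ex F : R := \sum_o pw o * F o.
Definition ind (P : Prop) : R := (`[< P >])%:R.
Definition Pr E : R := Ex (fun o => ind (E o)).
Definition merge D o o' : Om := [ffun k => if k \in D then o k else o' k].

Lemma ind_ge0 P : 0 <= ind P. Proof. exact: ler0n. Qed.

Lemma ind_le1 P : ind P <= 1. Proof. by rewrite /ind; case: asbool; rewrite ?ler01. Qed.

Lemma ind_le (P Q : Prop) : (P -> Q) -> ind P <= ind Q.
Proof.
move=> PQ; rewrite /ind; case: asboolP => [/PQ p|_]; last exact: ler0n.
by case: asboolP.
Qed.

Lemma ind_and (P Q : Prop) : ind (P /\ Q) = ind P * ind Q.
Proof. by rewrite /ind asbool_and; do 2 case: asbool; rewrite ?mulr1 ?mulr0. Qed.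

Lemma pw_ge0 o : 0 <= pw o.
Proof. by apply: prodr_ge0 => k _. Qed.

Lemma Ex_prod (g : K -> W -> R) :
  Ex (fun o => \prod_k g k (o k)) = \prod_k \sum_w mu k w * g k w.
Proof.
by rewrite bigA_distr_bigA; apply: eq_bigr => o _; rewrite -big_split.
Qed.

Lemma eq_Ex F G : F =1 G -> Ex F = Ex G.
Proof. by move=> FG; apply: eq_bigr => o _; rewrite FG. Qed.

Lemma Ex_le F G : (forall o, F o <= G o) -> Ex F <= Ex G.
Proof. by move=> FG; apply: ler_sum => o _; rewrite ler_wpM2l ?pw_ge0. Qed.

Lemma ExD F G : Ex (fun o => F o + G o) = Ex F + Ex G.
Proof. by rewrite /Ex -big_split; apply: eq_bigr => o _; rewrite mulrDr. Qed.

Lemma ExZ a F : Ex (fun o => a * F o) = a * Ex F.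
Proof. by rewrite /Ex mulr_sumr; apply: eq_bigr => o _; rewrite mulrCA. Qed.

Lemma Ex_cst a : Ex (fun=> a) = a.
Proof.
rewrite /Ex -mulr_suml -[RHS]mul1r; congr (_ * _).
rewrite (_ : \sum_o pw o = Ex (fun o => \prod_k (fun _ _ => 1) k (o k))).
  by rewrite (Ex_prod (fun _ _ => 1)) big1 // => k _; under eq_bigr do rewrite mulr1.
by apply: eq_bigr => o _; rewrite big1 ?mulr1.
Qed.

Lemma Ex_ge0 F : (forall o, 0 <= F o) -> 0 <= Ex F.
Proof. by move=> F0; apply: sumr_ge0 => o _; rewrite mulr_ge0 ?pw_ge0. Qed.

Lemma Ex_sum (I : Type) (r : seq I) (P : pred I) (F : I -> Om -> R) :
  Ex (fun o => \sum_(i <- r | P i) F i o) = \sum_(i <- r | P i) Ex (F i).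
Proof.
by rewrite /Ex exchange_big; apply: eq_bigr => o _; rewrite mulr_sumr.
Qed.

Lemma Ex_exchange (F : Om -> Om -> R) :
  Ex (fun o => Ex (fun o' => F o o')) = Ex (fun o' => Ex (fun o => F o o')).
Proof.
rewrite /Ex; under eq_bigr do rewrite mulr_sumr.
rewrite exchange_big; apply: eq_bigr => o _; rewrite mulr_sumr.
by apply: eq_bigr => o' _; rewrite mulrCA.
Qed.

Lemma Ex_le_cst F a : (forall o, F o <= a) -> Ex F <= a.
Proof. by move=> h; rewrite -[leRHS]Ex_cst Ex_le. Qed.

Lemma Ex_sqr F : Ex F ^+ 2 <= Ex (fun o => F o ^+ 2).
Proof.
have : 0 <= Ex (fun o => (F o - Ex F) ^+ 2).
  by apply: Ex_ge0 => o; apply: sqr_ge0.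
rewrite (@eq_Ex _ (fun o => F o ^+ 2 + ((- 2 * Ex F) * F o + Ex F ^+ 2))).
  by rewrite !ExD ExZ Ex_cst; move: (Ex F) => e; lra.
by move=> o; ring.
Qed.

Lemma mergeK D o o' : merge D (merge D o o') (merge D o' o) = o.
Proof. by apply/ffunP => k; rewrite !ffunE; case: (k \in D). Qed.

Lemma pw_merge D o o' : pw (merge D o o') * pw (merge D o' o) = pw o * pw o'.
Proof.
rewrite /pw -!big_split; apply: eq_bigr => k _ /=; rewrite !ffunE.
by case: (k \in D) => //; rewrite mulrC.
Qed.

(* Exchanging the coordinates in [D] of two independent samples preserves their
   joint law. *)
Lemma Ex_merge D F : Ex F = Ex (fun o => Ex (fun o' => F (merge D o o'))).
Proof.
transitivity (Ex (fun o => Ex (fun=> F o))).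
  by apply: eq_Ex => o; rewrite Ex_cst.
rewrite /Ex; under eq_bigr do rewrite mulr_sumr.
under [RHS]eq_bigr do rewrite mulr_sumr.
rewrite !pair_bigA /=.
rewrite [LHS](reindex (fun p => (merge D p.1 p.2, merge D p.2 p.1))) /=.
  by apply: eq_bigr => -[o o'] _ /=; rewrite !mulrA pw_merge.
apply: onW_bij; exists (fun p => (merge D p.1 p.2, merge D p.2 p.1));
  by case=> o o' /=; rewrite !mergeK.
Qed.

Lemma Pr_ge0 E : 0 <= Pr E.
Proof. by apply: Ex_ge0 => o; apply: ind_ge0. Qed.

Lemma Pr_le1 E : Pr E <= 1.
Proof. by apply: Ex_le_cst => o; apply: ind_le1. Qed.

Lemma Pr_sub E E' : (forall o, E o -> E' o) -> Pr E <= Pr E'.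
Proof. by move=> h; apply: Ex_le => o; apply: ind_le => /h. Qed.

Lemma Pr_or E E' : Pr (fun o => E o \/ E' o) <= Pr E + Pr E'.
Proof.
rewrite -ExD; apply: Ex_le => o; rewrite /ind asbool_or.
by do 2 case: asbool; rewrite ?addr0 ?add0r ?lexx // lerDl ler01.
Qed.

Lemma Pr_exists (I : finType) (E : I -> Om -> Prop) :
  Pr (fun o => exists i, E i o) <= \sum_i Pr (E i).
Proof.
rewrite -Ex_sum; apply: Ex_le => o.
rewrite {1}/ind; case: asboolP => [[i Ei]|_]; last first.
  by apply: sumr_ge0 => i _; apply: ind_ge0.
rewrite (bigD1 i) //= {1}/ind asboolT // lerDl.
by apply: sumr_ge0 => j _; apply: ind_ge0.
Qed.

Section Coordinates.
Variables (I : finType) (c : I -> K) (S : {set I}).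
Hypothesis c_inj : {in S &, injective c}.

(** The average of [Ex_merge] over all sets [c @: U]. When [c] is injective on [S], each coordinate
    [c i] is thereby picked by a fair coin from one of two samples, which makes results on random
    subsets applicable. *)
Lemma symmetrize F :
  Ex F = Ex (fun o => Ex (fun o' =>
    2^-1 ^+ #|S| * \sum_(U in powerset S) F (merge (c @: U) o o'))).
Proof.
transitivity (2^-1 ^+ #|S| * \sum_(U in powerset S) Ex F); last first.
  have -> : \sum_(U in powerset S) Ex F = \sum_(U in powerset S)
      Ex (fun o => Ex (fun o' => F (merge (c @: U) o o'))).
    by apply: eq_bigr => U _; rewrite -Ex_merge.
  rewrite -Ex_sum -ExZ.
  apply: eq_Ex => o.
  by rewrite ExZ -Ex_sum.
rewrite sumr_const card_powerset -[Ex F *+ _]mulr_natl natrX mulrA -exprMn.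
by rewrite mulVf ?expr1n ?mul1r // pnatr_eq0.
Qed.

Lemma merge_in (U : {set I}) o o' i : U \subset S -> i \in S ->
  merge (c @: U) o o' (c i) = if i \in U then o (c i) else o' (c i).
Proof.
move=> US iS; rewrite ffunE; congr (if _ then _ else _).
apply/imsetP/idP => [[j jU cij]|iU]; last by exists i.
by rewrite (c_inj iS (subsetP US _ jU) cij).
Qed.

(** The keys [c i] are distinct, so the expectation factors over them; a factor equal to one half
    with probability at least [p], and to one otherwise, has mean at most [1 - p / 2]. *)
Lemma Ex_half_pow (g : I -> W -> W -> bool) p :
  (forall i, i \in S ->
    p <= \sum_w \sum_w' mu (c i) w * mu (c i) w' * (g i w w')%:R) ->
  Ex (fun o => Ex (fun o' =>
    2^-1 ^+ #|[set i in S | g i (o (c i)) (o' (c i))]|)) <= (1 - p / 2) ^+ #|S|.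
Proof.
move=> gp.
pose h i w w' : R := if g i w w' then 2^-1 else 1.
pose G k w w' := \prod_(i in S | c i == k) h i w w'.
have -> : Ex (fun o => Ex (fun o' =>
    2^-1 ^+ #|[set i in S | g i (o (c i)) (o' (c i))]|)) =
    \prod_k \sum_w mu k w * \sum_w' mu k w' * G k w w'.
  rewrite -Ex_prod; apply: eq_Ex => o; rewrite -Ex_prod; apply: eq_Ex => o'.
  rewrite -prodr_const (eq_bigl (fun i => (i \in S) && g i (o (c i)) (o' (c i))));
    last by move=> i; rewrite inE.
  rewrite big_mkcondr (partition_big c xpredT) //=; apply: eq_bigr => k _.
  by apply: eq_bigr => i /andP[_ /eqP <-].
rewrite -prodr_const (partition_big c xpredT) //=.
have h0 i w w' : 0 <= h i w w' by rewrite /h; case: ifP; rewrite ?invr_ge0.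
apply: ler_prod => k _; apply/andP; split.
  apply: sumr_ge0 => w _; rewrite mulr_ge0 //; apply: sumr_ge0 => w' _.
  by rewrite mulr_ge0 //; apply: prodr_ge0.
have [[i /andP[iS /eqP cik]]|no] := pselect (exists i, (i \in S) && (c i == k)).
  have uniq j : (j \in S) && (c j == k) = (j == i).
    apply/andP/eqP => [[jS /eqP cj]|->]; last by rewrite cik.
    by apply: c_inj; rewrite // cj.
  rewrite (big_pred1 i) //.
  have sum1 : \sum_w \sum_w' mu k w * mu k w' = 1.
    under eq_bigr do rewrite -mulr_sumr mu_sum mulr1.
    exact: mu_sum.
  apply: (@le_trans _ _ (\sum_w \sum_w' mu k w * mu k w' -
      (\sum_w \sum_w' mu k w * mu k w' * (g i w w')%:R) / 2)).
    rewrite mulr_suml -sumrB; apply: ler_sum => w _.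
    rewrite mulr_suml -sumrB mulr_sumr; apply: ler_sum => w' _.
    rewrite /G (big_pred1 i) // /h; case: (g i w w') => /=;
      rewrite ?mulr1 ?mulr0 ?mul0r ?subr0 ?mulrA ?lexx //; lra.
  by rewrite sum1 lerD2l lerN2 ler_wpM2r ?invr_ge0 // -cik gp.
rewrite [leRHS]big1 => [|i ik]; last by case: no; exists i.
under eq_bigr => w _.
  under eq_bigr => w' _.
    rewrite /G big1 ?mulr1 => [|i ik]; last by case: no; exists i.
    over.
  rewrite mu_sum mulr1.
  over.
by rewrite mu_sum.
Qed.

End Coordinates.
End FiniteProduct.

(** * Small ball probabilities of sums of independent variables *)

Section SmallBall.
Variable R : realType.

(** Since [k] is at most [p j / 4], the factor [2^k] is below [exp (p j / 4)] and undoes only half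
    of the decay [exp (- p j / 2)]. *)
Lemma half_pow_bound (p : R) (j k : nat) : 0 <= p -> p <= 1 ->
  4 * k%:R <= p * j%:R ->
  (1 - p / 2) ^+ j * 2 ^+ k <= (1 + p * j%:R / 4)^-1.
Proof.
move=> p0 p1 kj.
have h1 : (1 - p / 2) ^+ j <= expR (- (p * j%:R / 2)).
  rewrite (_ : - (p * j%:R / 2) = j%:R * (- (p / 2))); last lra.
  rewrite expRM_natl; apply: lerXn2r; rewrite ?nnegrE ?expR_ge0 //; first lra.
  exact: expR_ge1Dx.
have h2 : 2 ^+ k <= expR (p * j%:R / 4) :> R.
  apply: (@le_trans _ _ (expR k%:R)); last by rewrite ler_expR; lra.
  rewrite -[k%:R]mulr1 expRM_natl; apply: lerXn2r; rewrite ?nnegrE ?expR_ge0 //.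
  by have := expR_ge1Dx (1 : R); lra.
apply: (@le_trans _ _ (expR (- (p * j%:R / 2)) * expR (p * j%:R / 4))).
  by apply: ler_pM => //; rewrite exprn_ge0 //; lra.
rewrite -expRD (_ : _ + _ = - (p * j%:R / 4)); last lra.
have ? : 0 <= p * j%:R / 4 by rewrite divr_ge0 // mulr_ge0.
rewrite expRN lef_pV2 ?posrE ?expR_gt0 ?expR_ge1Dx //; lra.
Qed.

Variables (K W : finType) (mu : K -> W -> R).
Hypothesis mu_ge0 : forall k w, 0 <= mu k w.
Hypothesis mu_sum : forall k, \sum_w mu k w = 1.

Definition pair_prob k (g : W -> W -> bool) : R :=
  \sum_w \sum_w' mu k w * mu k w' * (g w w')%:R.

(* A Kolmogorov-Rogozin inequality, reduced by symmetrization to the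
   Littlewood-Offord bound for sums with independent signs. *)
Lemma small_ball (I : finType) (c : I -> K) (S J : {set I})
    (Y : I -> W -> R[i]) (z : R[i]) (t2 p : R) :
  {in S &, injective c} -> J \subset S -> 0 <= t2 -> 0 < p -> p <= 1 ->
  (0 < #|J|)%N ->
  (forall i, i \in J ->
     p <= pair_prob (c i) (fun w w' => 8 * t2 < nsq (Y i w - Y i w'))) ->
  Pr mu (fun o => nsq (\sum_(i in S) Y i (o (c i)) - z) <= t2)
    <= 5 / Num.sqrt (p * #|J|%:R).
Proof.
move=> cS JS t0 p0 p1 J0 gp.
pose good i w w' := 8 * t2 < nsq (Y i w - Y i w').
pose k o o' := #|[set i in J | good i (o (c i)) (o' (c i))]|.
set m : R := p * #|J|%:R.
have m0 : 0 < m by rewrite mulr_gt0 ?ltr0n.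
pose k0 := Num.trunc (m / 4).
have /andP[k0l k0u] : (k0%:R <= m / 4 < k0.+1%:R).
  by apply: truncn_itv; rewrite divr_ge0 // ltW.
(* An exponential Markov inequality in pointwise form, [l] being the number of good pairs: if [l]
   exceeds [k0], about [m / 4], the first term dominates; otherwise the second term is at least
   one. *)
have pt (l : nat) :
    (Num.sqrt (l.+1%:R : R))^-1 <= 2 / Num.sqrt m + 2 ^+ k0 * 2^-1 ^+ l.
  have s0 : 0 <= 2 / Num.sqrt m by rewrite divr_ge0 ?sqrtr_ge0.
  have p0' : 0 <= 2 ^+ k0 * 2^-1 ^+ l :> R.
    by rewrite mulr_ge0 // exprn_ge0 // invr_ge0.
  have [lk|kl] := leqP l k0.
    apply: ler_wpDl => //; apply: (@le_trans _ _ 1).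
      rewrite invf_le1 ?sqrtr_gt0 ?ltr0n // -{1}sqrtr1 ler_wsqrtr //.
      by rewrite ler1n.
    rewrite -(subnK lk) exprD -mulrA -exprMn mulfV ?pnatr_eq0 //.
    by rewrite expr1n mulr1 exprn_ege1 // ler1n.
  apply: ler_wpDr => //.
  have sl : 0 < Num.sqrt (l.+1%:R : R) by rewrite sqrtr_gt0 ltr0n.
  have sm : 0 < Num.sqrt m by rewrite sqrtr_gt0.
  rewrite -[leLHS]mul1r ler_pdivrMr // mulrAC ler_pdivlMr // mul1r.
  rewrite -(@ler_pXn2r _ 2) ?nnegrE ?mulr_ge0 ?sqrtr_ge0 //.
  rewrite exprMn !sqr_sqrtr ?ler0n ?(ltW m0) //.
  have : k0.+1%:R <= l%:R :> R by rewrite ler_nat.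
  by rewrite -[l.+1]addn1 natrD; lra.
have cnt o o' : 2^-1 ^+ #|S| * \sum_(U in powerset S)
    ind R (nsq (\sum_(i in S) Y i (merge (c @: U) o o' (c i)) - z) <= t2)
    <= Num.sqrt 2 * (2 / Num.sqrt m + 2 ^+ k0 * 2^-1 ^+ k o o').
  pose d i := Y i (o (c i)) - Y i (o' (c i)).
  pose z' := z - \sum_(i in S) Y i (o' (c i)).
  pose J' := [set i in J | good i (o (c i)) (o' (c i))].
  have J'S : J' \subset S.
    by apply: subset_trans JS; apply/subsetP => i; rewrite inE => /andP[].
  have dJ' i : i \in J' -> 8 * t2 < nsq (d i) by rewrite inE => /andP[].
  have := littlewood_offord z' t0 J'S dJ'; rewrite -/(k o o').
  set F := [set U | _] => hF.
  have -> : \sum_(U in powerset S)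
      ind R (nsq (\sum_(i in S) Y i (merge (c @: U) o o' (c i)) - z) <= t2)
      = #|F|%:R.
    rewrite -sum1_card natr_sum [RHS](eq_bigl (fun U : {set I} => (U \in powerset S) &&
      (nsq (\sum_(i in U) d i - z') <= t2))); last first.
      by move=> U; rewrite !inE.
    rewrite [RHS]big_mkcondr; apply: eq_bigr => U; rewrite powersetE => US.
    have -> : \sum_(i in S) Y i (merge (c @: U) o o' (c i)) - z =
              \sum_(i in U) d i - z'.
      rewrite /z' opprB addrA; congr (_ - _).
      rewrite [\sum_(i in U) d i](eq_bigl (fun i => (i \in S) && (i \in U)));
        last by move=> i; case: (boolP (i \in U)) => [/(subsetP US) ->|]; rewrite ?andbF.
      rewrite big_mkcondr -big_split; apply: eq_bigr => i iS /=.
      by rewrite (merge_in cS) // /d; case: ifP; rewrite ?add0r ?subrK.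
    by rewrite /ind asboolb; case: (nsq _ <= _).
  have s2 : 0 <= Num.sqrt 2 :> R by rewrite sqrtr_ge0.
  apply: le_trans (ler_wpM2l _ hF) _; first by rewrite exprn_ge0 // invr_ge0.
  rewrite !mulrA -exprMn mulVf ?pnatr_eq0 // expr1n mul1r ler_wpM2l //.
rewrite /Pr (symmetrize mu_sum c S).
apply: le_trans (_ : Num.sqrt 2 * (2 / Num.sqrt m + 2 ^+ k0 *
    Ex mu (fun o => Ex mu (fun o' => 2^-1 ^+ k o o'))) <= _).
  apply: (@le_trans _ _ (Ex mu (fun o => Ex mu (fun o' =>
      Num.sqrt 2 * (2 / Num.sqrt m + 2 ^+ k0 * 2^-1 ^+ k o o'))))).
    by apply: Ex_le => // o; apply: Ex_le => // o'; apply: cnt.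
  have lin (G : {ffun K -> W} -> R) :
      Ex mu (fun o => Num.sqrt 2 * (2 / Num.sqrt m + 2 ^+ k0 * G o)) =
      Num.sqrt 2 * (2 / Num.sqrt m + 2 ^+ k0 * Ex mu G).
    by rewrite ExZ ExD (Ex_cst mu_sum) ExZ.
  apply: le_of_eq; rewrite -lin.
  by apply: eq_Ex => o; rewrite -lin.
have cJ : {in J &, injective c} by move=> i j /(subsetP JS) ? /(subsetP JS) ?; apply: cS.
have hE : Ex mu (fun o => Ex mu (fun o' => 2^-1 ^+ k o o')) <= (1 - p / 2) ^+ #|J|.
  exact: (Ex_half_pow mu_ge0 mu_sum cJ gp).
have s20 : 0 <= Num.sqrt 2 :> R by rewrite sqrtr_ge0.
have sm : 0 < Num.sqrt m by rewrite sqrtr_gt0.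
apply: (@le_trans _ _ (Num.sqrt 2 * (3 / Num.sqrt m))).
  have -> : 3 / Num.sqrt m = 2 / Num.sqrt m + (Num.sqrt m)^-1 by lra.
  rewrite ler_wpM2l // lerD2l.
  apply: le_trans (ler_wpM2l _ hE) _; first by rewrite exprn_ge0.
  have k4 : 4 * k0%:R <= p * #|J|%:R by rewrite -/m; lra.
  rewrite mulrC; apply: le_trans (half_pow_bound (ltW p0) p1 k4) _.
  rewrite -/m lef_pV2 ?posrE //; last by lra.
  have := sqr_sqrtr (ltW m0); have := sqr_ge0 (Num.sqrt m - 2).
  by move: (Num.sqrt m) => q; rewrite !expr2; lra.
rewrite mulrA ler_wpM2r ?invr_ge0 ?sqrtr_ge0 //.
have : Num.sqrt 2 ^+ 2 = 2 :> R by rewrite sqr_sqrtr.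
by move: (Num.sqrt 2) s20 => q q0 q2; nra.
Qed.

End SmallBall.

(** * Tall matrices *)

Section TallDeterministic.
Variable R : realType.
Local Notation C := R[i].

Lemma unitary_row_norm l n (Q : 'M[C]_(l, n)) : Q *m Q^t* = 1%:M ->
  forall k, \sum_i nsq (Q k i) = 1.
Proof.
move=> QQ k; apply: (@complexI R); rewrite rmorph_sum rmorph1.
have /matrixP/(_ k k) := QQ; rewrite !mxE eqxx => h; rewrite -[RHS]h.
apply: eq_bigr => i _ /=.
by rewrite !mxE -mul_conj_nsq.
Qed.

(* For one of the sign patterns the difference of the two vectors has large
   projection on the orthocomplement of the columns of [B]. *)
Lemma no_dichotomy n (B : 'M[C]_n) (xi xi' : 'I_n -> C) (k : 'I_n)
    (S D : {set 'I_n}) (m : nat) (r2 : R) :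
  k \in S -> (#|S| <= m)%N -> (2 * m <= #|D|)%N ->
  (forall i, i \in D -> r2 <= nsq (xi i - xi' i)) ->
  ~ (forall U : {set 'I_n}, U \subset D -> exists x : 'cV[C]_n,
      8 * \sum_(i in D) nsq ((if i \in U then xi i else xi' i) +
          \sum_(j in S :\ k) B i j * x j 0) < r2 * m%:R).
Proof.
move=> kS Sm mD hD h.
pose H : 'M[C]_n := \matrix_(i, j)
  if (i \in D) && (j \in S :\ k) then B i j else 0.
have HS i j : j \notin S :\ k -> H i j = 0.
  by rewrite mxE => /negPf ->; rewrite andbF.
have cS : (m + #|S :\ k| <= #|D|)%N.
  move: Sm; rewrite (cardsD1 k S) kS => Sm; rewrite (leq_trans _ mD) // mul2n -addnn.
  by rewrite leq_add2l (leq_trans _ Sm) // leq_addl.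
have [l [Q [ml QQ QD QH]]] := orthonormal_annihilator HS cS.
pose c i := (xi i - xi' i) *: col i Q.
have [U UD hU] := exists_signs c D.
have [x1 h1] := h U UD.
(* The complementary pattern: subtracting the two vectors leaves [xi i - xi' i] on [D] with exactly
   the signs provided by [exists_signs], plus a combination of columns of [H], which [Q]
   annihilates. *)
have [x2 h2] := h (D :\: U) (subsetDl _ _).
pose y (V : {set 'I_n}) (x : 'cV[C]_n) : 'cV[C]_n := \col_i
  if i \in D then (if i \in V then xi i else xi' i) +
          \sum_(j in S :\ k) B i j * x j 0 else 0.
have yE V x : N2 (y V x) = \sum_(i in D) nsq ((if i \in V then xi i else xi' i) +
          \sum_(j in S :\ k) B i j * x j 0).
  rewrite /N2 [RHS]big_mkcond; apply: eq_bigr => i _; rewrite mxE.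
  by case: ifP => //; rewrite nsq0.
pose z : 'cV[C]_n := \col_i if i \in D then
  (if i \in U then xi i - xi' i else - (xi i - xi' i)) else 0.
have yy : y U x1 - y (D :\: U) x2 = z + H *m (x1 - x2).
  apply/colP => i; rewrite !mxE.
  have [iD|iD] := boolP (i \in D); last first.
    rewrite subrr add0r big1 // => j _.
    by rewrite !mxE (negPf iD) mul0r.
  have -> : \sum_j H i j * (x1 - x2) j 0 =
      \sum_(j in S :\ k) B i j * x1 j 0 - \sum_(j in S :\ k) B i j * x2 j 0.
    rewrite -sumrB [RHS]big_mkcond; apply: eq_bigr => j _.
    by rewrite !mxE iD /=; case: ifP => _; rewrite ?mul0r // mulrBr.
  rewrite !inE iD andbT; case: (i \in U) => /=; rewrite opprD addrACA //.
  by rewrite opprB.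
have Qyy : Q *m (y U x1 - y (D :\: U) x2) =
    \sum_(i in U) c i - \sum_(i in D :\: U) c i.
  rewrite yy mulmxDr mulmxA QH mul0mx addr0.
  rewrite (big_mkcond (fun i => i \in U)).
  rewrite (big_mkcond (fun i => i \in D :\: U)) -sumrB.
  apply/colP => a; rewrite mxE summxE; apply: eq_bigr => i _.
  rewrite !mxE; have := subsetP UD i.
  case: (boolP (i \in U)) => [iU /(_ isT) iD|iU _].
    by rewrite iD in_setD iU /= !mxE subr0 mulrC.
  rewrite in_setD iU /=; case: (i \in D); rewrite !mxE ?subr0 ?mulr0 //.
  by rewrite sub0r mulrN mulrC.
have r0 : 0 < r2 * m%:R.
  by apply: le_lt_trans h1; rewrite mulr_ge0 // sumr_ge0 // => i _; apply: nsq_ge0.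
have r20 : 0 <= r2.
  rewrite leNgt; apply/negP => r2n; move: r0.
  by rewrite ltNge mulr_le0_ge0 // ltW.
(* The rows of [Q] are at least [m] unit vectors supported on [D], so its columns indexed by [D]
   have total squared norm at least [m]. *)
have low : r2 * m%:R <= \sum_(i in D) N2 (c i).
  apply: (@le_trans _ _ (\sum_(i in D) r2 * N2 (col i Q))); last first.
    by apply: ler_sum => i iD; rewrite N2Z ler_wpM2r ?N2_ge0 // hD.
  rewrite -mulr_sumr ler_wpM2l //.
  have -> : \sum_(i in D) N2 (col i Q) = \sum_(a < l) \sum_i nsq (Q a i).
    rewrite [RHS]exchange_big [LHS]big_mkcond; apply: eq_bigr => i _ /=.
    have [iD|iD] := boolP (i \in D).
      by apply: eq_bigr => a _; rewrite mxE.
    by rewrite big1 // => a _; rewrite QD // nsq0.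
  under eq_bigr do rewrite (unitary_row_norm QQ).
  by rewrite sumr_const card_ord ler_nat.
have := bessel QQ (y U x1 - y (D :\: U) x2); rewrite Qyy.
have := N2D_le (y U x1) (- y (D :\: U) x2); rewrite N2N.
move: h1 h2; rewrite -!yE.
by move: hU low; lra.
Qed.

(** By [pajor] it suffices to count shattered sets; such a set is determined by its part in [J],
    which is small, and its part in [J0] outside [J], which is arbitrary. *)
Lemma card_traces (T : finType) (F : {set {set T}}) (J0 J : {set T}) d :
  J \subset J0 -> F \subset powerset J0 ->
  (forall S, shatters F S -> (#|S :&: J| < d)%N) ->
  (#|F| <= #|[set V : {set T} | (#|V| < d)%N]| * 2 ^ (#|J0| - #|J|))%N.
Proof.
move=> JJ0 FJ0 h; apply: leq_trans (pajor F) _.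
have -> : (2 ^ (#|J0| - #|J|) = #|powerset (J0 :\: J)|)%N.
  by rewrite card_powerset cardsD (setIidPr JJ0).
rewrite -cardsX -(card_in_imset (f := fun S : {set T} => (S :&: J, S :\: J))).
  apply/subset_leq_card/subsetP => W /imsetP[S]; rewrite inE => Ssh ->.
  rewrite !inE /= h //= setSD //.
  have /shattersP/(_ S (subxx _)) [A AF AS] := Ssh.
  have := subsetP FJ0 _ AF; rewrite powersetE => /(subset_trans _); apply.
  by rewrite -AS subsetIl.
by move=> A B _ _ [AB1 AB2]; rewrite -(setID A J) -(setID B J) AB1 AB2.
Qed.

(** Expand [(1 + x)^n] as the sum of [x^#|V|] over all sets [V]; each set counted contributes at
    least [x^d]. The parameter [x] is left free to be balanced against the decay of the
    probabilities. *)
Lemma card_small_sets n d (x : R) : 0 < x -> x <= 1 ->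
  #|[set V : {set 'I_n} | (#|V| < d)%N]|%:R <= (1 + x) ^+ n / x ^+ d.
Proof.
move=> x0 x1; rewrite ler_pdivlMr ?exprn_gt0 //.
have -> : (1 + x) ^+ n = \sum_(V : {set 'I_n}) x ^+ #|V|.
  rewrite -[in LHS](card_ord n) -[LHS]prodr_const addrC bigA_distr.
  apply: eq_bigr => V _; rewrite -prodr_const [RHS]big_mkcond.
  by apply: eq_bigr.
rewrite -sum1_card natr_sum mulr_suml [leLHS]big_mkcond; apply: ler_sum => V _.
rewrite inE mul1r; case: ifP => Vd; last by rewrite exprn_ge0 // ltW.
by apply: ler_wiXn2l; rewrite ?(ltW x0) ?x1 // ltnW.
Qed.

End TallDeterministic.

Section Tall.
Variable R : realType.
Local Notation C := R[i].

(** The columns in [S], with the rows in [S] and [I] deleted, have squared least singular value at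
    least [r2 m / (8 #|S|)]. The rows in [S] are deleted because the entries at [(i, k)] and
    [(k, i)], both indices in [S], are dependent; on the other rows the selected columns are built
    from distinct pairs. The further rows [I] leave room for the decoupling set. *)
Definition tall n (A : 'M[C]_n) (m : nat) (r2 : R) : Prop :=
  forall (S I : {set 'I_n}) (x : 'cV[C]_n), (#|S| <= m)%N -> (#|I| <= m)%N ->
  (forall i, i \notin S -> x i 0 = 0) ->
  r2 * m%:R * N2 x <= 8 * #|S|%:R * N2on (~: (S :|: I)) (A *m x).

Variables (K W : finType) (mu : K -> W -> R).
Hypothesis mu_ge0 : forall k w, 0 <= mu k w.
Hypothesis mu_sum : forall k, \sum_w mu k w = 1.
Variables (n : nat) (e : 'I_n -> 'I_n -> K) (f : 'I_n -> 'I_n -> W -> C).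
Hypothesis e_inj : forall i j i' j', e i j = e i' j' ->
  (i = i' /\ j = j') \/ (i = j' /\ j = i').
Variables (p r2 : R).
Hypothesis p_gt0 : 0 < p.
Hypothesis p_le1 : p <= 1.
Hypothesis spread1 : forall i j, i != j ->
  p <= pair_prob mu (e i j) (fun w w' => r2 <= nsq (f i j w - f i j w')).

Definition rmx (o : {ffun K -> W}) : 'M[C]_n :=
  \matrix_(i, j) f i j (o (e i j)).

Definition small_sets d := [set V : {set 'I_n} | (#|V| < d)%N].

(** Symmetrize the entries of column [k] on the rows kept. The selections [U] for which the event
    occurs form a family; were it to shatter a set containing [2 * m] rows where the two samples
    differ by [r2], [no_dichotomy] would be contradicted. [card_traces] then bounds the family, and
    the number of good rows is handled by [Ex_half_pow]. *)
Lemma bad_column (S I : {set 'I_n}) (k : 'I_n) (m : nat) :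
  k \in S -> (#|S| <= m)%N ->
  Pr mu (fun o => exists2 x : 'cV[C]_n,
    (forall i, i \notin S -> x i 0 = 0) /\ x k 0 = 1 &
    8 * N2on (~: (S :|: I)) (rmx o *m x) < r2 * m%:R)
  <= #|small_sets (2 * m)|%:R * (1 - p / 2) ^+ #|~: (S :|: I)|.
Proof.
move=> kS Sm; set R0 := ~: (S :|: I); set E := fun o => _.
pose c i := e i k.
have neq i : i \in R0 -> i != k.
  by rewrite !inE negb_or => /andP[iS _]; apply: contraNneq iS => ->.
have cR : {in R0 &, injective c}.
  move=> i j iR jR /e_inj[[]//|[ik _]].
  by have := neq _ iR; rewrite ik eqxx.
rewrite /Pr (symmetrize mu_sum c R0).
pose good i w w' := r2 <= nsq (f i k w - f i k w').
apply: (@le_trans _ _ (#|small_sets (2 * m)|%:R * Ex mu (fun o => Ex mu (fun o' =>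
    2^-1 ^+ #|[set i in R0 | good i (o (c i)) (o' (c i))]|)))); last first.
  rewrite ler_wpM2l //; apply: (Ex_half_pow mu_ge0 mu_sum cR) => i iR.
  exact: (spread1 (neq _ iR)).
rewrite -ExZ; apply: (Ex_le mu_ge0) => o; rewrite -ExZ.
apply: (Ex_le mu_ge0) => o'.
set J := [set i in R0 | _].
pose F := [set U in powerset R0 | `[< E (merge (c @: U) o o') >]].
have -> : \sum_(U in powerset R0) ind R (E (merge (c @: U) o o')) = #|F|%:R.
  rewrite -sum1_card natr_sum.
  rewrite [RHS](eq_bigl (fun U => (U \in powerset R0) &&
    `[< E (merge (c @: U) o o') >])); last by move=> U; rewrite inE.
  rewrite [RHS]big_mkcondr; apply: eq_bigr => U _.
  by rewrite /ind; case: asbool.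
have JR : J \subset R0 by apply/subsetP => i; rewrite inE => /andP[].
have FR : F \subset powerset R0 by apply/subsetP => U; rewrite inE => /andP[].
have cF : (#|F| <= #|small_sets (2 * m)| * 2 ^ (#|R0| - #|J|))%N.
  apply: (card_traces JR FR) => T shT; rewrite ltnNge; apply/negP => mD.
  pose B : 'M[C]_n := \matrix_(i, j) f i j (o' (e i j)).
  apply: (@no_dichotomy R n B (fun i => f i k (o (c i)))
    (fun i => f i k (o' (c i))) k S (T :&: J) m r2 kS Sm mD).
    by move=> i; rewrite !inE => /and3P[_ _].
  move=> V VD.
  have /shattersP/(_ V VD) [U UF UV] := shatters_sub (subsetIl T J) shT.
  move: UF; rewrite !inE => /andP[UR /asboolP[x [xS xk] hx]]; exists x.
  apply: le_lt_trans hx; rewrite ler_pM2l //.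
  have DR : T :&: J \subset R0 by apply: subset_trans (subsetIr _ _) JR.
  apply: le_trans (N2on_sub _ DR); apply: le_of_eq.
  apply: eq_bigr => i iD; have iR := subsetP DR _ iD; congr nsq.
  rewrite [RHS]mxE [RHS](bigD1 k) //= xk mulr1 [rmx _ i k]mxE (merge_in cR) //.
  have -> : (i \in V) = (i \in U) by rewrite -UV inE iD andbT.
  congr (_ + _); first by case: ifP.
  rewrite [RHS](bigID (fun j => j \in S)) /= [X in _ + X]big1 ?addr0; last first.
    by move=> j /andP[_ /xS ->]; rewrite mulr0.
  apply: eq_big => [j|j]; first by rewrite in_setD1.
  rewrite in_setD1 => /andP[jk jS]; rewrite !mxE; congr (f i j _ * _).
  (* Exchanging keys of column [k] leaves the other columns of [S] unchanged on the rows kept: a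
     shared key would put row [k] among them, but [k] is in [S]. *)
  rewrite ffunE; case: imsetP => // -[i' i'U /e_inj[[_ jk']|[ik _]]].
    by rewrite jk' eqxx in jk.
  by have := neq _ iR; rewrite ik eqxx.
have cJ : (#|J| <= #|R0|)%N by apply: subset_leq_card.
apply: (@le_trans _ _ (2^-1 ^+ #|R0| *
    (#|small_sets (2 * m)| * 2 ^ (#|R0| - #|J|))%:R)).
  by rewrite ler_wpM2l ?exprn_ge0 ?invr_ge0 // ler_nat.
rewrite natrM natrX mulrCA ler_wpM2l // -{1}(subnK cJ) exprD mulrAC -exprMn.
by rewrite mulVf ?pnatr_eq0 // expr1n mul1r.
Qed.

(** Union bound over [S], [I] and the coordinate [k], with [x] rescaled so that its coordinate at
    [k] is one. The cube collects the choices of [S] and [I] and the factor from [bad_column]. *)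
Lemma not_tall_bound (m : nat) : (0 < m)%N -> 0 <= r2 ->
  Pr mu (fun o => ~ tall (rmx o) m r2) <=
  n%:R * (#|small_sets (2 * m)|%:R ^+ 3 * (1 - p / 2) ^+ (n - 2 * m)).
Proof.
move=> m0 r20; set q := 1 - p / 2.
have q0 : 0 <= q by rewrite /q; move: p_le1; lra.
have q1 : q <= 1 by rewrite /q; move: p_gt0; lra.
pose E (t : {set 'I_n} * {set 'I_n} * 'I_n) o := exists2 x : 'cV[C]_n,
    (forall i, i \notin t.1.1 -> x i 0 = 0) /\ x t.2 0 = 1 &
    8 * N2on (~: (t.1.1 :|: t.1.2)) (rmx o *m x) < r2 * m%:R.
pose G (t : {set 'I_n} * {set 'I_n} * 'I_n) :=
  [&& (#|t.1.1| <= m)%N, (#|t.1.2| <= m)%N & t.2 \in t.1.1].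
apply: (@le_trans _ _ (Pr mu (fun o => exists t, G t /\ E t o))).
  apply: (Pr_sub mu_ge0) => o; apply: contra_notP => h S I x Sm Im xS.
  rewrite leNgt; apply/negP => hx.
  have Sx : N2 x = \sum_(i in S) nsq (x i 0).
    rewrite /N2 [RHS]big_mkcond; apply: eq_bigr => i _.
    by case: ifPn => // /xS ->; rewrite nsq0.
  have N2x : 0 < N2 x.
    rewrite lt_neqAle N2_ge0 andbT eq_sym; apply/eqP => x0; move: hx.
    by rewrite x0 mulr0 ltNge !mulr_ge0 ?N2on_ge0.
  (* Some coordinate carries at least the average share of the mass; this is the origin of the
     factor [#|S|] in [tall]. *)
  have [k [kS hk]] : exists k, k \in S /\ N2 x <= #|S|%:R * nsq (x k 0).
    apply: contrapT => no.
    have lt k : k \in S -> #|S|%:R * nsq (x k 0) < N2 x.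
      by move=> kS; rewrite ltNge; apply/negP => ?; apply: no; exists k.
    have [S0|[k0 k0S]] := set_0Vmem S.
      by move: N2x; rewrite Sx S0 big_set0 ltxx.
    have : \sum_(k in S) #|S|%:R * nsq (x k 0) < \sum_(k in S) N2 x.
      rewrite (bigD1 k0) //= [ltRHS](bigD1 k0) //= ltr_leD ?lt //.
      by apply: ler_sum => k /andP[/lt/ltW].
    by rewrite -mulr_sumr -Sx sumr_const  -[X in _ < X]mulr_natl ltxx.
  have xk0 : 0 < nsq (x k 0).
    rewrite lt_neqAle nsq_ge0 andbT eq_sym; apply/eqP => xk.
    by move: hk; rewrite xk mulr0 leNgt N2x.
  have xkn0 : x k 0 != 0 by rewrite -nsq_eq0 gt_eqF.
  apply: h; exists (S, I, k); split; first by rewrite /G Sm Im.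
  exists ((x k 0)^-1 *: x); first split => [i iS|].
  - by rewrite mxE (xS i iS) mulr0.
  - by rewrite mxE mulVf // -nsq_eq0 gt_eqF.
  rewrite -scalemxAr N2onZ /=.
  have nV : nsq (x k 0)^-1 = (nsq (x k 0))^-1.
    apply: (mulfI (lt0r_neq0 xk0)); rewrite -nsqM !mulfV ?nsq1 //.
    exact: lt0r_neq0.
  rewrite nV mulrCA ltr_pdivrMl // -(ltr_pM2l (_ : 0 < #|S|%:R)); last first.
    by rewrite ltr0n card_gt0; apply/set0Pn; exists k.
  apply: lt_le_trans (_ : r2 * m%:R * N2 x <= _).
    by rewrite mulrA [_ * 8]mulrC.
  rewrite [leRHS]mulrA [leRHS]mulrC ler_wpM2l ?mulr_ge0 //.
apply: le_trans (Pr_exists mu_ge0 _) _.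
rewrite (bigID G) /= [X in _ + X]big1 ?addr0; last first.
  move=> t Gt; rewrite /Pr (@eq_Ex _ _ _ mu _ (fun=> 0)) ?(Ex_cst mu_sum) //.
  by move=> o; rewrite /ind asboolF // => -[]; rewrite (negPf Gt).
apply: (@le_trans _ _ (\sum_(t | G t)
    #|small_sets (2 * m)|%:R * q ^+ (n - 2 * m))).
  apply: ler_sum => -[[S I] k] /= /and3P[/= Sm Im kS].
  apply: le_trans (_ : Pr mu (E (S, I, k)) <= _).
    by apply: (Pr_sub mu_ge0) => o [].
  apply: le_trans (bad_column I kS Sm) _; rewrite ler_wpM2l //.
  apply: ler_wiXn2l => //.
  rewrite leq_subLR -{1}(card_ord n) -(cardsC (S :|: I)) leq_add2r.
  by rewrite (leq_trans (leq_card_setU _ _)) // mul2n -addnn leq_add.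
rewrite sumr_const -[leLHS]mulr_natl mulrA [leRHS]mulrA.
rewrite ler_wpM2r ?exprn_ge0 // exprSr [leRHS]mulrA ler_wpM2r //.
rewrite -natrX -natrM ler_nat.
have <- : (#|setX (setX (small_sets (2 * m)) (small_sets (2 * m))) [set: 'I_n]| =
          n * #|small_sets (2 * m)| ^ 2)%N.
  by rewrite !cardsX cardsT card_ord mulnn mulnC.
apply: subset_leq_card; apply/subsetP => -[[S I] k] /and3P[/= Sm Im _].
by rewrite !inE /= andbT; apply/andP; split; lia.
Qed.

End Tall.

Section TallProbability.
Variable R : realType.
Local Notation C := R[i].

Lemma pow_le_expR (h : R) n : h <= 1 -> (1 - h) ^+ n <= (expR (n%:R * h))^-1.
Proof.
move=> h1; rewrite -expRN -mulrN expRM_natl; apply: lerXn2r;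
  rewrite ?nnegrE ?expR_ge0 ?expR_ge1Dx //; lra.
Qed.

Lemma pow_decay_quadratic (h : R) n : 0 < h -> h <= 1 ->
  n%:R * (1 - h) ^+ n <= 2 / h ^+ 2 / n%:R.
Proof.
move=> h0 h1; have [->|n0] := posnP n; first by rewrite mul0r invr0 mulr0.
have nR : 0 < n%:R :> R by rewrite ltr0n.
have nh : 0 < n%:R * h by rewrite mulr_gt0.
apply: (@le_trans _ _ (n%:R * (2 / (n%:R * h) ^+ 2))).
  rewrite ler_wpM2l //; apply: le_trans (pow_le_expR n h1) _.
  rewrite -[2 / _]invf_div lef_pV2 ?posrE ?expR_gt0 ?divr_gt0 ?exprn_gt0 //.
  by have := expR_ge1Dxn 1 (ltW nh); rewrite (_ : 2`! = 2)%N //; lra.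
apply: le_of_eq; field.
by rewrite !gt_eqF.
Qed.

Lemma pow_eventually_le (h d : R) : 0 < h -> h <= 1 -> 0 < d ->
  exists2 Q : nat, (2 <= Q)%N & (1 - h) ^+ Q <= d.
Proof.
move=> h0 h1 d0; exists (Num.trunc (h * d)^-1).+2 => //.
apply: le_trans (pow_le_expR _ h1) _.
have hd : 0 < h * d by rewrite mulr_gt0.
have /andP[_ t] : ((Num.trunc (h * d)^-1)%:R <= (h * d)^-1 < (Num.trunc (h * d)^-1).+1%:R).
  by apply: truncn_itv; rewrite invr_ge0 ltW.
move: t; set T := Num.trunc _ => t.
rewrite -[d]invrK lef_pV2 ?posrE ?expR_gt0 ?invr_gt0 //.
apply: le_trans (expR_ge1Dx _).
have : d^-1 <= T.+1%:R * h.
  by rewrite -ler_pdivrMr // -invfM mulrC ltW.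
by rewrite -[_.+2]addn1 natrD; lra.
Qed.

(** Put [x = p / 18], [y = 1 - p / 6], [z = 1 - p / 2]. Since [z <= y^3] and [(1 + x)^3 y <= 1], the
    powers with exponent [n] multiply to at most [y^(2 n)]. One factor [y^n] remains as the bound,
    the other absorbs the losses [x^(-6 m)] and [z^(-2 m)] once [n >= Q m] with [Q] large. *)
Lemma tall_numerics (p : R) : 0 < p -> p <= 1 ->
  exists2 Q : nat, (2 <= Q)%N & forall n m, (Q * m <= n)%N ->
    ((1 + p / 18) ^+ n / (p / 18) ^+ (2 * m)) ^+ 3 * (1 - p / 2) ^+ (n - 2 * m)
    <= (1 - p / 6) ^+ n.
Proof.
move=> p0 p1; pose x := p / 18; pose z := 1 - p / 2; pose h := p / 6.
have x0 : 0 < x by rewrite divr_gt0.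
have z0 : 0 < z by rewrite /z; lra.
have h0 : 0 < h by rewrite /h; lra.
have h1 : h <= 1 by rewrite /h; lra.
have d0 : 0 < x ^+ 6 * z ^+ 2 by rewrite mulr_gt0 ?exprn_gt0.
have [Q Q2 hQ] := pow_eventually_le h0 h1 d0.
exists Q => // n m Qmn.
have y0 : 0 < 1 - p / 6 by lra.
set y := 1 - p / 6 in y0 *; rewrite -/h -/y in hQ.
have m2 : (2 * m <= n)%N by apply: leq_trans Qmn; rewrite leq_mul2r Q2 orbT.
rewrite -/x -/z exprMn exprVn mulrAC ler_pdivrMr ?exprn_gt0 //.
rewrite -(ler_pM2r (_ : 0 < z ^+ (2 * m))) ?exprn_gt0 //.
rewrite -[leLHS]mulrA -exprD subnK //.
apply: (@le_trans _ _ (y ^+ n * y ^+ n)).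
  have zy : z <= y ^+ 3.
    by rewrite /z /y !exprS expr0; nra.
  have ay : (1 + x) ^+ 3 * y <= 1.
    rewrite /y (_ : p / 6 = 3 * x); last by rewrite /x; lra.
    have -> : (1 + x) ^+ 3 * (1 - 3 * x) = 1 - (6 * x ^+ 2 + 8 * x ^+ 3 + 3 * x ^+ 4).
      by ring.
    by rewrite lerBlDr lerDl !addr_ge0 // mulr_ge0 // exprn_ge0 // ltW.
  apply: (@le_trans _ _ (((1 + x) ^+ n) ^+ 3 * (y ^+ 3) ^+ n)).
    rewrite ler_wpM2l ?exprn_ge0 ?addr_ge0 ?(ltW x0) //.
    by apply: lerXn2r; rewrite ?nnegrE ?exprn_ge0 ?(ltW z0) ?(ltW y0).
  rewrite exprAC -exprMn (_ : (1 + x) ^+ 3 * y ^+ 3 = ((1 + x) ^+ 3 * y) * (y * y));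
    last by ring.
  rewrite exprMn -[y ^+ n * _]exprMn -[leRHS]mul1r.
  rewrite ler_wpM2r ?exprn_ge0 ?mulr_ge0 ?(ltW y0) //.
  apply: exprn_ile1 => //.
  by rewrite mulr_ge0 ?(ltW y0) ?exprn_ge0 ?addr_ge0 ?(ltW x0).
rewrite -mulrA ler_pM2l ?exprn_gt0 //.
apply: (@le_trans _ _ (y ^+ (Q * m))).
  by apply: ler_wiXn2l; rewrite ?(ltW y0) // /y; lra.
rewrite exprM (_ : x ^+ (2 * m) ^+ 3 * z ^+ (2 * m) = (x ^+ 6 * z ^+ 2) ^+ m).
  by apply: lerXn2r; rewrite ?nnegrE ?(ltW d0) ?exprn_ge0 ?(ltW y0).
by rewrite [RHS]exprMn -!exprM; congr (_ ^+ _ * _ ^+ _); lia.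
Qed.

(** The exponential decay is weakened to [C1 / n], which the term [1 / sqrt n] of the final bound
    dominates. The constants depend on [p] alone, so the lemma also serves minors and their
    transposes. *)
Lemma not_tall_prob (p : R) : 0 < p -> p <= 1 ->
  exists (Q : nat) (C1 : R), [/\ (2 <= Q)%N, 0 < C1 &
  forall (K W : finType) (mu : K -> W -> R)
    (n : nat) (e : 'I_n -> 'I_n -> K) (f : 'I_n -> 'I_n -> W -> C) (r2 : R) m,
  (forall k w, 0 <= mu k w) -> (forall k, \sum_w mu k w = 1) ->
  (forall i j i' j', e i j = e i' j' ->
    (i = i' /\ j = j') \/ (i = j' /\ j = i')) ->
  (forall i j, i != j ->
    p <= pair_prob mu (e i j) (fun w w' => r2 <= nsq (f i j w - f i j w'))) ->
  0 <= r2 -> (0 < m)%N -> (Q * m <= n)%N ->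
  Pr mu (fun o => ~ tall (rmx e f o) m r2) <= C1 / n%:R].
Proof.
move=> p0 p1; have [Q Q2 hQ] := tall_numerics p0 p1.
exists Q, (2 / (p / 6) ^+ 2); split => //.
  by rewrite divr_gt0 // exprn_gt0 // divr_gt0.
move=> K W mu n e f r2 m mu0 mu1 einj hs r20 m0 Qm.
apply: le_trans (not_tall_bound mu0 mu1 einj p0 p1 hs m0 r20) _.
apply: (@le_trans _ _ (n%:R * (1 - p / 6) ^+ n)); last first.
  by apply: pow_decay_quadratic; lra.
rewrite ler_wpM2l //; apply: le_trans (hQ n m Qm).
rewrite ler_wpM2r ?exprn_ge0 //; first lra.
apply: lerXn2r; rewrite ?nnegrE //; last by apply: card_small_sets; lra.
by rewrite divr_ge0 ?exprn_ge0 //; lra.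
Qed.

End TallProbability.

(** * Spread of approximate null vectors, singular vectors and Schur complements *)

Section LinearAlgebra.
Variable R : realType.
Local Notation C := R[i].

Lemma N2_delta n (k : 'I_n) : N2 (delta_mx k 0 : 'cV[C]_n) = 1.
Proof.
rewrite /N2 (bigD1 k) //= mxE !eqxx nsq1 big1 ?addr0 // => i ik.
by rewrite mxE (negPf ik) nsq0.
Qed.

(** Test tallness on a single basis vector. With [m] proportional to [n] this forces the norm of a
    tall matrix to be at least of order [sqrt n]. *)
Lemma tall_opb_lower n (A : 'M[C]_n) m (r2 s2 : R) : (0 < n)%N -> (0 < m)%N ->
  tall A m r2 -> opb A s2 -> r2 * m%:R <= 8 * s2.
Proof.
case: n A => // n A _ m0 tA oA.
pose x : 'cV[C]_n.+1 := delta_mx ord0 0.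
have x1 : N2 x = 1 := N2_delta ord0.
have := tA [set ord0] set0 x; rewrite cards1 cards0 x1 !mulr1 => h.
apply: le_trans (h _ _ _) _ => //.
  by move=> i; rewrite inE mxE => /negPf ->.
rewrite ler_wpM2l //; apply: le_trans (N2on_le _ _) _.
by apply: le_trans (oA x) _; rewrite x1 mulr1.
Qed.

(* A vector that [A] nearly annihilates off [I] has at least [j] coordinates that
   are not small: otherwise [A] would nearly annihilate its large part, contrary
   to tallness. *)
Lemma spread n (A : 'M[C]_n) m (r2 s2 : R) (j : nat) (I : {set 'I_n})
    (y : 'cV[C]_n) :
  tall A m r2 -> opb A s2 -> 0 < r2 -> (0 < j)%N -> (j <= m)%N ->
  (#|I| <= m)%N ->
  N2on (~: I) (A *m y) <= r2 * m%:R / (128 * j%:R) * N2 y ->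
  (0 < N2 y) ->
  (j <= #|[set i | (r2 * m%:R / (128 * j%:R * s2 * n%:R) * N2 y
                    <= nsq (y i 0))%R]|)%N.
Proof.
move=> tA oA r20 j0 jm Im hI y0; rewrite leqNgt; apply/negP => Sj.
have m0 : (0 < m)%N := leq_trans j0 jm.
have n0 : (0 < n)%N.
  by case: (n) y y0 {oA tA I Im hI Sj} => // y; rewrite /N2 big_ord0 ltxx.
set S := [set i | _] in Sj.
have low := tall_opb_lower n0 m0 tA oA.
pose g := r2 * m%:R; have g0 : 0 < g by rewrite mulr_gt0 ?ltr0n.
have s20 : 0 < s2 by rewrite -/g in low; lra.
have jR : 1 <= j%:R :> R by rewrite ler1n.
have nR : 0 < n%:R :> R by rewrite ltr0n.
pose a := g / (128 * j%:R).
have a0 : 0 < a by rewrite divr_gt0 // mulr_gt0 //; lra.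
have ja : 128 * j%:R * a = g by rewrite /a; field; rewrite pnatr_eq0 -lt0n.
have eta : r2 * m%:R / (128 * j%:R * s2 * n%:R) = a / (s2 * n%:R).
  by rewrite /a /g; field; rewrite (gt_eqF s20) (gt_eqF nR) gt_eqF // ltr0n.
pose yS : 'cV[C]_n := \col_i if i \in S then y i 0 else 0.
pose w : 'cV[C]_n := \col_i if i \in S then 0 else y i 0.
have yE : y = yS + w.
  by apply/colP => i; rewrite !mxE; case: ifP; rewrite ?addr0 ?add0r.
have N2E' : N2 y = N2 yS + N2 w.
  rewrite /N2 -big_split; apply: eq_bigr => i _; rewrite !mxE.
  by case: ifP => _ /=; rewrite nsq0 ?addr0 ?add0r.
have N2w : s2 * N2 w <= a * N2 y.
  have : N2 w <= \sum_(i < n) a / (s2 * n%:R) * N2 y.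
    apply: ler_sum => i _; rewrite mxE; case: ifPn => [_|].
      rewrite nsq0 mulr_ge0 ?N2_ge0 //; apply: divr_ge0; first exact: ltW.
      by rewrite mulr_ge0 // ltW.
    by rewrite inE eta -ltNge => /ltW.
  rewrite sumr_const card_ord -mulr_natl => h.
  rewrite -(ler_pM2l s20) in h; apply: le_trans h _.
  apply: le_of_eq; field.
  by rewrite (gt_eqF s20) (gt_eqF nR).
have yS_low : N2 y <= 2 * N2 yS.
  suff : 2 * N2 w <= N2 y by lra.
  have aj : a <= j%:R * a by rewrite ler_peMl // ltW.
  have as2 : 2 * a <= s2 by move: low; rewrite -/g -ja; lra.
  have h := ler_wpM2r (ltW y0) as2; rewrite -(ler_pM2l s20); lra.
have ASle : N2on (~: (S :|: I)) (A *m yS) <= 4 * a * N2 y.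
  have -> : A *m yS = A *m y - A *m w by rewrite yE mulmxDr addrK.
  apply: le_trans (N2onB_le _ _ _) _.
  have h1 : N2on (~: (S :|: I)) (A *m y) <= a * N2 y.
    by apply: le_trans hI; apply: N2on_sub; rewrite setCS subsetUr.
  have h2 : N2on (~: (S :|: I)) (A *m w) <= a * N2 y.
    by apply: le_trans (N2on_le _ _) _; apply: le_trans (oA w) N2w.
  lra.
have ySS i : i \notin S -> yS i 0 = 0 by move=> iS; rewrite mxE (negPf iS).
have Sm : (#|S| <= m)%N := leq_trans (ltnW Sj) jm.
have := tA S I yS Sm Im ySS; rewrite leNgt => /negP; apply.
have Sj' : #|S|%:R <= j%:R :> R by rewrite ler_nat ltnW.
(* The constant 128 makes [8 j * 4 a] equal to [g / 4], while the large part [yS] keeps at least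
   half of the mass of [y], so tallness would give at least [g / 2]. *)
apply: (@le_lt_trans _ _ (8 * j%:R * (4 * a * N2 y))).
  apply: (@le_trans _ _ (8 * #|S|%:R * (4 * a * N2 y))).
    by rewrite ler_wpM2l // mulr_ge0.
  rewrite ler_wpM2r ?ler_wpM2l //.
  by rewrite mulr_ge0 ?N2_ge0 // mulr_ge0 // ltW.
apply: (@lt_le_trans _ _ (g * (N2 y / 2))).
  rewrite (_ : _ * _ = (128 * j%:R * a) * (N2 y / 4)); last by field.
  by rewrite ja ltr_pM2l //; lra.
by rewrite -/g ler_pM2l //; lra.
Qed.

Lemma gram_spectral n (A : 'M[C]_n) :
  exists (P : 'M[C]_n) (d : 'I_n -> R), [/\ P^t* *m P = 1%:M, P *m P^t* = 1%:M,
    (forall k, 0 <= d k),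
    (forall k, spectral_diag (A^t* *m A) 0 k = (d k)%:C) &
    forall x, N2 (A *m x) = \sum_k d k * nsq ((P *m x) k 0)].
Proof.
set G := A^t* *m A.
have Gn : G \is normalmx.
  by apply/normalmxP; rewrite trmx_mul map_mxM /= trmxCK.
have /orthomx_spectralP GE := Gn.
have Pu := spectral_unitarymx G.
set P := spectralmx G in GE Pu *; set D := spectral_diag G in GE *.
have PP : P *m P^t* = 1%:M by apply/unitarymxP.
have PP' : P^t* *m P = 1%:M by apply: mulmx1C.
have form x : (N2 (A *m x))%:C = \sum_k D 0 k * (nsq ((P *m x) k 0))%:C.
  rewrite N2E trmx_mul map_mxM /= -mulmxA (mulmxA (A^t*)) -/G GE.
  rewrite invmx_unitary // -!mulmxA mulmxA.
  have -> : x^t* *m P^t* = (P *m x)^t* by rewrite trmx_mul map_mxM.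
  rewrite mul_diag_mx; set z := P *m x.
  rewrite mxE; apply: eq_bigr => k _; rewrite -mul_conj_nsq !mxE conjCE.
  by rewrite mulrC -mulrA.
(* The eigenvalue is the squared length of the image of the [k]-th eigenvector, which shows it to be
   real and nonnegative. *)
have DE k : D 0 k = (N2 (A *m (P^t* *m delta_mx k 0)))%:C.
  rewrite form mulmxA PP mul1mx (bigD1 k) //= mxE !eqxx nsq1 mulr1 big1 ?addr0 //.
  by move=> i ik; rewrite mxE (negPf ik) /= nsq0 mulr0.
exists P, (fun k => N2 (A *m (P^t* *m delta_mx k 0))); split => //.
  by move=> k; apply: N2_ge0.
move=> x; apply: (@complexI R); rewrite form rmorph_sum; apply: eq_bigr => k _.
by rewrite DE rmorphM.
Qed.

Lemma unit_eigenvector n (A P : 'M[C]_n) (d : 'I_n -> R) k :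
  P *m P^t* = 1%:M -> P^t* *m P = 1%:M ->
  (forall x, N2 (A *m x) = \sum_k d k * nsq ((P *m x) k 0)) ->
  N2 (P^t* *m delta_mx k 0) = 1 /\ N2 (A *m (P^t* *m delta_mx k 0)) = d k.
Proof.
move=> PP' PP hA; split; first by rewrite -(N2_unitary PP) mulmxA PP' mul1mx N2_delta.
rewrite hA mulmxA PP' mul1mx (bigD1 k) //= mxE !eqxx nsq1 mulr1 big1 ?addr0 //.
by move=> i ik; rewrite mxE (negPf ik) /= nsq0 mulr0.
Qed.

Lemma min_singular_vector n (A : 'M[C]_n) : (0 < n)%N ->
  exists (w : 'cV[C]_n) (s2 : R), [/\ N2 w = 1, N2 (A *m w) = s2 &
    forall x, s2 * N2 x <= N2 (A *m x)].
Proof.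
case: n A => // n A _; have [P [d [PP PP' d0 _ hA]]] := gram_spectral A.
pose k := [arg min_(i < ord0) d i]%O.
have kmin i : d k <= d i.
  by rewrite /k; case: arg_minP => // j _; apply.
have NP x : N2 (P *m x) = N2 x by apply: N2_unitary.
have [e1 e2] := unit_eigenvector k PP' PP hA.
exists (P^t* *m delta_mx k 0), (d k); split => // x.
rewrite hA -NP /N2 mulr_sumr; apply: ler_sum => i _.
by rewrite ler_wpM2r ?nsq_ge0.
Qed.

Definition minor_mx N (A : 'M[C]_N.+1) k : 'M[C]_N :=
  \matrix_(i, j) A (lift k i) (lift k j).
Definition minor_col N (A : 'M[C]_N.+1) k : 'cV[C]_N := \col_i A (lift k i) k.
Definition minor_row N (A : 'M[C]_N.+1) k : 'cV[C]_N := \col_j A k (lift k j).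

Lemma sum_lift N (k : 'I_N.+1) (V : zmodType) (F : 'I_N.+1 -> V) :
  \sum_i F i = F k + \sum_i F (lift k i).
Proof. by rewrite (bigD1_ord k). Qed.

Lemma opb_minor N (A : 'M[C]_N.+1) k s2 : opb A s2 -> opb (minor_mx A k) s2.
Proof.
move=> oA x.
pose y : 'cV[C]_N.+1 := \col_i if unlift k i is Some j then x j 0 else 0.
have y1 : y k 0 = 0 by rewrite mxE unlift_none.
have y2 j : y (lift k j) 0 = x j 0 by rewrite mxE liftK.
have -> : N2 x = N2 y.
  rewrite /N2 (sum_lift k) y1 nsq0 add0r.
  by apply: eq_bigr => j _; rewrite y2.
apply: le_trans (oA y); rewrite [leRHS](sum_lift k) ler_wpDl ?nsq_ge0 //.
apply: ler_sum => i _; rewrite !mxE (sum_lift k) y1 mulr0 add0r.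
apply: le_of_eq; congr nsq.
by apply: eq_bigr => j _; rewrite y2 mxE.
Qed.

Lemma N2_minor_row N (A : 'M[C]_N.+1) k s2 : 0 <= s2 -> opb A s2 ->
  N2 (minor_row A k) <= s2.
Proof.
move=> s0 /(opb_tr s0) /(_ (delta_mx k 0)).
rewrite N2_delta mulr1; apply: le_trans; rewrite [leRHS](sum_lift k).
rewrite ler_wpDl ?nsq_ge0 //; apply: ler_sum => i _.
rewrite -colE !mxE; exact: lexx.
Qed.

(* Schur complement: solving [A x = rho] for the coordinate [x k]. *)
Lemma schur_bound N (A : 'M[C]_N.+1) k (x : 'cV[C]_N.+1) (s2 sg2 t2 h2 : R) :
  minor_mx A k \in unitmx -> 0 <= s2 -> opb A s2 -> 0 < sg2 ->
  (forall z, sg2 * N2 z <= N2 ((minor_mx A k)^T *m z)) ->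
  N2 (A *m x) <= t2 -> 0 < h2 -> h2 <= nsq (x k 0) ->
  nsq (A k k - ((minor_row A k)^T *m invmx (minor_mx A k) *m minor_col A k) 0 0)
    <= 2 * t2 * (1 + s2 / sg2) / h2.
Proof.
move=> Bu s0 oA sg0 hsg At h0 hx.
set B := minor_mx A k in Bu hsg *; set v := minor_row A k.
set u := minor_col A k; set G := invmx B.
pose y : 'cV[C]_N := \col_j x (lift k j) 0.
pose rho : 'cV[C]_N := \col_j (A *m x) (lift k j) 0.
have rhoE : rho = x k 0 *: u + B *m y.
  apply/colP => i; rewrite mxE mxE (sum_lift k) !mxE mulrC; congr (_ + _).
  by apply: eq_bigr => j _; rewrite !mxE.
have ax : (A *m x) k 0 = A k k * x k 0 + (v^T *m y) 0 0.
  rewrite mxE (sum_lift k) [in RHS]mxE; congr (_ + _).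
  by apply: eq_bigr => j _; rewrite !mxE.
have yE : y = G *m rho - x k 0 *: (G *m u).
  by rewrite rhoE mulmxDr scalemxAr mulmxA mulVmx // mul1mx addrAC subrr add0r.
have key : (A k k - (v^T *m G *m u) 0 0) * x k 0 =
    (A *m x) k 0 - (v^T *m G *m rho) 0 0.
  rewrite ax yE mulmxBr -scalemxAr !mulmxA [(_ - _ : 'M_(_,_)) 0 0]mxE.
  by rewrite [(- _ : 'M_(_,_)) 0 0]mxE [(_ *: _ : 'M_(_,_)) 0 0]mxE; ring.
rewrite ler_pdivlMr //.
apply: (@le_trans _ _ (nsq (A k k - (v^T *m G *m u) 0 0) * nsq (x k 0))).
  by rewrite ler_wpM2l ?nsq_ge0.
rewrite -nsqM key; apply: le_trans (nsqB_le _ _) _.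
have Arho : N2 rho + nsq ((A *m x) k 0) <= t2.
  apply: le_trans At; rewrite [leRHS](sum_lift k) addrC lerD2l.
  by apply: ler_sum => i _; rewrite mxE.
set z := (v^T *m G)^T.
(* By construction [B^T z = v], so the lower bound on [B^T] turns the bound on the row [v] into one
   on [z]. *)
have Nz : N2 z <= s2 / sg2.
  rewrite ler_pdivlMr // mulrC; apply: le_trans (hsg z) _.
  rewrite /z -trmx_mul -mulmxA mulVmx // mulmx1 trmxK.
  exact: N2_minor_row.
have vr : nsq ((v^T *m G *m rho) 0 0) <= s2 / sg2 * N2 rho.
  rewrite mxE; apply: le_trans (cauchy_schwarz _ _ _ _) _.
  apply: ler_wpM2r; first exact: N2_ge0.
  apply: le_trans Nz; apply: le_of_eq.
  by apply: eq_bigr => i _; congr nsq; rewrite [RHS]mxE.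
have := N2_ge0 rho; have := nsq_ge0 ((A *m x) k 0).
have : 0 <= s2 / sg2 by rewrite divr_ge0 // ltW.
move: vr Arho; move: (nsq _) (nsq ((A *m x) k 0)) (N2 rho) (s2 / sg2) => a b c d.
nra.
Qed.

End LinearAlgebra.

(** * The quadratic form of a minor *)

Section Decoupling.
Variable R : realType.
Local Notation C := R[i].

Lemma subset_of_card (T : finType) (A : {set T}) j : (j <= #|A|)%N ->
  exists2 B : {set T}, B \subset A & #|B| = j.
Proof.
move=> jA; exists [set x in take j (enum A)].
  by apply/subsetP => x; rewrite inE => /mem_take; rewrite mem_enum.
rewrite cardsE; have /card_uniqP -> : uniq (take j (enum A)) by rewrite take_uniq ?enum_uniq.
by rewrite size_take -cardE; case: ltngtP jA.
Qed.

(* When [sg2] is small the weights are large coordinates of a left singular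
   vector; otherwise constant weights do. *)
Lemma decoupling_weights N (B : 'M[C]_N) m j (r2 s2 sg2 : R) (w0 : 'cV[C]_N) :
  tall (B^T) m r2 -> 0 < r2 -> 1 <= s2 -> opb B s2 -> (0 < j)%N -> (j <= m)%N ->
  (m <= N)%N -> 0 < sg2 -> N2 w0 = 1 -> N2 (B^T *m w0) = sg2 ->
  exists (I : {set 'I_N}) (wt : 'I_N -> C) (ss2 : R),
  [/\ #|I| = j,
    forall i, i \in I -> r2 * m%:R / (128 * j%:R * s2 * N%:R) <= nsq (wt i),
    0 < ss2, (1 + s2 / sg2) * ss2 <= s2 * (1 + r2 / 128) &
    forall y z : 'cV[C]_N, B *m y = z -> (forall i, i \notin I -> z i 0 = 0) ->
      nsq (\sum_(i in I) wt i * z i 0) <= ss2 * N2 y].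
Proof.
move=> tB r20 s21 oB j0 jm mN sg0 w1 wB.
have s20 : 0 < s2 by lra.
have mR : 0 < m%:R :> R by rewrite ltr0n; apply: leq_trans jm.
have jR : 0 < j%:R :> R by rewrite ltr0n.
have NR : 0 < N%:R :> R by rewrite ltr0n (leq_trans _ mN) // -(ltr0n R).
have jmR : j%:R <= m%:R :> R by rewrite ler_nat.
have mNR : m%:R <= N%:R :> R by rewrite ler_nat.
(* Since [j <= m], the cut [r2 / 128] lies below the threshold under which [spread] applies to [w0]
   and [B^T]. *)
have [small|large] := leP sg2 (r2 / 128).
  have hy : N2on (~: set0) (B^T *m w0) <= r2 * m%:R / (128 * j%:R) * N2 w0.
    apply: le_trans (N2on_le _ _) _; rewrite wB w1 mulr1; apply: le_trans small _.
    rewrite (_ : _ / (128 * _) = r2 / 128 * (m%:R / j%:R)); last first.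
      by field; rewrite gt_eqF.
    by rewrite ler_peMr ?divr_ge0 ?(ltW r20) // ler_pdivlMr // mul1r.
  have := spread tB (opb_tr (ltW s20) oB) r20 j0 jm _ hy _.
  rewrite cards0 w1 mulr1 => /(_ isT ltr01) hj.
  have [I IS cI] := subset_of_card hj.
  exists I, (fun i => w0 i 0), sg2; split => //.
  - by move=> i /(subsetP IS); rewrite inE.
  - rewrite mulrDl mul1r divfK ?gt_eqF // mulrDr mulr1.
    by have := ler_peMl (ltW sg0) s21; have := ler_wpM2l (ltW s20) small; lra.
  move=> y z Byz zI; rewrite -wB.
  (* As [z = B y] vanishes off [I], restricting [w0] to [I] changes nothing and the sum is the
     pairing of [B^T w0] with [y]: the gain is exactly [sg2]. *)
  have -> : \sum_(i in I) w0 i 0 * z i 0 = \sum_i (B^T *m w0) i 0 * y i 0.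
    transitivity ((w0^T *m z) 0 0).
      rewrite mxE [LHS]big_mkcond; apply: eq_bigr => i _; rewrite mxE.
      by case: ifPn => // /zI ->; rewrite mulr0.
    rewrite -Byz mulmxA -[w0^T *m B]trmxK trmx_mul trmxK mxE.
    by apply: eq_bigr => i _; rewrite [in LHS]mxE.
  exact: cauchy_schwarz.
(* Here [sg2] is bounded below and [|B y|^2 <= s2 |y|^2] suffices. The constant weight has the
   squared modulus that the other case guarantees as a lower bound, so both cases share one
   threshold. *)
pose nu := r2 * m%:R / (128 * N%:R).
have nu0 : 0 < nu by rewrite divr_gt0 // mulr_gt0.
have [I _ cI] : exists2 I : {set 'I_N}, I \subset [set: 'I_N] & #|I| = j.
  by apply: subset_of_card; rewrite cardsT card_ord (leq_trans jm).
have etaE : r2 * m%:R / (128 * j%:R * s2 * N%:R) = nu / (j%:R * s2).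
  by rewrite /nu; field; rewrite !gt_eqF.
have eta0 : 0 <= nu / (j%:R * s2) by rewrite ltW // divr_gt0 // mulr_gt0.
exists I, (fun=> (Num.sqrt (nu / (j%:R * s2)))%:C), nu; split => //.
- by move=> i _; rewrite nsq_real sqr_sqrtr // etaE.
- have nud : nu <= r2 / 128.
    rewrite /nu ler_pdivrMr ?mulr_gt0 // mulrA divfK ?pnatr_eq0 //.
    by rewrite ler_wpM2l // ltW.
  have h1 : s2 / sg2 * nu <= s2.
    rewrite mulrAC ler_pdivrMr // ler_wpM2l ?(ltW s20) //; lra.
  rewrite mulrDl mul1r mulrDr mulr1.
  have : r2 / 128 <= s2 * (r2 / 128) by rewrite ler_peMl // divr_ge0 // ltW.
  lra.
move=> y z Byz zI; apply: le_trans (cauchy_schwarz _ _ _ _) _.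
rewrite sumr_const nsq_real sqr_sqrtr // cI -[_ *+ j]mulr_natl.
apply: (@le_trans _ _ (j%:R * (nu / (j%:R * s2)) * (s2 * N2 y))).
  rewrite (ler_wpM2l (mulr_ge0 (ltW jR) eta0)) //.
  by apply: le_trans (oB y); rewrite Byz; apply: (@N2on_le _ _ I).
by apply: le_of_eq; field; rewrite !gt_eqF.
Qed.

End Decoupling.

Section QuadraticForm.
Variable R : realType.
Local Notation C := R[i].
Variables (K W : finType) (mu : K -> W -> R).
Hypothesis mu_ge0 : forall k w, 0 <= mu k w.
Hypothesis mu_sum : forall k, \sum_w mu k w = 1.

Lemma pair_prob_sub k (g g' : W -> W -> bool) :
  (forall w w', g w w' -> g' w w') -> pair_prob mu k g <= pair_prob mu k g'.
Proof.
move=> h; apply: ler_sum => w _; apply: ler_sum => w' _.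
rewrite ler_wpM2l ?mulr_ge0 // ler_nat.
by case E : (g w w') => //; rewrite h.
Qed.

(** With the coordinates outside [D] fixed, Jensen's inequality squares the conditional probability,
    and the square is the probability that [E] holds for two independent samples on [D]. *)
Lemma decouple (D : {set K}) (E : {ffun K -> W} -> Prop) :
  Pr mu E ^+ 2 <= Ex mu (fun o => Ex mu (fun o2 => Ex mu (fun o' =>
    ind R (E (merge D o o') /\ E (merge D o2 o'))))).
Proof.
rewrite /Pr (Ex_merge mu_sum D) Ex_exchange.
apply: le_trans (Ex_sqr mu_ge0 mu_sum _) _.
apply: le_of_eq.
transitivity (Ex mu (fun o' => Ex mu (fun o => Ex mu (fun o2 =>
    ind R (E (merge D o o') /\ E (merge D o2 o')))))).
  apply: eq_Ex => o'; rewrite expr2 -ExZ; apply: eq_Ex => o.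
  by rewrite mulrC -ExZ; apply: eq_Ex => o2; rewrite ind_and.
by rewrite Ex_exchange; apply: eq_Ex => o; rewrite Ex_exchange.
Qed.

Variables (N : nat) (c : 'I_N -> K) (fu fv : 'I_N -> W -> C) (p D2 r2 : R).
Hypothesis c_inj : injective c.
Hypothesis p_gt0 : 0 < p.
Hypothesis p_le1 : p <= 1.
Hypothesis D2_gt0 : 0 < D2.
Hypothesis D2_le1 : D2 <= 1.
Hypothesis r2_gt0 : 0 < r2.
Hypothesis spread1 : forall i,
  p <= pair_prob mu (c i) (fun w w' => r2 <= nsq (fu i w - fu i w')).
Hypothesis spread2 : forall i a b, p * D2 <= pair_prob mu (c i) (fun w w' =>
  r2 * D2 * (nsq a + nsq b) <=
  nsq (a * (fu i w - fu i w') + b * (fv i w - fv i w'))).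

Local Notation Om := {ffun K -> W}.
Definition vcol (g : 'I_N -> W -> C) (o : Om) : 'cV[C]_N := \col_i g i (o (c i)).
Definition restr (I : {set 'I_N}) (x : 'cV[C]_N) : 'cV[C]_N :=
  \col_i if i \in I then x i 0 else 0.

Lemma vcol_merge (I : {set 'I_N}) g o o' :
  vcol g (merge (c @: I) o o') = restr I (vcol g o) + restr (~: I) (vcol g o').
Proof.
apply/colP => i; rewrite !mxE ffunE in_setC.
have -> : (c i \in c @: I) = (i \in I) by rewrite mem_imset.
by case: (i \in I); rewrite ?addr0 ?add0r.
Qed.

(** The part of the form quadratic in the coordinates outside [I] is common to both samples and
    cancels; the part inside [I] does not see [o'] and goes into [ka]; only the mixed terms, linear
    in [o'], remain. *)
Lemma quad_diff (G : 'M[C]_N) (I : {set 'I_N}) (o o2 : Om) :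
  let y := G *m restr I (vcol fu o - vcol fu o2) in
  let al := G^T *m restr I (vcol fv o - vcol fv o2) in
  exists ka : C, forall o' : Om,
    ((vcol fv (merge (c @: I) o o'))^T *m G *m vcol fu (merge (c @: I) o o')) 0 0 -
    ((vcol fv (merge (c @: I) o2 o'))^T *m G *m vcol fu (merge (c @: I) o2 o')) 0 0
    = \sum_(i in ~: I) (al i 0 * fu i (o' (c i)) + y i 0 * fv i (o' (c i))) + ka.
Proof.
move=> y al; set ua := restr I (vcol fu o); set ua2 := restr I (vcol fu o2).
set va := restr I (vcol fv o); set va2 := restr I (vcol fv o2).
exists ((va^T *m G *m ua) 0 0 - (va2^T *m G *m ua2) 0 0) => o'.
rewrite !vcol_merge -/ua -/ua2 -/va -/va2.
set ub := restr (~: I) (vcol fu o'); set vb := restr (~: I) (vcol fv o').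
have yE : y = G *m (ua - ua2).
  congr (_ *m _); apply/colP => i; rewrite !mxE.
  by case: ifP; rewrite ?subr0.
have alE : al = G^T *m (va - va2).
  congr (_ *m _); apply/colP => i; rewrite !mxE.
  by case: ifP; rewrite ?subr0.
have -> : \sum_(i in ~: I) (al i 0 * fu i (o' (c i)) + y i 0 * fv i (o' (c i))) =
    (al^T *m ub) 0 0 + (vb^T *m y) 0 0.
  rewrite [in RHS]mxE [X in _ = _ + X]mxE -big_split [LHS]big_mkcond.
  apply: eq_bigr => i _ /=; rewrite [al^T 0 i]mxE [vb^T 0 i]mxE.
  rewrite [ub i 0]mxE [vb i 0]mxE [vcol fu o' i 0]mxE [vcol fv o' i 0]mxE.
  by case: ifP => _; rewrite ?mulr0 ?mul0r ?addr0 // [X in _ = _ + X]mulrC.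
pose q (v u : 'cV[C]_N) := (v^T *m G *m u) 0 0.
have qDl v v' u : q (v + v') u = q v u + q v' u.
  by rewrite /q linearD /= !mulmxDl mxE.
have qDr v u u' : q v (u + u') = q v u + q v u'.
  by rewrite /q mulmxDr mxE.
have qNl v u : q (- v) u = - q v u.
  by rewrite /q linearN /= !mulNmx mxE.
have qNr v u : q v (- u) = - q v u.
  by rewrite /q mulmxN mxE.
rewrite yE alE trmx_mul trmxK [vb^T *m _]mulmxA.
rewrite -![(_ *m G *m _) 0 0]/(q _ _) !(qDl, qDr, qNl, qNr).
by clear qDl qDr qNl qNr yE alE; clearbody q; ring.
Qed.

(** [X] stands for [1 + s2 / sg2], which enlarges the threshold [th2]. Multiplying through by [ss2]
    and using [X * ss2 <= s2 * Z] removes [sg2]; what remains is the strict hypothesis on [j] and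
    [t2]. *)
Lemma threshold_numerics (a d nu j s2 ss2 t2 th2 X Z eta Ny yi : R) :
  0 < a -> 0 < d -> 0 < j -> 0 < s2 -> 0 < ss2 -> 0 <= t2 ->
  th2 <= 256 * t2 * s2 * X / a -> X * ss2 <= s2 * Z ->
  (384 * j) ^+ 2 * t2 * s2 ^+ 4 * Z < a ^+ 3 * d * nu ^+ 2 ->
  eta = nu / (j * s2) -> eta * a / 9 < ss2 * Ny -> 0 < eta ->
  eta / 2 * Ny <= yi -> 8 * (4 * th2) < a * d * yi.
Proof.
move=> a0 d0 j0 s0 ss0 t0 hth hX star etaE hNy eta0 hyi.
rewrite -(ltr_pM2r ss0).
apply: (@le_lt_trans _ _ (8192 * t2 * s2 ^+ 2 * Z / a)).
  have h1 := ler_wpM2r (ltW ss0) hth.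
  have h2 : 256 * t2 * s2 * X / a * ss2 <= 256 * t2 * s2 / a * (s2 * Z).
    rewrite (_ : _ * ss2 = 256 * t2 * s2 / a * (X * ss2)); last by field; rewrite gt_eqF.
    by rewrite ler_wpM2l // divr_ge0 ?mulr_ge0 // ltW.
  rewrite (_ : 8192 * t2 * s2 ^+ 2 * Z / a = 32 * (256 * t2 * s2 / a * (s2 * Z)));
    last by field; rewrite gt_eqF.
  lra.
apply: (@lt_le_trans _ _ (a * d * (eta / 2 * (eta * a / 9)))); last first.
  have -> : a * d * yi * ss2 = a * d * (ss2 * yi) by ring.
  rewrite ler_pM2l ?mulr_gt0 //.
  have := ler_wpM2l (ltW ss0) hyi; apply: le_trans.
  rewrite [leRHS]mulrCA ler_pM2l ?divr_gt0 //; exact: ltW.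
have js0 : 0 < 18 * a * (j * s2) ^+ 2 by rewrite !mulr_gt0 ?exprn_gt0 ?mulr_gt0.
rewrite -(ltr_pM2r js0) etaE.
rewrite (_ : _ * (18 * a * (j * s2) ^+ 2) = (384 * j) ^+ 2 * t2 * s2 ^+ 4 * Z);
  last by field; rewrite gt_eqF.
apply: lt_le_trans star _; apply: le_of_eq.
by field; rewrite !gt_eqF.
Qed.

(** Two small ball estimates are combined. Over the samples on [I], the weighted sum is rarely
    small, which makes [y = B^-1 z] long; over the remaining pairs, the linear form with the
    coefficients [y] and [al] is rarely small. The outer square root undoes the square in
    [decouple]. *)
Lemma quad_small_ball (B : 'M[C]_N) (a : C) m j (s2 sg2 t2 th2 : R)
    (w0 : 'cV[C]_N) :
  B \in unitmx -> tall B m r2 -> tall (B^T) m r2 -> opb B s2 -> 1 <= s2 ->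
  (0 < j)%N -> (2 * j <= m)%N -> (m <= N)%N -> 0 < sg2 -> 0 <= t2 ->
  N2 w0 = 1 -> N2 (B^T *m w0) = sg2 -> 0 <= th2 ->
  th2 <= 256 * t2 * s2 * (1 + s2 / sg2) / r2 ->
  (384 * j%:R) ^+ 2 * t2 * s2 ^+ 4 * (1 + r2 / 128) <
    r2 ^+ 3 * D2 * (r2 * m%:R / (128 * N%:R)) ^+ 2 ->
  Pr mu (fun o => nsq (a - ((vcol fv o)^T *m invmx B *m vcol fu o) 0 0) <= th2)
    <= Num.sqrt (5 / Num.sqrt (p * j%:R) + 5 / Num.sqrt (p * D2 * j%:R)).
Proof.
move=> Bu tB tBt oB s21 j0 jm mN sg0 t20 w1 wB th0 th star.
have jm' : (j <= m)%N by apply: leq_trans jm; rewrite leq_pmull.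
have m0 : (0 < m)%N := leq_trans j0 jm'.
have N0 : (0 < N)%N := leq_trans m0 mN.
have jR : 0 < j%:R :> R by rewrite ltr0n.
have NR : 0 < N%:R :> R by rewrite ltr0n.
have mR : 0 < m%:R :> R by rewrite ltr0n.
have s20 : 0 < s2 by lra.
have [I [wt [ss2 [cI hwt ss0 hss hI]]]] :=
  decoupling_weights tBt r2_gt0 s21 oB j0 jm' mN sg0 w1 wB.
set eta := r2 * m%:R / (128 * j%:R * s2 * N%:R) in hwt.
have eta0 : 0 < eta by rewrite divr_gt0 ?mulr_gt0.
set G := invmx B; set E := fun o => is_true (nsq _ <= th2).
(* The divisor 9 leaves room for the strict inequality with factor 8 in [small_ball]. *)
pose bad (o o2 : Om) : Prop :=
  nsq (\sum_(i in I) wt i * (fu i (o (c i)) - fu i (o2 (c i)))) <= eta * r2 / 9.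
have er0 : 0 < eta * r2 / 9 by rewrite divr_gt0 // mulr_gt0.
have c1 : 0 <= 5 / Num.sqrt (p * j%:R) by rewrite divr_ge0 ?sqrtr_ge0.
have c2 : 0 <= 5 / Num.sqrt (p * D2 * j%:R) by rewrite divr_ge0 ?sqrtr_ge0.
have pbad o2 : Pr mu (fun o => bad o o2) <= 5 / Num.sqrt (p * j%:R).
  have cI' : {in I &, injective c} by move=> ? ? _ _; apply: c_inj.
  have := @small_ball R K W mu mu_ge0 mu_sum _ c I I (fun i w => wt i * fu i w)
    (\sum_(i in I) wt i * fu i (o2 (c i))) (eta * r2 / 9) p cI' (subxx _)
    (ltW er0) p_gt0 p_le1; rewrite cI => /(_ j0) h.
  apply: le_trans (h _); last first.
    move=> i iI; apply: le_trans (spread1 i) _; apply: pair_prob_sub => w w' hw.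
    rewrite -mulrBr nsqM.
    apply: (@lt_le_trans _ _ (eta * r2)); first lra.
    by apply: ler_pM => //; rewrite ?(ltW eta0) ?(ltW r2_gt0) ?hwt.
  apply: (Pr_sub mu_ge0) => o; rewrite /bad.
  by under eq_bigr do rewrite mulrBr; rewrite sumrB.
have main (o o2 : Om) : ~ bad o o2 ->
    Ex mu (fun o' => ind R (E (merge (c @: I) o o') /\ E (merge (c @: I) o2 o')))
    <= 5 / Num.sqrt (p * D2 * j%:R).
  move=> /negP; rewrite -ltNge => nbad.
  set z := restr I (vcol fu o - vcol fu o2).
  pose y := G *m z.
  have Byz : B *m y = z by rewrite /y mulmxA mulmxV // mul1mx.
  have zI i : i \notin I -> z i 0 = 0 by rewrite mxE => /negPf ->.
  have ylow : eta * r2 / 9 < ss2 * N2 y.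
    apply: lt_le_trans nbad _; apply: le_trans (hI y z Byz zI).
    apply: le_of_eq; congr nsq.
    by apply: eq_bigr => i iI; rewrite !mxE iI.
  have y0 : 0 < N2 y by rewrite -(pmulr_rgt0 _ ss0) (lt_trans er0 ylow).
  have Im : (#|I| <= m)%N by rewrite cI.
  (* Twice [j] coordinates are requested, because those in [I], which number [j], carry no remaining
     randomness and are discarded. *)
  have j20 : (0 < 2 * j)%N by rewrite muln_gt0.
  have hy : N2on (~: I) (B *m y) <= r2 * m%:R / (128 * (2 * j)%:R) * N2 y.
    rewrite Byz /N2on big1 => [|i]; last by rewrite inE => /zI ->; rewrite nsq0.
    by rewrite mulr_ge0 ?N2_ge0 // divr_ge0 // mulr_ge0 // ltW.
  have := spread tB oB r2_gt0 j20 jm Im hy y0.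
  set Y0 := [set i | _] => cY.
  pose J := Y0 :\: I.
  have JI : J \subset ~: I by rewrite /J setDE subsetIr.
  have cJ : (j <= #|J|)%N.
    have := subset_leq_card (subsetIr Y0 I); rewrite cI => hY.
    rewrite /J cardsD; apply: leq_trans (leq_sub2l _ hY).
    by rewrite leq_subRL ?(leq_trans _ cY) ?addnn ?mul2n // -addnn leq_addr.
  have [ka hka] := quad_diff G I o o2.
  rewrite -/z -/y in hka; set al := G^T *m _ in hka.
  have cI' : {in ~: I &, injective c} by move=> ? ? _ _; apply: c_inj.
  have pD0 : 0 < p * D2 by rewrite mulr_gt0.
  have pD1 : p * D2 <= 1 by rewrite mulr_ile1 // ltW.
  have t40 : 0 <= 4 * th2 by rewrite mulr_ge0.
  have := @small_ball R K W mu mu_ge0 mu_sum _ c (~: I) J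
    (fun i w => al i 0 * fu i w + y i 0 * fv i w) (- ka) (4 * th2) (p * D2)
    cI' JI t40 pD0 pD1 (leq_trans j0 cJ) => h.
  apply: (@le_trans _ _ (5 / Num.sqrt (p * D2 * #|J|%:R))); last first.
    rewrite ler_wpM2l // lef_pV2 ?posrE ?sqrtr_gt0 ?mulr_gt0 //; last first.
      by rewrite ltr0n (leq_trans j0 cJ).
    by rewrite ler_wsqrtr // ler_wpM2l ?(ltW pD0) // ler_nat.
  apply: le_trans (h _); last first.
    move=> i iJ; apply: le_trans (spread2 i (al i 0) (y i 0)) _.
    apply: pair_prob_sub => w w' hw.
    rewrite (_ : _ - _ = al i 0 * (fu i w - fu i w') + y i 0 * (fv i w - fv i w'));
      last by ring.
    apply: lt_le_trans hw.
    have yi : r2 * m%:R / (128 * (2 * j)%:R * s2 * N%:R) * N2 y <= nsq (y i 0).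
      by move: iJ; rewrite !inE => /andP[_].
    (* Only the length of [y] is controlled; the joint bound on the pair makes this enough, whatever
       the coefficient [al i 0]. *)
    apply: (@lt_le_trans _ _ (r2 * D2 * nsq (y i 0))); last first.
      by apply: ler_wpM2l; [rewrite mulr_ge0 // ltW|rewrite lerDr nsq_ge0].
    apply: (threshold_numerics r2_gt0 D2_gt0 jR s20 ss0 t20 th hss star _ ylow eta0).
      by rewrite /eta; field; rewrite !gt_eqF.
    apply: le_trans yi; apply: le_of_eq.
    by rewrite /eta natrM; field; rewrite !gt_eqF.
  apply: (Ex_le mu_ge0) => o'; apply: ind_le => -[E1 E2].
  rewrite opprK -hka.
  rewrite (_ : _ - _ = (a - ((vcol fv (merge (c @: I) o2 o'))^T *m G *m
      vcol fu (merge (c @: I) o2 o')) 0 0) - (a - ((vcol fv (merge (c @: I) o o'))^T *m G *m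
      vcol fu (merge (c @: I) o o')) 0 0)); last by ring.
  apply: le_trans (nsqB_le _ _) _; move: E1 E2; rewrite /E; lra.
rewrite -(@ler_pXn2r _ 2) ?nnegrE ?sqrtr_ge0 ?(Pr_ge0 mu_ge0) //.
rewrite sqr_sqrtr ?addr_ge0 //; apply: le_trans (decouple (c @: I) E) _.
apply: (@le_trans _ _ (Ex mu (fun o => Ex mu (fun o2 =>
    ind R (bad o o2) + 5 / Num.sqrt (p * D2 * j%:R))))).
  apply: (Ex_le mu_ge0) => o; apply: (Ex_le mu_ge0) => o2.
  have [b|nb] := pselect (bad o o2); last by rewrite ler_wpDl ?ind_ge0 // main.
  rewrite {2}/ind asboolT // ler_wpDr //.
  by apply: (Ex_le_cst mu_ge0 mu_sum) => o'; apply: ind_le1.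
rewrite Ex_exchange; apply: (Ex_le_cst mu_ge0 mu_sum) => o2.
by rewrite ExD (Ex_cst mu_sum) lerD2r pbad.
Qed.

End QuadraticForm.

Section Column.
Variable R : realType.
Local Notation C := R[i].

(** A key represents an unordered pair of indices: the entries at [(i, j)] and [(j, i)] are two
    functions of one independent coordinate. A single entry spreads with constants [p] and [r2],
    whereas a combination of the two loses the factor [D2], later [1 - rho]. *)
Definition independent_entries (K W : finType) (mu : K -> W -> R) n
    (e : 'I_n -> 'I_n -> K) (f : 'I_n -> 'I_n -> W -> C) (p r2 D2 : R) : Prop :=
  [/\ (forall k w, 0 <= mu k w) /\ (forall k, \sum_w mu k w = 1),
    forall i j, e i j = e j i,
    forall i j i' j', e i j = e i' j' ->
      (i = i' /\ j = j') \/ (i = j' /\ j = i'),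
    forall i j, i != j ->
      p <= pair_prob mu (e i j) (fun w w' => r2 <= nsq (f i j w - f i j w')) &
    forall i j, i != j -> forall a b, p * D2 <= pair_prob mu (e i j) (fun w w' =>
      r2 * D2 * (nsq a + nsq b) <=
      nsq (a * (f i j w - f i j w') + b * (f j i w - f j i w')))].

Definition nearly_singular n (A : 'M[C]_n) (t2 s2 : R) : Prop :=
  opb A s2 /\ exists2 x : 'cV[C]_n, N2 x = 1 & N2 (A *m x) <= t2.

Lemma N2_unit n (A : 'M[C]_n) (w : 'cV[C]_n) : A \in unitmx -> N2 w = 1 ->
  0 < N2 (A *m w).
Proof.
move=> Au w1; rewrite lt_neqAle N2_ge0 andbT eq_sym N2_eq0.
apply/eqP => /(congr1 (mulmx (invmx A))); rewrite mulmxA mulVmx // mul1mx mulmx0.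
by move=> w0; move: w1; rewrite w0 N20 => /eqP; rewrite eq_sym oner_eq0.
Qed.

Variables (K W : finType) (mu : K -> W -> R) (N : nat).
Variables (e : 'I_N.+1 -> 'I_N.+1 -> K) (f : 'I_N.+1 -> 'I_N.+1 -> W -> C).
Variables (p r2 D2 : R).
Hypothesis p_gt0 : 0 < p.
Hypothesis p_le1 : p <= 1.
Hypothesis D2_gt0 : 0 < D2.
Hypothesis D2_le1 : D2 <= 1.
Hypothesis r2_gt0 : 0 < r2.
Hypothesis indep : independent_entries mu e f p r2 D2.

(** Freeze everything except row and column [k] off the diagonal. The minor, its least singular
    value and the diagonal entry become deterministic, and [schur_bound] places the event inside the
    small ball event of [quad_small_ball]. *)
Lemma column_bound (k : 'I_N.+1) m j (s2 t2 : R) :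
  (forall o, minor_mx (rmx e f o) k \in unitmx) -> 1 <= s2 -> 0 <= t2 ->
  (0 < j)%N -> (2 * j <= m)%N -> (m <= N)%N ->
  (384 * j%:R) ^+ 2 * t2 * s2 ^+ 4 * (1 + r2 / 128) <
    r2 ^+ 3 * D2 * (r2 * m%:R / (128 * N%:R)) ^+ 2 ->
  Pr mu (fun o => opb (rmx e f o) s2 /\ exists2 x : 'cV[C]_N.+1,
     r2 / (128 * s2 * N.+1%:R) <= nsq (x k 0) & N2 (rmx e f o *m x) <= t2 / N.+1%:R)
  <= Pr mu (fun o => ~ tall (minor_mx (rmx e f o) k) m r2) +
     Pr mu (fun o => ~ tall ((minor_mx (rmx e f o) k)^T) m r2) +
     Num.sqrt (5 / Num.sqrt (p * j%:R) + 5 / Num.sqrt (p * D2 * j%:R)).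
Proof.
have [[mu0 mu1] esym einj hs1 hs2] := indep.
move=> Bu s21 t20 j0 jm mN star; set E := fun o => _ /\ _.
pose c i := e (lift k i) k; pose D := [set c i | i : 'I_N].
have c_inj : injective c.
  move=> i i' /einj[[/lift_inj//]|[ik _]].
  by have := neq_lift k i; rewrite ik eqxx.
have Dk i i' : e (lift k i) (lift k i') \notin D.
  apply/imsetP => -[l _ /einj[[_ ik]|[ik _]]].
    by have := neq_lift k i'; rewrite ik eqxx.
  by have := neq_lift k i; rewrite ik eqxx.
have Dkk : e k k \notin D.
  apply/imsetP => -[l _ /einj[[kl _]|[_ kl]]];
  by have := neq_lift k l; rewrite -kl eqxx.
have sq0 : 0 <= Num.sqrt (5 / Num.sqrt (p * j%:R) + 5 / Num.sqrt (p * D2 * j%:R)).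
  by rewrite sqrtr_ge0.
(* The outer variable [o'] now determines the minor and the inner one resamples the keys of [D], so
   the inequality can be proved for each [o'] separately. *)
rewrite {1}/Pr (Ex_merge mu1 D) Ex_exchange.
rewrite -[X in _ <= _ + X](Ex_cst mu1) -!ExD; apply: (Ex_le mu0) => o'.
set B := minor_mx (rmx e f o') k.
have [tB|tB] := pselect (tall B m r2); last first.
  rewrite -addrA ler_wpDr ?addr_ge0 ?ind_ge0 // {2}/ind asboolT //.
  by apply: (Ex_le_cst mu0 mu1) => o; apply: ind_le1.
have [tBt|tBt] := pselect (tall B^T m r2); last first.
  apply: (@le_trans _ _ 1).
    by apply: (Ex_le_cst mu0 mu1) => o; apply: ind_le1.
  rewrite [X in _ <= _ + X + _](_ : _ = 1); last by rewrite /ind asboolT.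
  by rewrite -addrA ler_wpDl ?ind_ge0 // ler_wpDr.
rewrite ler_wpDl ?addr_ge0 ?ind_ge0 //.
have Bmerge o : minor_mx (rmx e f (merge D o o')) k = B.
  by apply/matrixP => i i'; rewrite !mxE ffunE (negPf (Dk _ _)).
have s20 : 0 <= s2 by lra.
have [oB|noB] := pselect (opb B s2); last first.
  apply: (Ex_le_cst mu0 mu1) => o; rewrite /ind asboolF // => -[oA _].
  by apply: noB; rewrite -(Bmerge o); apply: opb_minor.
have N0 : (0 < N)%N by apply: leq_trans mN; apply: leq_trans jm; rewrite muln_gt0.
have [w0 [sg2 [w1 wB hsg]]] := min_singular_vector B^T N0.
have sg0 : 0 < sg2 by rewrite -wB N2_unit // unitmx_tr Bu.
(* This is the right side of [schur_bound] for [t2 / N.+1] and the coordinate bound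
   [r2 / (128 * s2 * N.+1)]; the dimension cancels. *)
pose th2 := 256 * t2 * s2 * (1 + s2 / sg2) / r2.
have th0 : 0 <= th2.
  by rewrite divr_ge0 ?(ltW r2_gt0) // mulr_ge0 ?mulr_ge0 // addr_ge0 // divr_ge0 // ltW.
pose fu i := f (lift k i) k; pose fv i := f k (lift k i).
have s1 i : p <= pair_prob mu (c i) (fun w w' => r2 <= nsq (fu i w - fu i w')).
  by apply: hs1; rewrite eq_sym neq_lift.
have sp2 i a b : p * D2 <= pair_prob mu (c i) (fun w w' =>
    r2 * D2 * (nsq a + nsq b) <=
    nsq (a * (fu i w - fu i w') + b * (fv i w - fv i w'))).
  by apply: hs2; rewrite eq_sym neq_lift.
have qb := quad_small_ball mu0 mu1 c_inj p_gt0 p_le1 D2_gt0 D2_le1 r2_gt0 s1 sp2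
  (rmx e f o' k k) (Bu o') tB tBt oB s21 j0 jm mN sg0 t20 w1 wB th0 (lexx _) star.
apply: le_trans qb; apply: (Ex_le mu0) => o; apply: ind_le => -[oA [x hx Ax]].
have NR : 0 < N.+1%:R :> R by rewrite ltr0n.
have s2p : 0 < s2 by lra.
have h20 : 0 < r2 / (128 * s2 * N.+1%:R) by rewrite divr_gt0 // !mulr_gt0.
set A := rmx e f (merge D o o') in oA Ax.
have BE : minor_mx A k = B by apply: Bmerge.
have := @schur_bound R N A k x s2 sg2 (t2 / N.+1%:R) (r2 / (128 * s2 * N.+1%:R)).
rewrite BE => /(_ (Bu o') s20 oA sg0 hsg Ax h20 hx).
have -> : A k k = rmx e f o' k k by rewrite !mxE ffunE (negPf Dkk).
have cD i : c i \in D by rewrite imset_f.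
have -> : minor_col A k = vcol c fu o.
  by apply/colP => i; rewrite !mxE ffunE cD.
have -> : minor_row A k = vcol c fv o.
  by apply/colP => i; rewrite !mxE ffunE esym -/(c i) cD.
move/le_trans; apply; rewrite /th2; apply: le_of_eq.
move: (N.+1%:R : R) NR => q q0.
by field; rewrite ?(gt_eqF sg0) ?(gt_eqF r2_gt0) ?(gt_eqF s2p) ?(gt_eqF q0).
Qed.

End Column.

(** * The bound for finitely supported entries *)

Section FiniteTheorem.
Variable R : realType.
Local Notation C := R[i].

Definition rate (D s t : R) n : R :=
  (Num.sqrt (s ^+ 5 * t) + (Num.sqrt n%:R)^-1) / D.

(** [m] is about [N / Q], and [j] is the smaller of [m / 2] and a constant times [D / (t s^4)], the
    largest value that the threshold permits. The existence of [j] is conditional on the inequality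
    that [tall_opb_lower] supplies. *)
Lemma parameters (Q : nat) (r2 : R) : 0 < r2 -> (2 <= Q)%N ->
  exists E c3 : R, [/\ 1 <= E, 0 < c3 &
  forall (N : nat) (D s t : R), 0 < D -> D <= 1 -> 1 <= s -> 0 < t -> t <= 2 ->
  E * rate D s t N.+1 < 1 ->
  exists m : nat, [/\ (0 < m)%N /\ (m <= N)%N, (Q * m <= N)%N,
    (N.+1 <= 4 * Q * m)%N, t ^+ 2 / N.+1%:R <= r2 / 128 &
    r2 * m%:R <= 8 * s ^+ 2 -> exists j : nat, [/\ (0 < j)%N, (2 * j <= m)%N,
      (384 * j%:R) ^+ 2 * t ^+ 2 * (s ^+ 2) ^+ 4 * (1 + r2 / 128) <
        r2 ^+ 3 * D ^+ 2 * (r2 * m%:R / (128 * N%:R)) ^+ 2 &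
      j%:R^-1 <= c3 * (s ^+ 5 * t + N.+1%:R^-1)]]].
Proof.
move=> r20 Q2; have Q0 : 0 < Q%:R :> R by rewrite ltr0n; apply: leq_trans Q2.
pose nu0 : R := r2 / (512 * Q%:R).
have nu00 : 0 < nu0 by rewrite divr_gt0 // mulr_gt0.
pose Z : R := 1 + r2 / 128; have Z0 : 0 < Z by rewrite addr_gt0 // divr_gt0.
pose ka2 : R := r2 ^+ 3 * nu0 ^+ 2 / (2 * 384 ^+ 2 * Z).
have ka20 : 0 < ka2.
  by apply: divr_gt0; [apply: mulr_gt0; apply: exprn_gt0|
    apply: mulr_gt0 => //; apply: mulr_gt0 => //; apply: exprn_gt0].
pose ka := Num.sqrt ka2; have ka0 : 0 < ka by rewrite sqrtr_gt0.
have kaE : ka ^+ 2 = ka2 by rewrite sqr_sqrtr // ltW.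
(* The summands serve in turn: [8 Q] for [N >= 4 Q], [512 / r2] for the bound on [t^2 / n], [2 / ka]
   for [X >= 2], and [32 Q / r2] for [s D >= 1]. *)
pose E : R := 1 + 8 * Q%:R + 512 / r2 + 2 / ka + 32 * Q%:R / r2.
have p1 : 0 < 512 / r2 by rewrite divr_gt0.
have p2 : 0 < 2 / ka by rewrite divr_gt0.
have p3 : 0 < 32 * Q%:R / r2 by rewrite divr_gt0 // mulr_gt0.
have [E1 E2 E3 E4 E5] : [/\ 1 <= E, 8 * Q%:R <= E, 512 / r2 <= E,
    2 / ka <= E & 32 * Q%:R / r2 <= E].
  by split; rewrite /E; move: Q0 p1 p2 p3; clear; lra.
exists E, (16 * Q%:R + 2 / ka); split => //; first by rewrite addr_gt0 // mulr_gt0.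
clearbody E => N D s t D0 D1 s1 t0 t2.
set n := N.+1; have nR : 0 < n%:R :> R by rewrite ltr0n.
rewrite /rate; set q := s ^+ 5 * t; have s0 : 0 < s := lt_le_trans ltr01 s1.
have q0 : 0 < q by rewrite mulr_gt0 ?exprn_gt0.
set x := Num.sqrt q; set y := (Num.sqrt n%:R)^-1.
have x0 : 0 <= x by rewrite sqrtr_ge0.
have y0 : 0 < y by rewrite invr_gt0 sqrtr_gt0.
have xq : x ^+ 2 = q by rewrite sqr_sqrtr // ltW.
have yn : y ^+ 2 = n%:R^-1 by rewrite exprVn sqr_sqrtr // ltW.
rewrite mulrA ltr_pdivrMr // mul1r mulrDr => Exy.
have E0 : 0 < E := lt_le_trans ltr01 E1.
have Ex0 : 0 <= E * x by rewrite mulr_ge0 // ltW.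
have Ey0 : 0 < E * y by rewrite mulr_gt0.
have Eq : E ^+ 2 * q <= D ^+ 2.
  rewrite -xq -exprMn; apply: lerXn2r; rewrite ?nnegrE ?(ltW D0) //.
  by move: Exy Ey0; clear; lra.
have En : E ^+ 2 <= D ^+ 2 * n%:R.
  rewrite -ler_pdivrMr // -yn -exprMn.
  apply: lerXn2r; rewrite ?nnegrE ?(ltW D0) ?(ltW Ey0) //.
  by move: Exy Ex0; clear; lra.
have EE : E <= E ^+ 2 by rewrite expr2 ler_peMl // ltW.
have D21 : D ^+ 2 <= 1 by rewrite exprn_ile1 // ltW.
have nE : E <= n%:R.
  apply: le_trans EE _; apply: le_trans En _.
  by rewrite ler_piMl // ltW.
have NQ : (4 * Q <= N)%N.
  have : (8 * Q <= n)%N by rewrite -(ler_nat R) natrM (le_trans E2).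
  by move: Q2; rewrite /n; clear; lia.
pose m := (N %/ Q)%N.
have Qm : (Q * m <= N)%N by rewrite mulnC leq_trunc_div.
have Qpos : (0 < Q)%N by apply: leq_trans Q2.
have m4 : (4 <= m)%N by rewrite /m leq_divRL.
have Nm : (N < Q * m.+1)%N by rewrite mulnC ltn_ceil.
have m0 : (0 < m)%N by apply: leq_trans m4.
have nm : (n <= 2 * Q * m)%N.
  apply: leq_trans Nm _.
  have -> : (2 * Q * m = Q * (2 * m))%N by rewrite mulnCA mulnA.
  rewrite leq_mul2l; apply/orP; right; move: m0; clear; case: m => // m _.
  by rewrite mul2n -addnn addSn ltnS leq_addl.
have mN : (m <= N)%N by apply: leq_trans Qm; rewrite leq_pmull.
exists m; split => //.
  by apply: leq_trans nm _; rewrite !leq_pmul2r.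
  rewrite ler_pdivrMr //; apply: (@le_trans _ _ 4).
    rewrite (_ : 4 = 2 ^+ 2 :> R); last by ring.
    by apply: lerXn2r; rewrite ?nnegrE // ltW.
  have : 512 / r2 <= n%:R := le_trans E3 nE.
  by rewrite ler_pdivrMr // => h; rewrite mulrAC ler_pdivlMr //; move: h; clear; lra.
have mR : 0 < m%:R :> R by rewrite ltr0n.
have nmR : n%:R <= 2 * Q%:R * m%:R :> R by rewrite -!natrM ler_nat.
move=> sm.
(* The premise [sm] makes [s^2] at least a constant times [n], while smallness of the rate gives
   [D^2 n >= E^2]; the product of these yields [s D >= 1]. *)
have sD : 1 <= s * D.
  rewrite -(@ler_pXn2r _ 2) ?nnegrE ?mulr_ge0 ?(ltW s0) ?(ltW D0) //.
  rewrite expr1n exprMn.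
  have h1 : r2 * n%:R <= 16 * Q%:R * s ^+ 2.
    have := ler_wpM2l (ltW r20) nmR.
    have := ler_wpM2l (ltW Q0) sm; clear; lra.
  have h2 : r2 * (D ^+ 2 * n%:R) <= 16 * Q%:R * (s ^+ 2 * D ^+ 2).
    have := ler_wpM2l (sqr_ge0 D) h1; clear; lra.
  have h3 : 32 * Q%:R <= r2 * E by rewrite [leRHS]mulrC -ler_pdivrMr.
  have h4 : r2 * E <= r2 * (D ^+ 2 * n%:R).
    by rewrite ler_pM2l //; apply: le_trans EE En.
  have : 16 * Q%:R * 1 <= 16 * Q%:R * (s ^+ 2 * D ^+ 2).
    by move: Q0 h2 h3 h4; clear; lra.
  by rewrite ler_pM2l // mulr_gt0.
(* The upper limit for [j]. Its inverse is a multiple of [t s^4 / D], which [s D >= 1] bounds by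
   [s^5 t]. *)
pose X := ka * D / (t * s ^+ 4).
have ts0 : 0 < t * s ^+ 4 by rewrite mulr_gt0 ?exprn_gt0.
have qts : q = s * (t * s ^+ 4) by rewrite /q; ring.
have X2 : 2 <= X.
  rewrite /X ler_pdivlMr //.
  have h1 : 2 <= ka * E by rewrite [leRHS]mulrC -ler_pdivrMr.
  have h2 : E * (t * s ^+ 4) <= D.
    have a1 : t * s ^+ 4 <= q by rewrite qts ler_peMl // ltW.
    have a2 : E * (t * s ^+ 4) <= E ^+ 2 * q by apply: ler_pM => //; exact: ltW.
    apply: (le_trans a2); apply: (le_trans Eq).
    by rewrite expr2 ler_piMl // ltW.
  have := ler_wpM2l (ltW ka0) h2; have := ler_wpM2r (ltW ts0) h1; clear; lra.
have /andP[jl ju] : ((Num.trunc X)%:R <= X < (Num.trunc X).+1%:R).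
  by apply: truncn_itv; apply: le_trans X2.
set jX := Num.trunc X in jl ju.
have jX0 : (1 < jX.+1)%N by rewrite -(ltr_nat R); move: X2 ju; clear; lra.
have XjX : X <= 2 * jX%:R.
  have : 1 <= jX%:R :> R by rewrite ler1n -ltnS.
  by move: ju; rewrite -addn1 natrD; clear; lra.
have m20 : (0 < m./2)%N by rewrite half_gt0; apply: leq_trans m4.
have mh : (m <= 4 * m./2)%N.
  have := odd_double_half m; rewrite -muln2; move: m4; clear; case: (odd m) => /=; lia.
pose j := minn m./2 jX.
have j0 : (0 < j)%N by rewrite /j leq_min m20 -ltnS.
exists j; split => //.
- have : (j <= m./2)%N by rewrite geq_minl.
  by have := odd_double_half m; rewrite -muln2; clear; case: (odd m) => /=; lia.
- have jX' : j%:R <= X by apply: le_trans jl; rewrite ler_nat geq_minr.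
  have jts : j%:R * (t * s ^+ 4) <= ka * D by rewrite -ler_pdivlMr.
  have j0R : 0 <= j%:R :> R by [].
  have sq : (j%:R * (t * s ^+ 4)) ^+ 2 <= ka2 * D ^+ 2.
    rewrite -kaE -exprMn; apply: lerXn2r => //.
      by rewrite nnegrE mulr_ge0 // ltW.
    by rewrite nnegrE mulr_ge0 // ltW.
  have kZ : 384 ^+ 2 * Z * ka2 = r2 ^+ 3 * nu0 ^+ 2 / 2.
    by rewrite /ka2; field; rewrite gt_eqF.
  have nu : nu0 <= r2 * m%:R / (128 * N%:R).
    rewrite /nu0 ler_pdivrMr ?mulr_gt0 // mulrAC ler_pdivlMr; last first.
      by rewrite mulr_gt0 // ltr0n; apply: leq_trans mN.
    have : N%:R <= n%:R :> R by rewrite ler_nat.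
    move=> h; have := ler_wpM2l (ltW r20) (le_trans h nmR).
    have : 0 <= r2 * (Q%:R * m%:R) by rewrite mulr_ge0 ?mulr_ge0 // ltW.
    by clear; lra.
  apply: (@le_lt_trans _ _ (r2 ^+ 3 * nu0 ^+ 2 / 2 * D ^+ 2)).
    rewrite -kZ (_ : _ * (1 + r2 / 128) = 384 ^+ 2 * Z * (j%:R * (t * s ^+ 4)) ^+ 2);
      last by rewrite /Z; ring.
    by rewrite -[leRHS]mulrA (ler_wpM2l (mulr_ge0 (sqr_ge0 _) (ltW Z0))).
  apply: (@lt_le_trans _ _ (r2 ^+ 3 * nu0 ^+ 2 * D ^+ 2)).
    have : 0 < r2 ^+ 3 * nu0 ^+ 2 * D ^+ 2.
      by apply: mulr_gt0; [apply: mulr_gt0|]; apply: exprn_gt0.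
    by clear; lra.
  rewrite mulrAC ler_wpM2l //.
    by apply: mulr_ge0; apply: exprn_ge0; apply: ltW.
  by apply: lerXn2r; rewrite ?nnegrE ?(ltW nu00) // (le_trans (ltW nu00)).
have jV : j%:R^-1 <= (m./2)%:R^-1 + jX%:R^-1 :> R.
  rewrite /j; case: (leqP m./2 jX) => h.
    by rewrite lerDl invr_ge0.
  by rewrite lerDr invr_ge0.
apply: le_trans jV _; rewrite mulrDl.
have b1 : (m./2)%:R^-1 <= 16 * Q%:R * n%:R^-1 :> R.
  rewrite ler_pdivlMr // [leLHS]mulrC ler_pdivrMr ?ltr0n //.
  apply: le_trans nmR _.
  have : m%:R <= 4 * (m./2)%:R :> R by rewrite -natrM ler_nat.
  move=> h; have := ler_wpM2l (ltW Q0) h.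
  have : 0 <= Q%:R * (m./2)%:R :> R by rewrite mulr_ge0 // ltW.
  by clear; lra.
have b2 : jX%:R^-1 <= 2 / ka * q.
  have jX0R : 0 < jX%:R :> R by rewrite ltr0n -ltnS.
  have X0 : 0 < X by apply: lt_le_trans X2.
  apply: (@le_trans _ _ (2 / X)).
    by rewrite -[leLHS]mul1r ler_pdivrMr // mulrAC ler_pdivlMr // mul1r.
  rewrite /X qts invf_div [leLHS]mulrA ler_pdivrMr ?mulr_gt0 //.
  rewrite (_ : _ * (ka * D) = 2 * (t * s ^+ 4) * (s * D)); last by field; rewrite gt_eqF.
  by rewrite ler_peMr // mulr_ge0 // ltW.
have a1 : 0 <= 16 * Q%:R * q by rewrite !mulr_ge0 // ltW.
have a2 : 0 <= 2 / ka * n%:R^-1 by rewrite mulr_ge0 ?invr_ge0 // ltW.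
by rewrite !mulrDr; move: a1 a2 b1 b2; clear; lra.
Qed.

End FiniteTheorem.

Section FiniteBound.
Variable R : realType.
Local Notation C := R[i].

Lemma le_sqrt_self (x : R) : 0 <= x -> x <= 1 -> x <= Num.sqrt x.
Proof.
move=> x0 x1; rewrite -{1}[x]ger0_norm // -sqrtr_sqr ler_wsqrtr //.
by rewrite expr2 ler_piMl.
Qed.

Lemma sqrtD_le (x y : R) : 0 <= x -> 0 <= y ->
  Num.sqrt (x + y) <= Num.sqrt x + Num.sqrt y.
Proof.
move=> x0 y0; rewrite -(@ler_pXn2r _ 2) ?nnegrE ?addr_ge0 ?sqrtr_ge0 //.
rewrite sqr_sqrtr ?addr_ge0 // sqrrD !sqr_sqrtr // addrAC lerDl.
by rewrite mulrn_wge0 // mulr_ge0 ?sqrtr_ge0.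
Qed.

(** The left side is at most the square root of a constant times the rate; as the rate is at most
    one, this is below the fourth root. *)
Lemma tail_numerics (p c3 D s t : R) (n j : nat) : 0 < p -> 0 < c3 -> 0 < D ->
  D <= 1 -> 0 < s -> 0 < t -> (0 < j)%N -> rate D s t n <= 1 ->
  j%:R^-1 <= c3 * (s ^+ 5 * t + n%:R^-1) ->
  Num.sqrt (5 / Num.sqrt (p * j%:R) + 5 / Num.sqrt (p * D ^+ 2 * j%:R)) <=
  Num.sqrt (10 * Num.sqrt c3 / Num.sqrt p) * Num.sqrt (Num.sqrt (rate D s t n)).
Proof.
move=> p0 c30 D0 D1 s0 t0 j0 rr1 hj.
have jR : 0 < j%:R :> R by rewrite ltr0n.
have q0 : 0 <= s ^+ 5 * t by rewrite mulr_ge0 ?exprn_ge0 // ltW.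
have nV : 0 <= n%:R^-1 :> R by rewrite invr_ge0.
have rr0 : 0 <= rate D s t n.
  by rewrite divr_ge0 ?addr_ge0 ?invr_ge0 ?sqrtr_ge0 // ltW.
have sp : 0 < Num.sqrt p by rewrite sqrtr_gt0.
have sj : 0 < Num.sqrt (j%:R : R) by rewrite sqrtr_gt0.
have sc : 0 < Num.sqrt c3 by rewrite sqrtr_gt0.
rewrite -sqrtrM; last by rewrite divr_ge0 ?mulr_ge0 // ltW.
apply: ler_wsqrtr.
apply: (@le_trans _ _ (10 * Num.sqrt c3 / Num.sqrt p * rate D s t n)); last first.
  apply: ler_wpM2l; last exact: le_sqrt_self.
  by rewrite divr_ge0 ?mulr_ge0 // ltW.
have -> : Num.sqrt (p * D ^+ 2 * j%:R) = Num.sqrt p * D * Num.sqrt j%:R.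
  have pD : 0 <= p * D ^+ 2 by rewrite mulr_ge0 ?sqr_ge0 // ltW.
  by rewrite (sqrtrM _ pD) (sqrtrM _ (ltW p0)) sqrtr_sqr gtr0_norm.
rewrite sqrtrM ?(ltW p0) //.
set a := Num.sqrt p in sp *; set b := Num.sqrt j%:R in sj *.
have le1 : 5 / (a * b) <= 5 / (a * D * b).
  rewrite ler_wpM2l // lef_pV2 ?posrE ?mulr_gt0 // mulrAC.
  by rewrite ler_piMr // mulr_ge0 // ltW.
apply: (@le_trans _ _ (10 / a / D * b^-1)).
  rewrite (_ : 10 / a / D * b^-1 = 5 / (a * D * b) + 5 / (a * D * b)).
    by rewrite lerD2r.
  by field; rewrite !gt_eqF.
have hb : b^-1 <= Num.sqrt c3 * (Num.sqrt (s ^+ 5 * t) + (Num.sqrt n%:R)^-1).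
  rewrite /b -sqrtrV //; apply: le_trans (ler_wsqrtr hj) _.
  rewrite sqrtrM ?(ltW c30) // ler_wpM2l ?(ltW sc) //.
  by apply: le_trans (sqrtD_le q0 nV) _; rewrite sqrtrV.
apply: le_trans (ler_wpM2l _ hb) _.
  by rewrite !divr_ge0 // ltW.
rewrite /rate; apply: le_of_eq.
move: (_ + (Num.sqrt n%:R)^-1) => z.
by field; rewrite (gt_eqF D0) (gt_eqF sp).
Qed.

(** Unless the bound is trivial, a tall nearly singular matrix has, by [spread] with [j = m], at
    least [m] indices [k] at which the event of [column_bound] occurs. Averaging over [k] thus costs
    only the ratio of [N.+1] to [m], at most [4 Q], where a union bound would cost a factor [n]. *)
Theorem finite_bound (p r2 : R) : 0 < p -> p <= 1 -> 0 < r2 ->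
  exists2 C0 : R, 0 < C0 &
  forall (K W : finType) (mu : K -> W -> R) (N : nat)
    (e : 'I_N.+1 -> 'I_N.+1 -> K) (f : 'I_N.+1 -> 'I_N.+1 -> W -> C)
    (D s t : R),
  0 < D -> D <= 1 -> independent_entries mu e f p r2 (D ^+ 2) ->
  (forall k o, minor_mx (rmx e f o) k \in unitmx) ->
  1 <= s -> 0 < t -> t <= 2 ->
  Pr mu (fun o => nearly_singular (rmx e f o) (t ^+ 2 / N.+1%:R) (s ^+ 2))
    <= C0 * Num.sqrt (Num.sqrt (rate D s t N.+1)).
Proof.
move=> p0 p1 r20.
have [Q [C1 [Q2 C10 htall]]] := not_tall_prob p0 p1.
have [E [c3 [E1 c30 hpar]]] := parameters r20 Q2.
set c := Num.sqrt (10 * Num.sqrt c3 / Num.sqrt p).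
have c0 : 0 <= c by rewrite sqrtr_ge0.
have E0 : 0 < E := lt_le_trans ltr01 E1.
have Cpos : 0 <= C1 * (1 + 16 * Q%:R) + 4 * Q%:R * c.
  by rewrite addr_ge0 // mulr_ge0 ?addr_ge0 ?mulr_ge0 // ltW.
exists (E + (C1 * (1 + 16 * Q%:R) + 4 * Q%:R * c)).
  exact: ltr_wpDr.
move=> K W mu N e f D s t D0 D1 indep minv s1 t0 t2.
have [[mu0 mu1] esym einj hs1 hs2] := indep.
have s0 : 0 < s := lt_le_trans ltr01 s1.
set rr := rate D s t N.+1.
have nR : 0 < N.+1%:R :> R by rewrite ltr0n.
have y0 : 0 < (Num.sqrt N.+1%:R)^-1 :> R by rewrite invr_gt0 sqrtr_gt0.
have rr0 : 0 < rr.
  by rewrite divr_gt0 // ltr_wpDl ?sqrtr_ge0.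
have q40 : 0 <= Num.sqrt (Num.sqrt rr) by rewrite sqrtr_ge0.
have [big|small] := leP 1 (E * rr).
  apply: le_trans (Pr_le1 mu0 mu1 _) _.
  apply: (@le_trans _ _ (E * Num.sqrt (Num.sqrt rr))); last first.
    by rewrite ler_wpM2r // lerDl.
  have [r1|r1] := leP rr 1.
    apply: le_trans big _; rewrite ler_wpM2l ?(ltW E0) //.
    have h1 := le_sqrt_self (ltW rr0) r1.
    apply: (le_trans h1); apply: le_sqrt_self; first exact: sqrtr_ge0.
    by rewrite -sqrtr1 ler_wsqrtr.
  have : 1 <= Num.sqrt (Num.sqrt rr).
    by rewrite -{1}sqrtr1 ler_wsqrtr // -{1}sqrtr1 ler_wsqrtr // ltW.
  by move=> h; apply: (le_trans h); rewrite ler_peMl.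
have rr1 : rr <= 1.
  by apply: le_trans (ltW small); rewrite ler_peMl // ltW.
have [m [[m0 mN] Qm nQm tn hj]] := hpar N D s t D0 D1 s1 t0 t2 small.
have mR : 0 < m%:R :> R by rewrite ltr0n.
pose A o := rmx e f o.
pose NS o := nearly_singular (A o) (t ^+ 2 / N.+1%:R) (s ^+ 2).
have nV : N.+1%:R^-1 <= Num.sqrt (Num.sqrt rr).
  have yrr : (Num.sqrt N.+1%:R)^-1 <= rr.
    rewrite /rr /rate ler_pdivlMr //.
    apply: (@le_trans _ _ (Num.sqrt N.+1%:R)^-1); first by rewrite ler_piMr // ltW.
    by rewrite lerDr sqrtr_ge0.
  have y1 : (Num.sqrt N.+1%:R)^-1 <= 1 :> R by apply: le_trans yrr rr1.
  apply: (@le_trans _ _ (Num.sqrt N.+1%:R)^-1).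
    rewrite -[in leLHS](@sqr_sqrtr _ N.+1%:R) // -exprVn expr2.
    by rewrite ler_piMl // ltW.
  apply: (le_trans yrr); have h1 := le_sqrt_self (ltW rr0) rr1.
  apply: (le_trans h1); apply: le_sqrt_self; first exact: sqrtr_ge0.
  by rewrite -sqrtr1 ler_wsqrtr.
have ptall : Pr mu (fun o => ~ tall (A o) m r2) <= C1 / N.+1%:R.
  by apply: htall => //; [exact: ltW|exact: leq_trans Qm _].
suff : Pr mu (fun o => tall (A o) m r2 /\ NS o) <=
    C1 * (16 * Q%:R) / N.+1%:R + 4 * Q%:R * c * Num.sqrt (Num.sqrt rr).
  move=> h.
  apply: (@le_trans _ _ (Pr mu (fun o => ~ tall (A o) m r2) +
      Pr mu (fun o => tall (A o) m r2 /\ NS o))).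
    apply: le_trans (Pr_or mu0 _ _); apply: (Pr_sub mu0) => o ns.
    by have [tA|tA] := pselect (tall (A o) m r2); [right|left].
  apply: (le_trans (lerD ptall h)).
  have K0 : 0 <= C1 * (1 + 16 * Q%:R) by apply: mulr_ge0; [exact: ltW|rewrite addr_ge0 // mulr_ge0].
  have := ler_wpM2l K0 nV; set K1 := C1 * (1 + _) => hK.
  rewrite (_ : C1 / _ + _ = K1 * N.+1%:R^-1 + 4 * Q%:R * c * Num.sqrt (Num.sqrt rr));
    last by rewrite /K1; ring.
  rewrite [leRHS]mulrDl [X in _ <= _ + X]mulrDl ler_wpDl ?lerD2r //.
  by rewrite mulr_ge0 // ltW.
(* If [s] is too small for a tall matrix, [tall_opb_lower] makes the event empty; otherwise [sm] is
   the premise under which [parameters] supplies [j]. *)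
have [sm|sm] := leP (r2 * m%:R) (8 * s ^+ 2); last first.
  have -> : Pr mu (fun o => tall (A o) m r2 /\ NS o) = 0.
    rewrite -[RHS](Ex_cst mu1 0); apply: eq_Ex => o.
    rewrite /ind asboolF // => -[tA [oA _]].
    by have := tall_opb_lower (ltn0Sn N) m0 tA oA; rewrite leNgt sm.
  have hQ : 0 <= Q%:R :> R by [].
  rewrite addr_ge0 //; last by rewrite !mulr_ge0.
  by rewrite divr_ge0 ?mulr_ge0 // ltW.
have [j [j0 jm star jle]] := hj sm.
pose Ek (k : 'I_N.+1) o := opb (A o) (s ^+ 2) /\ exists2 x : 'cV[C]_N.+1,
     r2 / (128 * s ^+ 2 * N.+1%:R) <= nsq (x k 0) & N2 (A o *m x) <= t ^+ 2 / N.+1%:R.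
have s21 : 1 <= s ^+ 2 by rewrite exprn_ege1.
have D20 : 0 < D ^+ 2 by rewrite exprn_gt0.
have D21 : D ^+ 2 <= 1 by rewrite exprn_ile1 // ltW.
have pk k : Pr mu (Ek k) <= C1 / N%:R + C1 / N%:R + c * Num.sqrt (Num.sqrt rr).
  have cb := column_bound p0 p1 D20 D21 r20 indep (minv k) s21 (sqr_ge0 t) j0 jm mN star.
  apply: (le_trans cb); apply: lerD; last exact: tail_numerics.
  apply: lerD.
    (* A principal minor and its transpose are again matrices of the form [rmx], with relabelled
       keys, so [not_tall_prob] applies to both. *)
    apply: (@le_trans _ _ (Pr mu (fun o => ~ tall (rmx
      (fun i i' => e (lift k i) (lift k i')) (fun i i' => f (lift k i) (lift k i')) o) m r2))).
      apply: (Pr_sub mu0) => o; rewrite (_ : minor_mx _ k = rmx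
        (fun i i' => e (lift k i) (lift k i')) (fun i i' => f (lift k i) (lift k i')) o) //.
      by apply/matrixP => i i'; rewrite !mxE.
    apply: htall => //; last exact: ltW.
      move=> i i' l l' /einj[] [/lift_inj -> /lift_inj ->]; by [left|right].
    by move=> i i' ii'; apply: hs1; apply: contraNneq ii' => /lift_inj ->.
  apply: (@le_trans _ _ (Pr mu (fun o => ~ tall (rmx
      (fun i i' => e (lift k i') (lift k i)) (fun i i' => f (lift k i') (lift k i)) o) m r2))).
    apply: (Pr_sub mu0) => o; rewrite (_ : (minor_mx _ k)^T = rmx
      (fun i i' => e (lift k i') (lift k i)) (fun i i' => f (lift k i') (lift k i)) o) //.
    by apply/matrixP => i i'; rewrite !mxE.
  apply: htall => //; last exact: ltW.
    move=> i i' l l' /einj[] [/lift_inj -> /lift_inj ->]; by [left|right].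
  by move=> i i' ii'; apply: hs1; apply: contraNneq ii' => /lift_inj ->.
have avg : m%:R * Pr mu (fun o => tall (A o) m r2 /\ NS o) <= \sum_k Pr mu (Ek k).
  rewrite -ExZ -Ex_sum; apply: (Ex_le mu0) => o.
  rewrite {1}/ind; case: asboolP => [[tA [oA [x x1 Ax]]]|_]; last first.
    by rewrite mulr0; apply: sumr_ge0 => k _; apply: ind_ge0.
  rewrite mulr1.
  have x0 : 0 < N2 x by rewrite x1.
  have hx : N2on (~: set0) (A o *m x) <= r2 * m%:R / (128 * m%:R) * N2 x.
    apply: le_trans (N2on_le _ _) _; apply: le_trans Ax _.
    by rewrite x1 mulr1 -mulf_div divff ?mulr1 ?gt_eqF.
  have := spread tA oA r20 m0 (leqnn m) _ hx x0; rewrite cards0 => /(_ isT) hm.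
  apply: (@le_trans _ _ #|[set i | (r2 * m%:R / (128 * m%:R * s ^+ 2 * N.+1%:R)
             * N2 x <= nsq (x i 0))%R]|%:R); first by rewrite ler_nat.
  rewrite -sum1_card natr_sum [leLHS]big_mkcond; apply: ler_sum => k _.
  rewrite inE; case: ifP => hk; last exact: ind_ge0.
  rewrite /ind asboolT //; split => //; exists x => //.
  apply: le_trans hk; rewrite x1 mulr1; apply: le_of_eq.
  move: (N.+1%:R : R) nR => q q0.
  by field; rewrite ?(gt_eqF mR) ?(gt_eqF s0) ?(gt_eqF q0).
have N0 : (0 < N)%N := leq_trans m0 mN.
have NR : 0 < N%:R :> R by rewrite ltr0n.
have avg2 := le_trans avg (ler_sum _ (fun k _ => pk k)).
rewrite sumr_const card_ord -[leRHS]mulr_natl in avg2.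
have nm : N.+1%:R <= 4 * Q%:R * m%:R :> R by rewrite -!natrM ler_nat.
have N2n : N%:R^-1 <= 2 * N.+1%:R^-1 :> R.
  rewrite -[2 * _]invf_div lef_pV2 ?posrE ?divr_gt0 //.
  by rewrite ler_pdivrMr // -natrM ler_nat muln2 -addnn -addn1 leq_add2l.
set z := Num.sqrt (Num.sqrt rr) in q40 avg2 *.
have b0 : 0 <= C1 / N%:R + C1 / N%:R + c * z.
  by rewrite !addr_ge0 ?mulr_ge0 ?invr_ge0 // ltW.
have h1 := le_trans avg2 (ler_wpM2r b0 nm).
have h2 : m%:R * Pr mu (fun o => tall (A o) m r2 /\ NS o) <=
    m%:R * (4 * Q%:R * (C1 / N%:R + C1 / N%:R + c * z)).
  by apply: (le_trans h1); apply: le_of_eq; ring.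
rewrite ler_pM2l // in h2; apply: (le_trans h2).
have h3 := ler_wpM2l (ltW C10) N2n.
have : 4 * Q%:R * (C1 / N%:R + C1 / N%:R + c * z) <=
    4 * Q%:R * (C1 * (2 * N.+1%:R^-1) + C1 * (2 * N.+1%:R^-1) + c * z).
  rewrite ler_wpM2l ?mulr_ge0 // lerD2r lerD //.
move/le_trans; apply; apply: le_of_eq; ring.
Qed.

End FiniteBound.

(** * Singular values *)

Section SingularValues.
Variable R : realType.
Local Notation C := R[i].

Lemma singular_values_spectral N (A : 'M[C]_N.+1) :
  exists (P : 'M[C]_N.+1) (d : 'I_N.+1 -> R),
  [/\ P^t* *m P = 1%:M, P *m P^t* = 1%:M, (forall k, 0 <= d k),
    forall x, N2 (A *m x) = \sum_k d k * nsq ((P *m x) k 0) &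
    singular_values A = sort (fun x y => y <= x)
      [seq Num.sqrt (d k) | k <- enum 'I_N.+1]].
Proof.
have [P [d [PP PP' d0 dE hA]]] := gram_spectral A.
exists P, d; split => //; rewrite /singular_values; congr sort.
by apply: eq_map => k; rewrite dE.
Qed.

Lemma ge_sorted (l : seq R) : sorted (fun x y => y <= x) (sort (fun x y => y <= x) l).
Proof. by apply: sort_sorted => x y; apply: le_total. Qed.

Lemma singular_value_extrema N (A : 'M[C]_N.+1) :
  exists (P : 'M[C]_N.+1) (d : 'I_N.+1 -> R),
  [/\ forall x, N2 (P *m x) = N2 x, (forall k, 0 <= d k),
    forall x, N2 (A *m x) = \sum_k d k * nsq ((P *m x) k 0),
    forall k, singular_value A N.+1 <= Num.sqrt (d k) <= singular_value A 1 &
    forall m, (0 < m <= N.+1)%N -> exists2 x, N2 x = 1 &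
      singular_value A m = Num.sqrt (N2 (A *m x))].
Proof.
have [P [d [PP PP' d0 hA svE]]] := singular_values_spectral A.
exists P, d; rewrite /singular_value svE /=; set l := [seq _ | _ <- _].
have sl : size (sort (fun x y => y <= x) l) = N.+1.
  by rewrite size_sort size_map size_enum_ord.
have ord i j : (i <= j < N.+1)%N ->
    nth 0 (sort (fun x y => y <= x) l) j <= nth 0 (sort (fun x y => y <= x) l) i.
  move=> /andP[ij jN]; apply: (sorted_leq_nth (leT := fun x y => y <= x)) => //.
  - by move=> x0 y z xy yz; apply: le_trans yz xy.
  - exact: ge_sorted.
  - by rewrite inE sl (leq_ltn_trans ij).
  - by rewrite inE sl.
split => //; first by move=> x; apply: N2_unitary.
  move=> k; have : Num.sqrt (d k) \in sort (fun x y => y <= x) l.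
    by rewrite mem_sort; apply: map_f; rewrite mem_enum.
  move=> /(nthP 0); case=> i; rewrite sl => iN <-.
  by apply/andP; split; apply: ord; rewrite ?iN // ltnSn andbT -ltnS.
case=> // m mN; have : nth 0 (sort (fun x y => y <= x) l) m \in l.
  by rewrite -(mem_sort (fun x y => y <= x)) mem_nth // sl.
move=> /mapP[k _ /= ->]; have [e1 e2] := unit_eigenvector k PP' PP hA.
by exists (P^t* *m delta_mx k 0); rewrite ?e2.
Qed.

Lemma singular_value_lastP N (A : 'M[C]_N.+1) (tau : R) : 0 <= tau ->
  singular_value A N.+1 <= tau <->
  exists2 x : 'cV[C]_N.+1, N2 x = 1 & N2 (A *m x) <= tau ^+ 2.
Proof.
move=> tau0; have [P [d [NP d0 hA hd hv]]] := singular_value_extrema A.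
split => [|[x x1 hx]].
  have [|x x1 ->] := hv N.+1; first by rewrite ltnSn.
  move=> h; exists x => //; rewrite -(sqr_sqrtr (N2_ge0 (A *m x))).
  by apply: lerXn2r => //; rewrite nnegrE ?sqrtr_ge0.
have [//|lt] := leP (singular_value A N.+1) tau; exfalso.
have d1 k : singular_value A N.+1 ^+ 2 <= d k.
  have /andP[h _] := hd k; rewrite -(sqr_sqrtr (d0 k)).
  by apply: lerXn2r; rewrite ?nnegrE ?sqrtr_ge0 // (le_trans tau0 (ltW lt)).
have : singular_value A N.+1 ^+ 2 <= N2 (A *m x).
  rewrite hA -[leLHS]mulr1 -x1 -(NP x) [X in _ * X]/N2 mulr_sumr.
  by apply: ler_sum => k _; rewrite ler_wpM2r ?nsq_ge0.
move=> /le_trans /(_ hx); rewrite leNgt => /negP; apply.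
by rewrite ltrXn2r // ltW.
Qed.

Lemma singular_value_firstP N (A : 'M[C]_N.+1) (s : R) : 0 <= s ->
  singular_value A 1 <= s <-> opb A (s ^+ 2).
Proof.
move=> s0; have [P [d [NP d0 hA hd hv]]] := singular_value_extrema A.
split => [h x|h].
  rewrite hA -(NP x) [X in _ * X]/N2 mulr_sumr; apply: ler_sum => k _.
  have /andP[_ hk] := hd k; rewrite ler_wpM2r ?nsq_ge0 // -(sqr_sqrtr (d0 k)).
  by apply: lerXn2r; rewrite ?nnegrE ?sqrtr_ge0 // (le_trans hk).
have [//|x x1 ->] := hv 1; have := h x; rewrite x1 mulr1 => hx.
by rewrite -(@ler_pXn2r _ 2) ?nnegrE ?sqrtr_ge0 // sqr_sqrtr ?N2_ge0.
Qed.

Lemma N2_triangle n (x y : 'cV[C]_n) :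
  Num.sqrt (N2 (x + y)) <= Num.sqrt (N2 x) + Num.sqrt (N2 y).
Proof.
rewrite -(@ler_pXn2r _ 2) ?nnegrE ?addr_ge0 ?sqrtr_ge0 //.
rewrite sqr_sqrtr ?N2_ge0 // sqrrD !sqr_sqrtr ?N2_ge0 // addrAC.
pose S := \sum_i x i 0 * (y i 0)^*%C.
have -> : N2 (x + y) = N2 x + N2 y + 2 * complex.Re S.
  rewrite /S Re_sum mulr_sumr /N2 -!big_split; apply: eq_bigr => i _ /=.
  rewrite mxE; case: (x i 0) (y i 0) => [a b] [c d]; rewrite /nsq /=; ring.
rewrite lerD2l -[leRHS]mulr_natl ler_wpM2l // -sqrtrM ?N2_ge0 //.
apply: le_trans (ler_norm _) _; rewrite -sqrtr_sqr; apply: ler_wsqrtr.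
apply: (@le_trans _ _ (nsq S)); first by rewrite lerDl sqr_ge0.
apply: le_trans (cauchy_schwarz _ _ _ _) _.
by rewrite ler_wpM2l ?N2_ge0 // /N2; apply: ler_sum => i _; rewrite nsqC.
Qed.

(** The squared Frobenius norm. *)
Definition entry_sum n (A : 'M[C]_n) : R := \sum_i \sum_j nsq (A i j).

Lemma opb_entry_sum n (A : 'M[C]_n) : opb A (entry_sum A).
Proof.
move=> x; rewrite /N2 mulr_suml; apply: ler_sum => i _; rewrite mxE.
exact: cauchy_schwarz.
Qed.

(** The perturbation has norm at most its Frobenius norm, which the hypotheses keep below both [s]
    and [t / sqrt n]; hence the doubling of [s] and [t]. *)
Lemma nearly_singular_perturb N (A A' : 'M[C]_N.+1) (s t d2 : R) :
  0 <= d2 -> (forall i j, nsq (A' i j - A i j) <= d2) ->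
  N.+1%:R ^+ 2 * d2 <= s ^+ 2 -> N.+1%:R ^+ 2 * d2 <= t ^+ 2 / N.+1%:R ->
  nearly_singular A (t ^+ 2 / N.+1%:R) (s ^+ 2) ->
  nearly_singular A' ((2 * t) ^+ 2 / N.+1%:R) ((2 * s) ^+ 2).
Proof.
move=> d0 hd hs ht [oA [x x1 Ax]].
have oE y : N2 ((A' - A) *m y) <= N.+1%:R ^+ 2 * d2 * N2 y.
  apply: le_trans (opb_entry_sum _ _) _; rewrite ler_wpM2r ?N2_ge0 //.
  apply: (@le_trans _ _ (\sum_(i < N.+1) \sum_(j < N.+1) d2)).
    by apply: ler_sum => i _; apply: ler_sum => j _; rewrite !mxE hd.
  by rewrite !sumr_const card_ord -mulrnA -[leLHS]mulr_natl natrM expr2.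
have A'E y : A' *m y = A *m y + (A' - A) *m y by rewrite mulmxBl addrC subrK.
split => [y|].
  rewrite A'E; apply: le_trans (N2D_le _ _) _.
  have := oA y; have := oE y; have := ler_wpM2r (N2_ge0 y) hs.
  rewrite exprMn (_ : 2 ^+ 2 = 2 + 2 :> R); last by ring.
  by move=> h1 h2 h3; rewrite !mulrDl; lra.
exists x => //; rewrite A'E; apply: le_trans (N2D_le _ _) _.
have hx := oE x; rewrite x1 mulr1 in hx.
rewrite exprMn -[leRHS]mulrA (_ : 2 ^+ 2 = 2 + 2 :> R); last by ring.
by rewrite [leRHS]mulrDl lerD // ler_wpM2l // (le_trans hx ht).
Qed.

Lemma N2_close n (A : 'M[C]_n) : exists2 K : R, 0 <= K &
  forall (x y : 'cV[C]_n) e, 0 < e -> (forall i, nsq (x i 0 - y i 0) <= e ^+ 2) ->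
  `|Num.sqrt (N2 (A *m x)) - Num.sqrt (N2 (A *m y))| <= K * e.
Proof.
have es0 : 0 <= entry_sum A.
  by apply: sumr_ge0 => i _; apply: sumr_ge0 => j _; apply: nsq_ge0.
exists (Num.sqrt (entry_sum A * n%:R)); first by rewrite sqrtr_ge0.
have dist (y z : 'cV[C]_n) :
    `|Num.sqrt (N2 y) - Num.sqrt (N2 z)| <= Num.sqrt (N2 (y - z)).
  have h1 := N2_triangle (y - z) z; have h2 := N2_triangle (z - y) y.
  rewrite subrK in h1; rewrite subrK -(opprB y z) N2N in h2.
  by rewrite ler_norml; apply/andP; split; move: h1 h2; clear; lra.
move=> x y e e0 h; apply: le_trans (dist _ _) _; rewrite -mulmxBr.
have hN : N2 (x - y) <= n%:R * e ^+ 2.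
  apply: (@le_trans _ _ (\sum_(i < n) e ^+ 2)).
    by apply: ler_sum => i _; rewrite !mxE h.
  by rewrite sumr_const card_ord mulr_natl.
apply: (@le_trans _ _ (Num.sqrt (entry_sum A * n%:R * e ^+ 2))).
  apply: ler_wsqrtr; apply: le_trans (opb_entry_sum _ _) _.
  by rewrite -mulrA ler_wpM2l.
by rewrite sqrtrM ?mulr_ge0 // sqrtr_sqr gtr0_norm.
Qed.

Definition dense_in n (D : 'cV[C]_n -> Prop) : Prop :=
  forall (x : 'cV[C]_n) e, 0 < e ->
  exists2 y, D y & forall i, nsq (x i 0 - y i 0) <= e ^+ 2.

(** Both norms are Lipschitz in [x] by [N2_close]. With a countable dense set this turns a condition
    on all vectors into a countable intersection, hence a measurable event. *)
Lemma N2_le_dense n (A B : 'M[C]_n) (a b : R) (D : 'cV[C]_n -> Prop) :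
  0 <= a -> 0 <= b -> dense_in D ->
  (forall x, D x -> a ^+ 2 * N2 (A *m x) <= b ^+ 2 * N2 (B *m x)) ->
  forall x, a ^+ 2 * N2 (A *m x) <= b ^+ 2 * N2 (B *m x).
Proof.
move=> a0 b0 dD hD x.
have sqE c (z : 'cV[C]_n) : 0 <= c -> c ^+ 2 * N2 z = (c * Num.sqrt (N2 z)) ^+ 2.
  by move=> _; rewrite exprMn sqr_sqrtr ?N2_ge0.
have sq0 c (z : 'cV[C]_n) : 0 <= c -> 0 <= c * Num.sqrt (N2 z).
  by move=> ?; rewrite mulr_ge0 ?sqrtr_ge0.
rewrite !sqE //; apply: lerXn2r; rewrite ?nnegrE ?sq0 //.
have [K1 K10 hA] := N2_close A; have [K2 K20 hB] := N2_close B.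
apply/ler_addgt0Pr => e e0.
pose K := a * K1 + b * K2 + 1.
have K0 : 0 < K by rewrite ltr_wpDl // addr_ge0 // mulr_ge0.
have [y Dy hy] := dD x (e / K) (divr_gt0 e0 K0).
have := hD y Dy; rewrite !sqE // ler_pXn2r ?nnegrE ?sq0 // => hyy.
have := hA x y _ (divr_gt0 e0 K0) hy; have := hB x y _ (divr_gt0 e0 K0) hy.
rewrite !ler_norml => /andP[h1 _] /andP[_ h2].
have eK : a * (K1 * (e / K)) + b * (K2 * (e / K)) <= e.
  rewrite (_ : _ + _ = e * ((a * K1 + b * K2) / K)); last by ring.
  by rewrite ler_piMr ?(ltW e0) // ler_pdivrMr // mul1r lerDl.
have := ler_wpM2l a0 h2; have := ler_wpM2l b0 h1.
by move: hyy eK; clear; lra.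
Qed.

End SingularValues.

From mathcomp Require Import finmap.
From mathcomp Require Import all_classical all_reals all_analysis.
From mathcomp Require Import measurable_realfun.
Import Order.TTheory GRing.Theory Num.Theory ComplexField.Normc.
Import numFieldNormedType.Exports.
Local Open Scope classical_set_scope.
Local Open Scope ring_scope.
Local Open Scope complex_scope.

(** * Discretization of laws *)

Section Grid.
Variable R : realType.
Local Notation C := R[i].

(** For a map into a finite type this is measurability with respect to all subsets. *)
Definition measurable_fibres d (T : measurableType d) (V : Type) (c : T -> V) :=
  forall v, measurable (c @^-1` [set v]).

Lemma count_below (M : nat) (k : nat) :
  (\sum_(i < M) (i <= k : nat) = minn M k.+1)%N.
Proof.
elim: M => [|M IH]; first by rewrite big_ord0 min0n.
by rewrite big_ord_recr /= IH; case: leqP; lia.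
Qed.

(* Rounding to the nearest lower point of the grid of mesh [e] on [-L, L],
   encoded by the comparisons with the grid points. *)
Lemma real_grid (e L : R) : 0 < e -> 0 < L ->
  exists (V : finType) (code : R -> V) (val : V -> R),
  measurable_fibres code /\
  forall x, `|x| <= L -> `|x - val (code x)| <= e.
Proof.
move=> e0 L0; pose M := (Num.trunc (2 * L / e)).+1.
have /andP[_ hM] : ((Num.trunc (2 * L / e))%:R <= 2 * L / e < M%:R).
  by apply: truncn_itv; rewrite divr_ge0 // ?mulr_ge0 // ltW.
pose code (x : R) := [ffun i : 'I_M => - L + i%:R * e <= x].
(* When [x] lies in cell [k], the points numbered 0 to [k] are at most [x], one more than [k]; hence
   the extra [- e]. *)
pose val (v : {ffun 'I_M -> bool}) : R :=
  - L - e + e * \sum_(i < M) (v i)%:R.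
exists {ffun 'I_M -> bool}, code, val; split.
  move=> v.
  have -> : code @^-1` [set v] = \bigcap_(i in [set: 'I_M])
      (if v i then [set` `[- L + i%:R * e, +oo[] else [set` `]-oo, - L + i%:R * e[]).
    apply/seteqP; split => x /=.
      move=> <- i _; rewrite ffunE; case: ifPn; rewrite /= in_itv /= ?andbT //.
      by rewrite -ltNge.
    move=> h; apply/ffunP => i; rewrite ffunE; have := h i Logic.I.
    case: (v i) => /=; rewrite in_itv /= ?andbT // => hx.
    by apply/negbTE; rewrite -ltNge.
  apply: fin_bigcap_measurable; first exact: finite_finset.
  by move=> i _; case: ifP => _; apply: measurable_itv.
move=> x; rewrite ler_norml => /andP[xl xu].
pose y := (x + L) / e.
have y0 : 0 <= y by rewrite divr_ge0 ?(ltW e0) //; lra.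
have /andP[kl ku] := truncn_itv y0; set k := Num.trunc y in kl ku.
have yM : y < M%:R.
  apply: le_lt_trans hM; rewrite /y ler_wpM2r ?invr_ge0 ?(ltW e0) //; lra.
have SE : \sum_(i < M) (code x i)%:R = (minn M k.+1)%:R :> R.
  rewrite -count_below natr_sum; apply: eq_bigr => i _; congr (_%:R).
  rewrite ffunE; congr nat_of_bool.
  rewrite -lerBrDl opprK -ler_pdivlMr // -/y.
  apply/idP/idP => [iy|ik].
    by rewrite -ltnS -(ltr_nat R) (le_lt_trans iy).
  by apply: le_trans kl; rewrite ler_nat.
rewrite /val SE.
have xE : x = e * y - L by rewrite /y mulrC divfK ?addrK // gt_eqF.
have hS : y <= (minn M k.+1)%:R <= y + 1.
  apply/andP; split; first by case: leqP => _; exact: ltW.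
  have : (minn M k.+1)%:R <= k.+1%:R :> R by rewrite ler_nat geq_minr.
  by rewrite -addn1 natrD; lra.
have -> : x - (- L - e + e * (minn M k.+1)%:R) = e * (y + 1 - (minn M k.+1)%:R).
  by rewrite {1}xE; ring.
rewrite normrM gtr0_norm // ler_piMr ?(ltW e0) // ler_norml.
by move/andP: hS => [h1 h2]; apply/andP; split; move: h1 h2; clear; lra.
Qed.

Lemma nsq_le_coords (e x y : R) : `|x| <= e / 2 -> `|y| <= e / 2 ->
  x ^+ 2 + y ^+ 2 <= e ^+ 2.
Proof.
have sq t : `|t| <= e / 2 -> t ^+ 2 <= (e / 2) ^+ 2.
  move=> ht; rewrite -[t ^+ 2]ger0_norm ?sqr_ge0 // normrX.
  by apply: lerXn2r; rewrite ?nnegrE // (le_trans _ ht).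
move=> /sq hx /sq hy; have := sqr_ge0 e.
by move: hx hy; rewrite exprMn expr2 (_ : 2^-1 ^+ 2 = 4^-1); [lra|field].
Qed.

Lemma complex_grid (e L : R) : 0 < e -> 0 < L ->
  exists (V : finType) (code : C -> V) (val : V -> C),
  measurable_fibres code /\
  forall z, nsq z <= L ^+ 2 -> nsq (z - val (code z)) <= e ^+ 2.
Proof.
move=> e0 L0; have e20 : 0 < e / 2 by rewrite divr_gt0.
have [V [code [val [mc hc]]]] := real_grid e20 L0.
exists (V * V)%type, (fun z => (code (complex.Re z), code (complex.Im z))),
  (fun v => val v.1 +i* val v.2); split.
  move=> [v1 v2].
  have -> : (fun z => (code (complex.Re z), code (complex.Im z))) @^-1` [set (v1, v2)]
      = (@reim R) @^-1` (code @^-1` [set v1] `*` code @^-1` [set v2]).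
    by apply/seteqP; split => -[a b] /= => [[]|[]] -> ->.
  rewrite -[X in measurable X]setTI; apply: measurable_reim => //.
  by apply: measurableX.
case=> a b; rewrite /nsq /= => h.
have ab t : t ^+ 2 <= L ^+ 2 -> `|t| <= L.
  by move=> ht; rewrite -(@ler_pXn2r _ 2) ?nnegrE ?(ltW L0) // -normrX ger0_norm ?sqr_ge0.
have ha : `|a - val (code a)| <= e / 2.
  by apply/hc/ab; have := sqr_ge0 b; lra.
have hb : `|b - val (code b)| <= e / 2.
  by apply/hc/ab; have := sqr_ge0 a; lra.
exact: nsq_le_coords.
Qed.

End Grid.

Section FiniteLaw.
Context d (T : measurableType d) (R : realType) (Q : probability T R).
Variables (V : finType) (c : T -> V).
Hypothesis mc : measurable_fibres c.

Lemma measurable_code_event (G : V -> Prop) : measurable [set w | G (c w)].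
Proof.
have -> : [set w | G (c w)] = \bigcup_(v in [set v | G v]) (c @^-1` [set v]).
  apply/seteqP; split => w /=; first by move=> Gw; exists (c w).
  by move=> [v /= Gv cv]; rewrite cv.
by apply: fin_bigcup_measurable => //; exact: finite_finset.
Qed.

Definition law v : R := fine (Q (c @^-1` [set v])).

Lemma law_ge0 v : 0 <= law v.
Proof. by rewrite fine_ge0. Qed.

Lemma lawE v : Q (c @^-1` [set v]) = (law v)%:E.
Proof. by rewrite /law fineK // fin_num_measure. Qed.

Lemma law_integral (phi : V -> R) : (forall v, 0 <= phi v) ->
  (\int[Q]_w (phi (c w))%:E = (\sum_v phi v * law v)%:E)%E.
Proof.
move=> phi0.
transitivity (\int[Q]_w (\sum_(v <- index_enum V)
    ((phi v)%:E * (\1_(c @^-1` [set v]) w)%:E)))%E.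
  apply: eq_integral => w _; rewrite (bigD1_seq (c w)) ?index_enum_uniq ?mem_index_enum //=.
  rewrite indicE mem_set // mule1 big1 ?adde0 // => v vc.
  by rewrite indicE memNset ?mule0 // => cv; rewrite -cv eqxx in vc.
rewrite ge0_integral_sum //; last first.
- by move=> v w _; rewrite mule_ge0 ?lee_fin.
- by move=> v; apply: emeasurable_funM => //; apply/measurable_EFinP.
rewrite -sumEFin; apply: eq_bigr => v _.
rewrite ge0_integralZl_EFin //; last by apply/measurable_EFinP.
rewrite EFinM -lawE; congr (_ * _)%E.
by rewrite integral_indic // setIT.
Qed.

Lemma law_event (G : V -> Prop) :
  Q [set w | G (c w)] = (\sum_v ind R (G v) * law v)%:E.
Proof.
rewrite -law_integral; last by move=> v; apply: ind_ge0.
have mG := measurable_code_event G.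
transitivity (\int[Q]_w (\1_[set w | G (c w)] w)%:E)%E.
  by rewrite integral_indic // setIT.
apply: eq_integral => w _.
rewrite indicE /ind; congr (_%:R%:E).
Qed.

Lemma law_sum : \sum_v law v = 1.
Proof.
have h : Q setT = (\sum_v ind R True * law v)%:E.
  by rewrite -(law_event (fun=> True)); congr (Q _); apply/seteqP; split.
rewrite probability_setT in h; have -> : 1 = \sum_v ind R True * law v by case: h.
by apply: eq_bigr => v _; rewrite /ind asboolT // mul1r.
Qed.

End FiniteLaw.

(** * Conditional second moments *)

Section ConditionalVariance.
Context d (T : measurableType d) (R : realType) (Q : probability T R).
Local Notation C := R[i].
Variable E : set T.
Hypothesis mE : measurable E.
Hypothesis QE : Q (~` E) = 0%E.

(** Boundedness on [E] is enough because [Q] gives [E] full mass. The entries may fail to be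
    integrable under the original law, so all moments are taken under the conditional one. *)
Definition ess_bounded (f : T -> R) :=
  measurable_fun setT f /\ exists M, forall w, E w -> `|f w| <= M.
Definition mean (f : T -> R) : R := fine 'E_Q[f].

Lemma ae_E (P : T -> Prop) : (forall w, E w -> P w) -> {ae Q, forall w, P w}.
Proof.
move=> h; exists (~` E); split => //; first exact: measurableC.
by move=> w /=; apply: contra_not => /h.
Qed.

Lemma ess_bounded_integrable f : ess_bounded f -> Q.-integrable setT (EFin \o f).
Proof.
move=> [mf [M hM]]; apply/integrableP; split; first exact/measurable_EFinP.
apply: (@le_lt_trans _ _ (`|M|%:E * Q setT)%E); last first.
  by rewrite probability_setT mule1 ltry.
apply: integral_le_bound => //; first exact/measurable_EFinP.
by apply: ae_E => w Ew _; rewrite lee_fin (le_trans (hM w Ew)) // ler_norm.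
Qed.

Lemma meanE f : ess_bounded f -> (\int[Q]_w (f w)%:E = (mean f)%:E)%E.
Proof.
move=> bf; rewrite /mean unlock fineK //.
by apply: integrable_fin_num => //; apply: ess_bounded_integrable.
Qed.

Lemma eq_mean f g : f =1 g -> mean f = mean g.
Proof. by move=> /funext ->. Qed.

Lemma ess_boundedD f g : ess_bounded f -> ess_bounded g ->
  ess_bounded (fun w => f w + g w).
Proof.
move=> [mf [M hM]] [mg [M' hM']]; split; first exact: measurable_funD.
by exists (M + M') => w Ew; apply: le_trans (ler_normD _ _) (lerD (hM _ Ew) (hM' _ Ew)).
Qed.

Lemma ess_boundedM f g : ess_bounded f -> ess_bounded g ->
  ess_bounded (fun w => f w * g w).
Proof.
move=> [mf [M hM]] [mg [M' hM']]; split; first exact: measurable_funM.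
by exists (M * M') => w Ew; rewrite normrM ler_pM // ?hM ?hM'.
Qed.

Lemma ess_bounded_cst r : ess_bounded (fun=> r).
Proof. by split => //; exists `|r|. Qed.

Lemma ess_boundedZ r f : ess_bounded f -> ess_bounded (fun w => r * f w).
Proof. by move=> bf; apply: ess_boundedM => //; apply: ess_bounded_cst. Qed.

Lemma meanD f g : ess_bounded f -> ess_bounded g ->
  mean (fun w => f w + g w) = mean f + mean g.
Proof.
move=> bf bg; have := meanE (ess_boundedD bf bg).
under eq_integral do rewrite EFinD.
rewrite integralD //; [|exact: ess_bounded_integrable..].
by rewrite !meanE // -EFinD => -[].
Qed.

Lemma meanZ r f : ess_bounded f -> mean (fun w => r * f w) = r * mean f.
Proof.
move=> bf; have := meanE (ess_boundedZ r bf).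
under eq_integral do rewrite EFinM.
rewrite integralZl //; last exact: ess_bounded_integrable.
by rewrite !meanE // -EFinM => -[].
Qed.

Lemma mean_cst r : mean (fun=> r) = r.
Proof.
by have := expectation_cst Q r; rewrite /mean => ->.
Qed.

Variables (U V : T -> C).
Hypothesis bU1 : ess_bounded (fun w => complex.Re (U w)).
Hypothesis bU2 : ess_bounded (fun w => complex.Im (U w)).
Hypothesis bV1 : ess_bounded (fun w => complex.Re (V w)).
Hypothesis bV2 : ess_bounded (fun w => complex.Im (V w)).

Let p1 w := complex.Re (U w) - mean (fun w => complex.Re (U w)).
Let p2 w := complex.Im (U w) - mean (fun w => complex.Im (U w)).
Let q1 w := complex.Re (V w) - mean (fun w => complex.Re (V w)).
Let q2 w := complex.Im (V w) - mean (fun w => complex.Im (V w)).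

Let centered f : ess_bounded f -> ess_bounded (fun w => f w - mean f) /\
  mean (fun w => f w - mean f) = 0.
Proof.
move=> bf; split; first by apply: ess_boundedD => //; apply: ess_bounded_cst.
rewrite (meanD bf (ess_bounded_cst _)) mean_cst subrr //.
Qed.

Lemma cvarE : cvar Q U = mean (fun w => p1 w * p1 w + p2 w * p2 w).
Proof.
apply: eq_mean => w; rewrite -nsq_normc /nsq /p1 /p2 -!expr2 /cexpect.
by case: (U w).
Qed.

Lemma ccovE : ccov Q U V = mean (fun w => p1 w * q1 w + p2 w * q2 w) +i*
  mean (fun w => p2 w * q1 w - p1 w * q2 w).
Proof.
rewrite /ccov {1}/cexpect; congr (_ +i* _); apply: eq_mean => w;
  rewrite /p1 /p2 /q1 /q2 /cexpect /mean; case: (U w) => a b;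
  case: (V w) => a' b' /=; ring.
Qed.

Lemma bp1 : ess_bounded p1. Proof. by have [] := centered bU1. Qed.
Lemma bp2 : ess_bounded p2. Proof. by have [] := centered bU2. Qed.
Lemma bq1 : ess_bounded q1. Proof. by have [] := centered bV1. Qed.
Lemma bq2 : ess_bounded q2. Proof. by have [] := centered bV2. Qed.

(** The witness [k] is the mean of [u U + v V - c]: centering [U] and [V] kills the linear terms and
    leaves the variances and [2 Re (u conj(v) Cov)]. *)
Lemma mean_nsq (u v c : C) : exists k : C,
  mean (fun w => nsq (u * U w + v * V w - c)) =
  nsq u * cvar Q U + nsq v * cvar Q V + nsq k +
  2 * (complex.Re (u * v^*) * complex.Re (ccov Q U V)
       - complex.Im (u * v^*) * complex.Im (ccov Q U V)) /\
  ess_bounded (fun w => nsq (u * U w + v * V w - c)).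
Proof.
have [b1 b2 b3 b4] := And4 bp1 bp2 bq1 bq2.
have m1 : mean p1 = 0 by have [] := centered bU1.
have m2 : mean p2 = 0 by have [] := centered bU2.
have m3 : mean q1 = 0 by have [] := centered bV1.
have m4 : mean q2 = 0 by have [] := centered bV2.
pose k := u * (mean (fun w => complex.Re (U w)) +i* mean (fun w => complex.Im (U w)))
  + v * (mean (fun w => complex.Re (V w)) +i* mean (fun w => complex.Im (V w))) - c.
pose f1 w := p1 w * p1 w + p2 w * p2 w.
pose f2 w := q1 w * q1 w + q2 w * q2 w.
pose f3 w := p1 w * q1 w + p2 w * q2 w.
pose f4 w := p2 w * q1 w - p1 w * q2 w.
have bf1 : ess_bounded f1 by apply: ess_boundedD; apply: ess_boundedM.
have bf2 : ess_bounded f2 by apply: ess_boundedD; apply: ess_boundedM.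
have bf3 : ess_bounded f3 by apply: ess_boundedD; apply: ess_boundedM.
have bf4 : ess_bounded f4.
  have -> : f4 = (fun w => p2 w * q1 w + (-1) * (p1 w * q2 w)).
    by apply/funext => w; rewrite /f4 mulN1r.
  by apply: ess_boundedD; [|apply: ess_boundedZ]; apply: ess_boundedM.
pose a1 := 2 * complex.Re (u * v^*).
pose a2 := - (2 * complex.Im (u * v^*)).
pose l1 := 2 * complex.Re (u * k^*); pose l2 := - (2 * complex.Im (u * k^*)).
pose l3 := 2 * complex.Re (v * k^*); pose l4 := - (2 * complex.Im (v * k^*)).
have FE : (fun w => nsq (u * U w + v * V w - c)) = (fun w =>
    nsq u * f1 w + (nsq v * f2 w + (a1 * f3 w + (a2 * f4 w +
    (l1 * p1 w + (l2 * p2 w + (l3 * q1 w + (l4 * q2 w + nsq k)))))))).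
  apply/funext => w.
  have -> : u * U w + v * V w - c = u * (p1 w +i* p2 w) + v * (q1 w +i* q2 w) + k.
    rewrite /p1 /p2 /q1 /q2 /k; case: (U w) => ? ?; case: (V w) => ? ?.
    case: (u) => ? ?; case: (v) => ? ?; case: (c) => ? ?.
    by apply/eqP; rewrite eq_complex /=; apply/andP; split; apply/eqP; ring.
  rewrite /f1 /f2 /f3 /f4 /a1 /a2 /l1 /l2 /l3 /l4.
  move: (p1 w) (p2 w) (q1 w) (q2 w) => x1 x2 y1 y2; case: (k) => k1 k2.
  case: (u) => u1 u2; case: (v) => v1 v2; rewrite /nsq /=; ring.
have B0 := ess_bounded_cst (nsq k).
have B1 := ess_boundedD (ess_boundedZ l4 b4) B0.
have B2 := ess_boundedD (ess_boundedZ l3 b3) B1.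
have B3 := ess_boundedD (ess_boundedZ l2 b2) B2.
have B4 := ess_boundedD (ess_boundedZ l1 b1) B3.
have B5 := ess_boundedD (ess_boundedZ a2 bf4) B4.
have B6 := ess_boundedD (ess_boundedZ a1 bf3) B5.
have B7 := ess_boundedD (ess_boundedZ (nsq v) bf2) B6.
have B8 := ess_boundedD (ess_boundedZ (nsq u) bf1) B7.
exists k; split; last by rewrite FE.
rewrite FE (meanD (ess_boundedZ (nsq u) bf1) B7) (meanD (ess_boundedZ (nsq v) bf2) B6).
rewrite (meanD (ess_boundedZ a1 bf3) B5) (meanD (ess_boundedZ a2 bf4) B4).
rewrite (meanD (ess_boundedZ l1 b1) B3) (meanD (ess_boundedZ l2 b2) B2).
rewrite (meanD (ess_boundedZ l3 b3) B1) (meanD (ess_boundedZ l4 b4) B0).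
rewrite !meanZ // mean_cst m1 m2 m3 m4 !mulr0 !add0r.
rewrite cvarE ccovE /= -/f1 -/f3 -/f4 /a1 /a2.
have -> : cvar Q V = mean f2.
  apply: eq_mean => w; rewrite -nsq_normc /nsq /f2 /q1 /q2 -!expr2 /cexpect.
  by case: (V w).
ring.
Qed.

(** With [a = |u|^2 Var U] and [b = |v|^2 Var V], the cross term of [mean_nsq] is at least
    [- 2 rho sqrt (a b)], hence at least [- rho (a + b)]. *)
Lemma conditional_variance (s2 rho : R) : 0 < s2 -> rho < 1 ->
  s2 <= cvar Q U -> s2 <= cvar Q V -> normc (ccorr Q U V) <= rho ->
  forall u v c : C, s2 * (1 - rho) * (nsq u + nsq v) <=
    mean (fun w => nsq (u * U w + v * V w - c)) /\
    ess_bounded (fun w => nsq (u * U w + v * V w - c)).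
Proof.
move=> s20 rho1 hU hV hc u v c; have [k [-> bF]] := mean_nsq u v c; split=> //.
have U0 : 0 < cvar Q U by lra.
have V0 : 0 < cvar Q V by lra.
have rho0 : 0 <= rho by apply: le_trans hc; rewrite /normc; case: ccorr => *; apply: sqrtr_ge0.
set a := nsq u * cvar Q U; set b := nsq v * cvar Q V.
have a0 : 0 <= a by rewrite mulr_ge0 ?nsq_ge0 // ltW.
have b0 : 0 <= b by rewrite mulr_ge0 ?nsq_ge0 // ltW.
have hcov : nsq (ccov Q U V) <= rho ^+ 2 * (cvar Q U * cvar Q V).
  have : nsq (ccorr Q U V) <= rho ^+ 2.
    rewrite nsq_normc; apply: lerXn2r => //; rewrite nnegrE //.
    by rewrite /normc; case: ccorr => *; apply: sqrtr_ge0.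
  have UV0 : 0 < cvar Q U * cvar Q V by rewrite mulr_gt0.
  have sUV : 0 < Num.sqrt (cvar Q U * cvar Q V) by rewrite sqrtr_gt0.
  rewrite /ccorr nsqM.
  have -> : nsq (((Num.sqrt (cvar Q U * cvar Q V))%:C)^-1) = (cvar Q U * cvar Q V)^-1.
    have nz : (Num.sqrt (cvar Q U * cvar Q V))%:C != 0.
      by rewrite -nsq_eq0 nsq_real gt_eqF // exprn_gt0.
    apply: (mulfI (lt0r_neq0 UV0)); rewrite mulfV ?gt_eqF //.
    rewrite -{1}(sqr_sqrtr (ltW UV0)) -nsq_real -nsqM mulfV ?nsq1 //.
  by rewrite ler_pdivrMr.
set X := complex.Re (u * v^*) * _ - _.
have hX : `|X| <= rho * ((a + b) / 2).
  rewrite -(@ler_pXn2r _ 2) ?nnegrE ?mulr_ge0 ?divr_ge0 ?addr_ge0 //.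
  rewrite -normrX ger0_norm ?sqr_ge0 //.
  apply: (@le_trans _ _ (nsq (u * v^*) * nsq (ccov Q U V))).
    rewrite /X /nsq; move: (u * v^*) (ccov Q U V) => [x y] [x' y'] /=.
    by have := sqr_ge0 (x * y' + y * x'); lra.
  rewrite nsqM nsqC; apply: (@le_trans _ _ (rho ^+ 2 * (a * b))).
    apply: le_trans (ler_wpM2l _ hcov) _; first by rewrite mulr_ge0 ?nsq_ge0.
    by apply: le_of_eq; rewrite /a /b; ring.
  rewrite exprMn ler_wpM2l ?sqr_ge0 //.
  by have := sqr_ge0 (a - b); lra.
have := nsq_ge0 k; have : - (rho * (a + b)) <= 2 * X.
  by move: hX; rewrite ler_norml => /andP[h _]; lra.
have ha : s2 * nsq u <= a by rewrite mulrC ler_wpM2l ?nsq_ge0.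
have hb : s2 * nsq v <= b by rewrite mulrC ler_wpM2l ?nsq_ge0.
have : (1 - rho) * (s2 * nsq u + s2 * nsq v) <= (1 - rho) * (a + b).
  by rewrite ler_wpM2l ?lerD //; lra.
by move=> h1 h2 h3; lra.
Qed.

End ConditionalVariance.

(** * Spread of symmetrized variables from conditional variances *)

Section PaleyZygmund.
Variable R : realType.
Local Notation C := R[i].
Variables (K W : finType) (mu : K -> W -> R) (k : K).
Hypothesis mu_ge0 : forall k w, 0 <= mu k w.
Hypothesis mu_sum : forall k, \sum_w mu k w = 1.

(* Paley-Zygmund for the symmetrized variable: averaging the hypothesis over
   [c = Y w'] bounds the second moment of [Y w - Y w'] on [G] from below. *)
Lemma pair_prob_variance (Y : W -> C) (G : {pred W}) (lam B b : R) :
  0 < b -> 0 < B -> 0 <= lam -> (forall w, w \in G -> nsq (Y w) <= B) ->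
  b <= \sum_(w in G) mu k w ->
  (forall c, lam <= \sum_(w in G) mu k w * nsq (Y w - c)) ->
  b * lam / (8 * B) <=
    pair_prob mu k (fun w w' => b * lam / 2 <= nsq (Y w - Y w')).
Proof.
move=> b0 B0 lam0 hB hb hlam; set q := b * lam / 2.
have q0 : 0 <= q by rewrite divr_ge0 // mulr_ge0 // ltW.
set pp := pair_prob _ _ _; pose m := \sum_(w in G) mu k w.
have m1 : m <= 1.
  by rewrite -(mu_sum k) /m [leLHS]big_mkcond /=; apply: ler_sum => w _; case: ifP.
have m0 : 0 <= m by apply: sumr_ge0.
have low : b * lam <= \sum_(w' in G) \sum_(w in G) mu k w * mu k w' * nsq (Y w - Y w').
  apply: (@le_trans _ _ (\sum_(w' in G) mu k w' * lam)).
    by rewrite -mulr_suml ler_wpM2r.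
  apply: ler_sum => w' _; apply: le_trans (ler_wpM2l (mu_ge0 _ _) (hlam (Y w'))) _.
  by rewrite mulr_sumr; apply: ler_sum => w _; rewrite mulrA [X in X * _]mulrC.
(* Pairs above the level [q] contribute at most [4 B] each, all others together at most [q], which
   is half of the lower bound [b * lam]. *)
have up : \sum_(w' in G) \sum_(w in G) mu k w * mu k w' * nsq (Y w - Y w') <=
    4 * B * pp + q * (m * m).
  have -> : 4 * B * pp = \sum_w' \sum_w mu k w * mu k w' *
      (4 * B * (q <= nsq (Y w - Y w'))%R%:R).
    rewrite exchange_big /= mulr_sumr; apply: eq_bigr => w _.
    by rewrite mulr_sumr; apply: eq_bigr => w' _; rewrite mulrCA.
  have -> : q * (m * m) = \sum_(w' in G) \sum_(w in G) mu k w * mu k w' * q.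
    rewrite mulrC {2}/m mulr_sumr mulr_suml; apply: eq_bigr => w' _.
    by rewrite /m !mulr_suml.
  rewrite big_mkcond [X in _ + X]big_mkcond -big_split /=; apply: ler_sum => w' _.
  case: ifPn => Gw'; last first.
    rewrite addr0; apply: sumr_ge0 => w _.
    by rewrite !mulr_ge0 // ltW.
  rewrite big_mkcond [X in _ + X]big_mkcond -big_split /=; apply: ler_sum => w _.
  case: ifPn => Gw; last by rewrite addr0 !mulr_ge0 // ltW.
  rewrite -mulrDr ler_wpM2l ?mulr_ge0 //.
  have [h|h] := lerP q (nsq (Y w - Y w')); last by rewrite mulr0 add0r ltW.
  rewrite mulr1; have := nsqB_le (Y w) (Y w'); have := hB _ Gw; have := hB _ Gw'.
  by move: q0; clear; lra.
have : q * (m * m) <= q by rewrite ler_piMr // mulr_ile1.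
rewrite ler_pdivrMr ?mulr_gt0 //; move: low up; rewrite /q.
move: (\sum_(w' in G) _) (pp) => x y.
rewrite [y * _]mulrC -!mulrA; move: (B * y) => v; clear; lra.
Qed.

End PaleyZygmund.

Section Conditioning.
Context d (T : measurableType d) (R : realType) (P : probability T R).
Local Notation C := R[i].
Variables (E : set T) (mE : measurable E) (b : R).
Hypotheses (b_gt0 : 0 < b) (PE : (b%:E <= P E)%E).

Lemma cond_probE A : cond_prob P mE A = (P (A `&` E) * ((fine (P E))^-1)%:E)%E.
Proof.
rewrite /cond_prob /= /mnormalize /= /mrestr /= setTI.
have P0 : (0 < P E)%E by apply: lt_le_trans PE; rewrite lte_fin.
rewrite gt_eqF //=; case: ifPn => // /eqP h.
by have := fin_num_measure P E mE; rewrite h => /fin_numP[_ /eqP].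
Qed.

Lemma cond_prob_le A : measurable A -> (b%:E * cond_prob P mE A <= P (A `&` E))%E.
Proof.
move=> mA; rewrite cond_probE muleA.
have fE : P E \is a fin_num by rewrite fin_num_measure.
have fA : P (A `&` E) \is a fin_num by rewrite fin_num_measure //; apply: measurableI.
rewrite -(fineK fA) -!EFinM lee_fin [b * _]mulrC -mulrA.
have bE : b <= fine (P E) by rewrite -lee_fin fineK.
rewrite ler_piMr ?fine_ge0 // ler_pdivrMr ?mul1r //.
exact: lt_le_trans bE.
Qed.

Lemma cond_probC : cond_prob P mE (~` E) = 0%E.
Proof. by rewrite cond_probE setICl measure0 mul0e. Qed.

Variables (U V : T -> C) (F : finType) (code : C -> F) (val : F -> C) (a eps : R).
Hypotheses (mU : measurable_fun setT U) (mV : measurable_fun setT V).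
Hypotheses (bU : forall w, E w -> nsq (U w) <= a ^+ 2)
           (bV : forall w, E w -> nsq (V w) <= a ^+ 2).
Hypotheses (mc : measurable_fibres code)
  (hval : forall z, nsq z <= a ^+ 2 -> nsq (z - val (code z)) <= eps ^+ 2).
Hypothesis eps1 : eps ^+ 2 <= 1.

Let c w := (code (U w), code (V w)).

Lemma measurable_pair_code : measurable_fibres c.
Proof.
move=> [v1 v2]; have -> : c @^-1` [set (v1, v2)] =
    U @^-1` (code @^-1` [set v1]) `&` V @^-1` (code @^-1` [set v2]).
  by apply/seteqP; split => w /=; [case=> <- <-|case; rewrite /c => -> ->].
by apply: measurableI; rewrite -[X in measurable X]setTI; [apply: mU|apply: mV].
Qed.

(** The event [E] need not be determined by the codes. These codes contain all those reached on [E]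
    and replace it after discretization; the bound comes from [|val|^2 <= 2 |z|^2 + 2 eps^2]. *)
Definition small_codes : {pred F * F} :=
  [pred v | (nsq (val v.1) <= 2 * a ^+ 2 + 2) && (nsq (val v.2) <= 2 * a ^+ 2 + 2)].

Lemma E_small_codes w : E w -> c w \in small_codes.
Proof.
move=> Ew; have h z : nsq z <= a ^+ 2 -> nsq (val (code z)) <= 2 * a ^+ 2 + 2.
  move=> hz; have := hval hz; rewrite -nsqN opprB => hz'.
  have := nsqD_le (val (code z) - z) z; rewrite subrK.
  by move: eps1 hz hz'; lra.
by rewrite inE /= !h ?bU ?bV.
Qed.

Lemma law_small_codes : b <= \sum_(v in small_codes) law P c v.
Proof.
rewrite -lee_fin; apply: le_trans PE _.
rewrite big_mkcond /= (_ : \sum_v _ = \sum_v ind R (v \in small_codes) * law P c v).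
  rewrite -(law_event P measurable_pair_code (fun v => v \in small_codes)).
  apply: le_measure; rewrite ?inE //; last by move=> w /E_small_codes.
  exact: (measurable_code_event measurable_pair_code (fun v => v \in small_codes)).
by apply: eq_bigr => v _; rewrite /ind asboolb; case: ifP; rewrite ?mul1r ?mul0r.
Qed.

Let Q := cond_prob P mE.

Lemma law_cond_le v : b * law Q c v <= (v \in small_codes)%:R * law P c v.
Proof.
have mv := measurable_pair_code v.
have := cond_prob_le mv; rewrite (lawE Q measurable_pair_code).
have [vG|vG] := boolP (v \in small_codes); last first.
  rewrite (_ : _ `&` E = set0) ?measure0 ?lee_fin ?mul0r //.
  apply/seteqP; split => // w /= [cw /E_small_codes].
  by rewrite cw (negPf vG).
rewrite mul1r -EFinM => /le_trans; move=> /(_ (P (c @^-1` [set v]))).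
rewrite (lawE P measurable_pair_code) lee_fin; apply.
rewrite -(lawE P measurable_pair_code).
by apply: le_measure; rewrite ?inE //; apply: measurableI.
Qed.

(** Rounding costs at most [4 eps^2 (|u|^2 + |v|^2)], half of [lam], after a factor 2 for splitting
    the square. Conditional weights are then replaced by unconditional ones through [law_cond_le],
    which costs [b]. *)
Lemma discretized_variance (u v z : C) (lam : R) :
  lam <= mean Q (fun w => nsq (u * U w + v * V w - z)) ->
  ess_bounded E (fun w => nsq (u * U w + v * V w - z)) ->
  8 * eps ^+ 2 * (nsq u + nsq v) <= lam ->
  b * lam / 4 <= \sum_(x in small_codes) law P c x *
                    nsq (u * val x.1 + v * val x.2 - z).
Proof.
move=> hlam bF heps.
pose phi (x : F * F) := 2 * nsq (u * val x.1 + v * val x.2 - z) +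
  4 * eps ^+ 2 * (nsq u + nsq v).
have phi0 x : 0 <= phi x.
  have := nsq_ge0 u; have := nsq_ge0 v; have := nsq_ge0 (u * val x.1 + v * val x.2 - z).
  move=> h1 h2 h3; apply: addr_ge0; first exact: (mulr_ge0 _ h1).
  by apply: (mulr_ge0 _ (addr_ge0 h3 h2)); apply: (mulr_ge0 _ (sqr_ge0 _)).
have : mean Q (fun w => nsq (u * U w + v * V w - z)) <= \sum_x phi x * law Q c x.
  rewrite -lee_fin -(meanE mE cond_probC bF) -(law_integral Q measurable_pair_code) //.
  apply: ae_ge0_le_integral => //.
  - by move=> w _; rewrite lee_fin nsq_ge0.
  - by apply/measurable_EFinP; case: bF.
  - by move=> w _; rewrite lee_fin.
  - apply/measurable_EFinP => _ B mB; rewrite setTI.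
    exact: (measurable_code_event measurable_pair_code (fun x => B (phi x))).
  apply: (ae_E mE cond_probC) => w Ew _; rewrite lee_fin /phi /=.
  have -> : u * U w + v * V w - z =
      (u * val (code (U w)) + v * val (code (V w)) - z) +
      (u * (U w - val (code (U w))) + v * (V w - val (code (V w)))) by ring.
  apply: le_trans (nsqD_le _ _) _; rewrite lerD2l.
  have := nsqD_le (u * (U w - val (code (U w)))) (v * (V w - val (code (V w)))).
  rewrite !nsqM.
  have := ler_wpM2l (nsq_ge0 u) (hval (bU Ew)).
  have := ler_wpM2l (nsq_ge0 v) (hval (bV Ew)); lra.
pose S := \sum_(x in small_codes) law P c x * nsq (u * val x.1 + v * val x.2 - z).
have -> : \sum_x phi x * law Q c x =
   2 * (\sum_x nsq (u * val x.1 + v * val x.2 - z) * law Q c x) +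
   4 * eps ^+ 2 * (nsq u + nsq v).
  rewrite (eq_bigr (fun x => 2 * (nsq (u * val x.1 + v * val x.2 - z) * law Q c x)
      + 4 * eps ^+ 2 * (nsq u + nsq v) * law Q c x)) => [|x _].
    by rewrite big_split -!mulr_sumr (law_sum Q measurable_pair_code) mulr1.
  by rewrite /phi mulrDl -mulrA.
have : b * (\sum_x nsq (u * val x.1 + v * val x.2 - z) * law Q c x) <= S.
  rewrite /S [leRHS]big_mkcond mulr_sumr; apply: ler_sum => x _.
  rewrite mulrCA; apply: le_trans (ler_wpM2l (nsq_ge0 _) (law_cond_le x)) _.
  by case: ifP => _; rewrite ?mul1r ?mul0r ?mulr0 // mulrC.
rewrite -/S; move: (S) (\sum_x _) => S' Y hS hY.
have := ler_wpM2l (ltW b_gt0) (le_trans hlam hY).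
have := ler_wpM2l (ltW b_gt0) heps.
by rewrite mulrDr; lra.
Qed.

End Conditioning.

(** * Reduction to finitely supported entries *)

Section Measurability.
Context d (T : measurableType d) (R : realType).
Local Notation C := R[i].

Lemma measurable_ReIm (U : T -> C) : measurable_fun setT U ->
  measurable_fun setT (fun w => complex.Re (U w)) /\
  measurable_fun setT (fun w => complex.Im (U w)).
Proof.
move=> mU; have m := measurableT_comp (@measurable_reim R) mU.
split; [exact: measurableT_comp (@measurable_fst _ _ _ _) m|].
exact: measurableT_comp (@measurable_snd _ _ _ _) m.
Qed.

Lemma measurable_complex (U : T -> C) :
  measurable_fun setT (fun w => complex.Re (U w)) ->
  measurable_fun setT (fun w => complex.Im (U w)) -> measurable_fun setT U.
Proof.
move=> mr mi _ B [B' mB' <-].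
by have := measurable_fun_pair mr mi measurableT mB'; rewrite !setTI.
Qed.

Lemma measurable_N2 n (A : T -> 'M[C]_n) (x : 'cV[C]_n) :
  (forall i j, measurable_fun setT (fun w => A w i j)) ->
  measurable_fun setT (fun w => N2 (A w *m x)).
Proof.
move=> mA; apply: measurable_sum => i.
have -> : (fun w => nsq ((A w *m x) i 0)) = (fun w =>
   (\sum_j (complex.Re (A w i j) * complex.Re (x j 0)
            - complex.Im (A w i j) * complex.Im (x j 0))) ^+ 2 +
   (\sum_j (complex.Re (A w i j) * complex.Im (x j 0)
            + complex.Im (A w i j) * complex.Re (x j 0))) ^+ 2).
  apply/funext => w; rewrite /nsq mxE Re_sum Im_sum; congr (_ ^+ 2 + _ ^+ 2);
    by apply: eq_bigr => j _; case: (A w i j) (x j 0) => [? ?] [? ?].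
have m j := measurable_ReIm (mA i j).
by apply: measurable_funD; apply: measurable_funX; apply: measurable_sum => j;
  [apply: measurable_funB|apply: measurable_funD]; apply: measurable_funM => //;
  case: (m j).
Qed.

Definition rational_vector n (r : 'cV[rat * rat]_n) : 'cV[C]_n :=
  \col_i (ratr (r i 0).1 +i* ratr (r i 0).2).

Lemma dense_rational n : dense_in (fun x : 'cV[C]_n => exists r, x = rational_vector r).
Proof.
move=> x e e0.
have app (y : R) : {q : rat | `|y - ratr q| <= e / 2}.
  have : y < y + e / 2 by rewrite ltrDl divr_gt0.
  move=> /rat_in_itvoo/cid[q]; rewrite in_itv /= => /andP[h1 h2]; exists q.
  by rewrite ler_norml; apply/andP; split; move: e0 h1 h2; clear; lra.
pose r : 'cV[rat * rat]_n :=
  \col_i (sval (app (complex.Re (x i 0))), sval (app (complex.Im (x i 0)))).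
exists (rational_vector r); first by exists r.
move=> i; rewrite !mxE /=; case: (x i 0) => u v /=; rewrite /nsq /=.
exact: nsq_le_coords (svalP (app u)) (svalP (app v)).
Qed.

Lemma measurable_N2_le n (A B : T -> 'M[C]_n) (a b : R) : 0 <= a -> 0 <= b ->
  (forall i j, measurable_fun setT (fun w => A w i j)) ->
  (forall i j, measurable_fun setT (fun w => B w i j)) ->
  measurable [set w | forall x, a ^+ 2 * N2 (A w *m x) <= b ^+ 2 * N2 (B w *m x)].
Proof.
move=> a0 b0 mA mB.
pose F k : set T := if choice.unpickle k is Some r then [set w |
    a ^+ 2 * N2 (A w *m rational_vector r) <= b ^+ 2 * N2 (B w *m rational_vector r)]
  else setT.
have -> : [set w | forall x, a ^+ 2 * N2 (A w *m x) <= b ^+ 2 * N2 (B w *m x)] =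
    \bigcap_k F k.
  apply/seteqP; split => w /= h.
    by move=> k _; rewrite /F; case: choice.unpickle => [r|] //=; apply: h.
  apply: (N2_le_dense a0 b0 (@dense_rational n)) => _ [r ->].
  by have := h (choice.pickle r) Logic.I; rewrite /F choice.pickleK.
apply: bigcapT_measurable => k; rewrite /F; case: choice.unpickle => // r.
rewrite -[X in measurable X]setTI.
by apply: measurable_fun_le => //; apply: measurable_funM => //; apply: measurable_N2.
Qed.

(** The least singular value is at most [tau] exactly when, for every [k], the bound
    [(tau^2 + 1 / (k + 1)) |x|^2 <= |A x|^2] fails for some [x]; the converse direction uses that
    the minimum is attained. Each such failure is the complement of an event covered by
    [measurable_N2_le]. *)
Lemma measurable_singular_values N (A : T -> 'M[C]_N.+1) (tau s : R) :
  0 <= tau -> 0 <= s ->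
  (forall i j, measurable_fun setT (fun w => A w i j)) ->
  measurable [set w | singular_value (A w) N.+1 <= tau /\ singular_value (A w) 1 <= s].
Proof.
move=> t0 s0 mA.
have m1 (i j : 'I_N.+1) : measurable_fun setT (fun w : T => (1%:M : 'M[C]_N.+1) i j).
  exact: measurable_cst.
have -> : [set w | singular_value (A w) N.+1 <= tau /\ singular_value (A w) 1 <= s] =
  (\bigcap_k ~` [set w | forall x, Num.sqrt (tau ^+ 2 + k.+1%:R^-1) ^+ 2 * N2 (1%:M *m x)
      <= 1 ^+ 2 * N2 (A w *m x)]) `&`
  [set w | forall x, 1 ^+ 2 * N2 (A w *m x) <= s ^+ 2 * N2 (1%:M *m x)].
  have sq k : Num.sqrt (tau ^+ 2 + k.+1%:R^-1) ^+ 2 = tau ^+ 2 + k.+1%:R^-1.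
    by rewrite sqr_sqrtr // addr_ge0 ?sqr_ge0.
  apply/seteqP; split => w [h1 h2]; split.
  - move: h1 => /(singular_value_lastP _ t0)[x x1 hx] k _ /= /(_ x).
    rewrite sq mul1mx x1 mulr1 expr1n mul1r => /le_trans/(_ hx).
    by rewrite gerDl leNgt invr_gt0 ltr0Sn.
  - move/(singular_value_firstP _ s0): h2 => h2 x.
    by rewrite mul1mx expr1n mul1r; apply: h2.
  - apply/(singular_value_lastP _ t0).
    have [x [s2 [x1 hx hmin]]] := @min_singular_vector R _ (A w) (ltn0Sn N).
    exists x; rewrite // leNgt hx; apply/negP => lt.
    have lt0 : 0 < s2 - tau ^+ 2 by rewrite subr_gt0.
    have [k hk] : exists k, k.+1%:R^-1 <= s2 - tau ^+ 2.
      exists (Num.trunc (s2 - tau ^+ 2)^-1).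
      rewrite -[leRHS]invrK lef_pV2 ?posrE ?invr_gt0 ?ltr0Sn //.
      by rewrite ltW // truncnS_gt.
    apply: (h1 k Logic.I) => /= y; rewrite sq mul1mx expr1n mul1r.
    apply: le_trans (hmin y); rewrite ler_wpM2r ?N2_ge0 //.
    by rewrite addrC -lerBrDr.
  - apply/(singular_value_firstP _ s0) => x.
    by have := h2 x; rewrite mul1mx expr1n mul1r.
apply: measurableI.
  by apply: bigcapT_measurable => k; apply: measurableC; apply: measurable_N2_le.
exact: measurable_N2_le.
Qed.

End Measurability.

Section DiscretizedMatrix.
Context d (T : measurableType d) (R : realType) (P : probability T R).
Local Notation C := R[i].
Variables (n : nat) (X : 'I_n -> 'I_n -> {RV P >-> R[i]}).
Hypotheses (Xpairs : pairs_independent X) (Xdiag : diagonal_independent X).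
Variables (V : finType) (code : C -> V).
Hypothesis mc : measurable_fibres code.
Local Notation K := ('I_n * 'I_n)%type.
Local Notation W := (V * V)%type.

(* Only the keys [(i, j)] with [i < j] carry randomness. *)
Definition pair_code (w : T) (k : K) : W :=
  if (k.1 < k.2)%N then (code (X k.1 k.2 w), code (X k.2 k.1 w)) else (code 0, code 0).
Definition off_code (w : T) : {ffun K -> W} := [ffun k => pair_code w k].
Definition diag_code (w : T) : {ffun 'I_n -> V} := [ffun i => code (X i i w)].
Definition pair_law (k : K) : W -> R := law P (pair_code^~ k).

Lemma sigma_of_code d' (S : measurableType d') (U : T -> S) (A : set S) :
  measurable A -> sigma_of U (U @^-1` A).
Proof. by move=> mA; exists A => //; rewrite setTI. Qed.

Lemma pair_code_lt (k : K) : (k.1 < k.2)%N ->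
  pair_code^~ k = (fun w => (code (X k.1 k.2 w), code (X k.2 k.1 w))).
Proof. by move=> kk; apply/funext => w; rewrite /pair_code kk. Qed.

Lemma pair_code_ge (k : K) : ~~ (k.1 < k.2)%N ->
  pair_code^~ k = (fun=> (code 0, code 0)).
Proof. by move=> kk; apply/funext => w; rewrite /pair_code (negPf kk). Qed.

Lemma measurable_pair_code_fibre k : measurable_fibres (pair_code^~ k).
Proof.
move=> v; have [kk|kk] := boolP (k.1 < k.2)%N; last first.
  by rewrite pair_code_ge // preimage_cst; case: ifP.
rewrite pair_code_lt //; have -> : (fun w => (code (X k.1 k.2 w), code (X k.2 k.1 w))) @^-1` [set v] =
    X k.1 k.2 @^-1` (code @^-1` [set v.1]) `&` X k.2 k.1 @^-1` (code @^-1` [set v.2]).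
  by apply/seteqP; split => w /=; [move=> <-|case; case: (v) => ? ? /= -> ->].
by apply: measurableI; apply: measurable_funPTI.
Qed.

Lemma off_code_fibre o : off_code @^-1` [set o] =
  \bigcap_(k in [set: K]) (pair_code^~ k @^-1` [set o k]).
Proof.
apply/seteqP; split => w /=; first by move=> <- k _; rewrite ffunE.
by move=> h; apply/ffunP => k; rewrite ffunE; apply: h.
Qed.

Lemma measurable_off_code : measurable_fibres off_code.
Proof.
move=> o; rewrite off_code_fibre; apply: fin_bigcap_measurable => [|k _].
  exact: finite_finset.
exact: measurable_pair_code_fibre.
Qed.

Lemma diag_code_fibre v : diag_code @^-1` [set v] =
  \bigcap_(i in [set: 'I_n]) (X i i @^-1` (code @^-1` [set v i])).
Proof.
apply/seteqP; split => w /=; first by move=> <- k _ /=; rewrite ffunE.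
by move=> h; apply/ffunP => k; rewrite ffunE; apply: h.
Qed.

Lemma measurable_diag_code : measurable_fibres diag_code.
Proof.
move=> v; rewrite diag_code_fibre; apply: fin_bigcap_measurable => [|i _].
  exact: finite_finset.
exact: measurable_funPTI.
Qed.

Lemma law_off_code o : law P off_code o = pw pair_law o.
Proof.
apply: EFin_inj; rewrite -(lawE P measurable_off_code).
(* At a key that is not increasing the code is constant: an outcome [o] with another value there has
   probability zero on both sides, and otherwise such keys contribute the whole space and the factor
   one. *)
have [h|/forallPn[k]] := boolP [forall k : K, ~~ (k.1 < k.2)%N ==> (o k == (code 0, code 0))];
    last first.
  rewrite negb_imply => /andP[kk ok]; rewrite /pw (bigD1 k) //=.
  have e0 : pair_code^~ k @^-1` [set o k] = set0.
    apply/seteqP; split => // w /=; rewrite /pair_code (negPf kk) => eo.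
    by rewrite -eo eqxx in ok.
  rewrite {1}/pair_law /law e0 measure0 mul0r off_code_fibre.
  rewrite (_ : bigcap _ _ = set0) ?measure0 //.
  by apply/seteqP; split => // w /(_ k Logic.I); rewrite e0.
have triv (k : K) : ~~ (k.1 < k.2)%N -> pair_code^~ k @^-1` [set o k] = setT.
  move=> kk; apply/seteqP; split => // w _ /=; rewrite /pair_code (negPf kk).
  by move/forallP: h => /(_ k); rewrite kk => /eqP.
pose J : {fset K} := [fset k in [seq k : K <- enum {: K} | (k.1 < k.2)%N]]%fset.
have JE (k : K) : (k \in J) = (k.1 < k.2)%N.
  by rewrite !inE mem_filter mem_enum andbT.
have hJ : [set` J] `<=` [set ij : K | (ij.1 < ij.2)%N] by move=> k /=; rewrite JE.
have hE k : k \in J -> sigma_of (fun w => (X k.1 k.2 w, X k.2 k.1 w))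
    (pair_code^~ k @^-1` [set o k]).
  rewrite JE => kk; rewrite pair_code_lt //.
  rewrite (_ : _ @^-1` _ = (fun w => (X k.1 k.2 w, X k.2 k.1 w)) @^-1`
     (code @^-1` [set (o k).1] `*` code @^-1` [set (o k).2])).
    by apply: sigma_of_code; apply: measurableX.
  by apply/seteqP; split => w /=; [move=> <-|case; case: (o k) => ? ? /= -> ->].
have := Xpairs hJ hE.
rewrite (_ : \bigcap_(k in [set` J]) _ = off_code @^-1` [set o]); last first.
  rewrite off_code_fibre; apply/seteqP; split => w hw k /= kJ; last exact: hw.
  by have [kk|kk] := boolP (k.1 < k.2)%N; [apply: hw; rewrite /= JE|
    have : [set: T] w by []; rewrite -(triv _ kk)].
move=> ->.
rewrite (eq_bigr (fun k => (pair_law k (o k))%:E)); last first.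
  by move=> k _; rewrite (lawE P (measurable_pair_code_fibre k)).
rewrite prodEFin; congr (_%:E).
rewrite /pw [RHS](bigID (fun k : K => (k.1 < k.2)%N)) /= [X in _ = _ * X]big1 ?mulr1.
  rewrite -[RHS]big_filter; apply: perm_big.
  apply: uniq_perm; rewrite ?fset_uniq ?filter_uniq ?index_enum_uniq // => k.
  by rewrite JE mem_filter mem_index_enum andbT.
by move=> k kk; rewrite /pair_law /law triv // probability_setT.
Qed.

Lemma law_off_diag o v :
  P (off_code @^-1` [set o] `&` diag_code @^-1` [set v]) =
  (pw pair_law o * law P diag_code v)%:E.
Proof.
rewrite setIC Xdiag; last 2 first.
- rewrite diag_code_fibre.
  apply: (@fin_bigcap_measurable _ (g_sigma_algebraType
    (\bigcup_(i in [set: 'I_n]) sigma_of (X i i)))) => [|i _]; first exact: finite_finset.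
  by apply: sub_gen_smallest; exists i => //; apply: sigma_of_code.
- rewrite off_code_fibre.
  apply: (@fin_bigcap_measurable _ (g_sigma_algebraType
    (\bigcup_(ij in [set ij : K | ij.1 != ij.2]) sigma_of (X ij.1 ij.2)))) => [|k _].
    exact: finite_finset.
  have [kk|kk] := boolP (k.1 < k.2)%N; last first.
    rewrite pair_code_ge // preimage_cst; case: ifP => _; last exact: measurable0.
    exact: (@measurableT _ (g_sigma_algebraType _)).
  rewrite pair_code_lt //.
  have -> : (fun w => (code (X k.1 k.2 w), code (X k.2 k.1 w))) @^-1` [set o k] =
      X k.1 k.2 @^-1` (code @^-1` [set (o k).1]) `&`
      X k.2 k.1 @^-1` (code @^-1` [set (o k).2]).
    by apply/seteqP; split => w /=; [move=> <-|case; case: (o k) => ? ? /= -> ->].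
  apply: measurableI; apply: sub_gen_smallest.
    by exists (k.1, k.2); [rewrite /= neq_ltn kk|apply: sigma_of_code].
  by exists (k.2, k.1); [rewrite /= neq_ltn kk orbT|apply: sigma_of_code].
by rewrite muleC EFinM -(lawE P measurable_diag_code) -law_off_code
  -(lawE P measurable_off_code).
Qed.

(** Condition on the codes of the diagonal: by independence the off-diagonal law is unaffected, and
    a bound uniform in [v] averages out, whatever the dependence among the diagonal entries. *)
Lemma discretized_event_le (E : {ffun K -> W} -> {ffun 'I_n -> V} -> Prop) beta :
  (forall v, Pr pair_law (fun o => E o v) <= beta) ->
  measurable [set w | E (off_code w) (diag_code w)] /\
  (P [set w | E (off_code w) (diag_code w)] <= beta%:E)%E.
Proof.
move=> hE; pose c w := (off_code w, diag_code w).
have cE o v : c @^-1` [set (o, v)] = off_code @^-1` [set o] `&` diag_code @^-1` [set v].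
  by apply/seteqP; split => w /=; [case=> <- <-|case; rewrite /c => -> ->].
have mC : measurable_fibres c.
  move=> -[ o v]; rewrite cE.
  by apply: measurableI; [exact: measurable_off_code|exact: measurable_diag_code].
have EE : [set w | E (off_code w) (diag_code w)] =
    [set w | (fun x => E x.1 x.2) (c w)] by [].
split; first exact: (measurable_code_event mC (fun x => E x.1 x.2)).
rewrite EE (law_event P mC (fun x => E x.1 x.2)) lee_fin.
rewrite (eq_bigr (fun x => ind R (E x.1 x.2) * law P c (x.1, x.2))) => [|[] //].
rewrite -(pair_bigA _ (fun o v => ind R (E o v) * law P c (o, v))) exchange_big /=.
apply: (@le_trans _ _ (\sum_v law P diag_code v * beta)); last first.
  by rewrite -mulr_suml (law_sum P measurable_diag_code) mul1r.
apply: ler_sum => v _; apply: le_trans (ler_wpM2l (law_ge0 P _ _) (hE v)).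
rewrite /Pr /Ex mulr_sumr; apply: ler_sum => o _.
rewrite {1}/law cE law_off_diag /=.
by rewrite mulrC -mulrA mulrCA.
Qed.

End DiscretizedMatrix.

Section GenericShift.
Variable R : realType.
Local Notation C := R[i].

(** Only the roots of a product of finitely many characteristic polynomials must be avoided. The
    numbers [delta / (j + 1)], for [j] below the size of the product, are too many to be all
    roots. *)
Lemma generic_shift (I : finType) n (A : I -> 'M[C]_n) (delta : R) : 0 < delta ->
  exists2 th : R, 0 < th <= delta & forall i, A i + (th%:C)%:M \in unitmx.
Proof.
move=> d0; pose p := \prod_i char_poly (- A i).
have p0 : p != 0.
  by apply/prodf_neq0 => i _; apply: monic_neq0; apply: char_poly_monic.
pose pts := [seq (delta / j.+1%:R)%:C | j <- iota 0 (size p)].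
have /allPn[z] : ~~ all (root p) pts.
  apply/negP => /(max_poly_roots p0) h.
  have : uniq pts.
    rewrite map_inj_uniq ?iota_uniq // => j k [] /(mulfI (lt0r_neq0 d0)) /invr_inj /eqP.
    by rewrite eqr_nat eqSS => /eqP.
  by move=> /h; rewrite size_map size_iota ltnn.
move=> /mapP[j _ ->] nr; exists (delta / j.+1%:R).
  by rewrite divr_gt0 ?ltr0Sn //= ler_pdivrMr ?ltr0Sn // ler_peMr ?(ltW d0) // ler1n.
move=> i; rewrite unitmxE unitfE; apply: contraNneq nr => det0.
rewrite /root /p horner_prod (bigD1 i) //= mulf_eq0.
rewrite /char_poly -horner_evalE -det_map_mx.
rewrite (_ : map_mx _ _ = A i + ((delta / j.+1%:R)%:C)%:M) ?det0 ?eqxx //.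
apply/matrixP => k l; rewrite !mxE /= /horner_eval.
by rewrite hornerD hornerN hornerMn hornerX hornerC opprK addrC.
Qed.

End GenericShift.

Section DiscretizedEntries.
Context d (T : measurableType d) (R : realType) (P : probability T R).
Local Notation C := R[i].
Variables (n : nat) (X : 'I_n -> 'I_n -> {RV P >-> R[i]}) (a b sigma rho : R).
Hypotheses (b_gt0 : 0 < b) (sigma_gt0 : 0 < sigma) (rho_ge0 : 0 <= rho) (rho_lt1 : rho < 1).
Hypothesis Xb : forall i j : 'I_n, (i < j)%N -> b <= fine (P (bounded_event X a i j)).
Hypothesis Xvar : forall i j, i != j -> sigma ^+ 2 <= cvar (cond_bounded X a i j) (X i j).
Hypothesis Xcorr : forall i j : 'I_n, (i < j)%N ->
  normc (ccorr (cond_bounded X a i j) (X i j) (X j i)) <= rho.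
Variables (V : finType) (code : C -> V) (val : V -> C) (eps : R).
Hypothesis mc : measurable_fibres code.
Hypothesis hval : forall z, nsq z <= a ^+ 2 -> nsq (z - val (code z)) <= eps ^+ 2.
Hypothesis eps1 : eps ^+ 2 <= 1.
Hypothesis eps_small : 8 * eps ^+ 2 <= sigma ^+ 2 * (1 - rho).
Local Notation K := ('I_n * 'I_n)%type.
Local Notation W := (V * V)%type.
Local Notation Gamma := (2 * a ^+ 2 + 2).
Local Notation mu := (pair_law X code).

Lemma Gamma_gt0 : 0 < Gamma.
Proof. by have := sqr_ge0 a; lra. Qed.

Lemma pair_law_ge0 k w : 0 <= mu k w.
Proof. exact: law_ge0. Qed.

Lemma pair_law_sum k : \sum_w mu k w = 1.
Proof. by apply: law_sum; apply: measurable_pair_code_fibre. Qed.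

Lemma cond_boundedC i j : cond_bounded X a i j = cond_bounded X a j i.
Proof.
have cond_eq (A B : set T) (mA : measurable A) (mB : measurable B) :
    A = B -> cond_prob P mA = cond_prob P mB.
  by move=> AB; subst B; rewrite (Prop_irrelevance mA mB).
by apply: cond_eq; apply/seteqP; split => w [h1 h2].
Qed.

Lemma bounded_nsq i j w : bounded_event X a i j w ->
  nsq (X i j w) <= a ^+ 2 /\ nsq (X j i w) <= a ^+ 2.
Proof.
have nn (z : C) : 0 <= normc z by case: z => ? ?; apply: sqrtr_ge0.
move=> [h1 h2]; rewrite !nsq_normc.
by split; apply: lerXn2r; rewrite ?nnegrE // (le_trans _ h1) ?nn.
Qed.

Section Pair.
Variables (i j : 'I_n).
Hypothesis ij : (i < j)%N.
Let E := bounded_event X a i j.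
Let mE := measurable_bounded_event X a i j.
Let Q := cond_bounded X a i j.

Lemma bounded_prob : (b%:E <= P E)%E.
Proof. by rewrite -(fineK (fin_num_measure P E mE)) lee_fin Xb. Qed.

Lemma bounded_cond0 : Q (~` E) = 0%E.
Proof. exact: cond_probC bounded_prob. Qed.

Lemma ess_bounded_ReIm (U : {RV P >-> R[i]}) :
  (forall w, E w -> nsq (U w) <= a ^+ 2) ->
  ess_bounded E (fun w => complex.Re (U w)) /\ ess_bounded E (fun w => complex.Im (U w)).
Proof.
move=> hU; have [m1 m2] := measurable_ReIm (@measurable_funPT _ _ _ _ U).
have ab t : t ^+ 2 <= a ^+ 2 -> `|t| <= `|a|.
  by move=> ht; rewrite -(@ler_pXn2r _ 2) ?nnegrE // -!normrX !ger0_norm ?sqr_ge0.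
split; split => //; exists `|a| => w /hU; rewrite /nsq => h; apply: ab;
  apply: le_trans h; [rewrite lerDl|rewrite lerDr]; exact: sqr_ge0.
Qed.

Lemma bounded_entries :
  [/\ ess_bounded E (fun w => complex.Re (X i j w)),
      ess_bounded E (fun w => complex.Im (X i j w)),
      ess_bounded E (fun w => complex.Re (X j i w)) &
      ess_bounded E (fun w => complex.Im (X j i w))] /\
  sigma ^+ 2 <= cvar Q (X i j) /\ sigma ^+ 2 <= cvar Q (X j i).
Proof.
have [? ?] := ess_bounded_ReIm (U := X i j) (fun w h => proj1 (bounded_nsq h)).
have [? ?] := ess_bounded_ReIm (U := X j i) (fun w h => proj2 (bounded_nsq h)).
by split => //; split; last rewrite /Q cond_boundedC; rewrite Xvar // neq_ltn ij ?orbT.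
Qed.

(** [discretized_variance] feeds [pair_prob_variance], with [2 Gamma (|u|^2 + |v|^2)] as the bound
    on the squared combination. For [lam] proportional to [|u|^2 + |v|^2] the scale of [(u, v)]
    cancels in the probability. *)
Lemma pair_spread (u v : C) (lam : R) : 0 < nsq u + nsq v -> 0 <= lam ->
  (forall z, lam <= mean Q (fun w => nsq (u * X i j w + v * X j i w - z)) /\
     ess_bounded E (fun w => nsq (u * X i j w + v * X j i w - z))) ->
  8 * eps ^+ 2 * (nsq u + nsq v) <= lam ->
  b ^+ 2 * lam / (64 * Gamma * (nsq u + nsq v)) <=
    pair_prob mu (i, j) (fun w w' => b ^+ 2 * lam / 8 <=
      nsq (u * (val w.1 - val w'.1) + v * (val w.2 - val w'.2))).
Proof.
move=> S0 lam0 hlam heps; have G0 := Gamma_gt0.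
have muE : mu (i, j) = law P (fun w => (code (X i j w), code (X j i w))).
  by rewrite /pair_law pair_code_lt.
have hX : forall w, E w -> nsq (X i j w) <= a ^+ 2 by move=> w /bounded_nsq[].
have hX' : forall w, E w -> nsq (X j i w) <= a ^+ 2 by move=> w /bounded_nsq[].
have mX := @measurable_funPT _ _ _ _ (X i j).
have mX' := @measurable_funPT _ _ _ _ (X j i).
pose Y (w : W) := u * val w.1 + v * val w.2.
have := @pair_prob_variance R K W mu (i, j) pair_law_ge0 pair_law_sum Y
  (small_codes val a) (b * lam / 4) (2 * (nsq u + nsq v) * Gamma) b b_gt0.
have -> : b * (b * lam / 4) / (8 * (2 * (nsq u + nsq v) * Gamma)) =
    b ^+ 2 * lam / (64 * Gamma * (nsq u + nsq v)).
  by field; rewrite !gt_eqF.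
have -> : b * (b * lam / 4) / 2 = b ^+ 2 * lam / 8 by field.
move=> h; apply: le_trans (h _ _ _ _ _) _ => {h}.
- by rewrite !mulr_gt0.
- by rewrite divr_ge0 // mulr_ge0 // ltW.
- move=> w; rewrite inE /= => /andP[w1 w2]; apply: le_trans (nsqD_le _ _) _.
  rewrite !nsqM; have := ler_wpM2l (nsq_ge0 u) w1; have := ler_wpM2l (nsq_ge0 v) w2.
  by lra.
- rewrite muE.
  exact: (law_small_codes mE bounded_prob mX mX' hX hX' mc hval eps1).
- move=> z; have [h1 h2] := hlam z; rewrite muE.
  exact: (discretized_variance b_gt0 bounded_prob mX mX' hX hX' mc hval eps1 h1 h2 heps).
apply: pair_prob_sub => [k w|w w']; first exact: pair_law_ge0.
rewrite (_ : Y w - Y w' = u * (val w.1 - val w'.1) + v * (val w.2 - val w'.2)) //.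
by rewrite /Y; ring.
Qed.

Lemma pair_lower (u v : C) : 
  b ^+ 2 * sigma ^+ 2 / (64 * Gamma) * (1 - rho) <=
    pair_prob mu (i, j) (fun w w' =>
      b ^+ 2 * sigma ^+ 2 / 8 * (1 - rho) * (nsq u + nsq v) <=
      nsq (u * (val w.1 - val w'.1) + v * (val w.2 - val w'.2))) \/ nsq u + nsq v = 0.
Proof.
have [S0|S0] := eqVneq (nsq u + nsq v) 0; [by right|left].
have {}S0 : 0 < nsq u + nsq v by rewrite lt0r S0 addr_ge0 ?nsq_ge0.
have s20 : 0 < sigma ^+ 2 by rewrite exprn_gt0.
have r0 : 0 < 1 - rho by rewrite subr_gt0.
have [[bU1 bU2 bV1 bV2] [hu hv]] := bounded_entries.
have := @pair_spread u v (sigma ^+ 2 * (1 - rho) * (nsq u + nsq v)) S0.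
rewrite (_ : _ / (64 * Gamma * _) = b ^+ 2 * sigma ^+ 2 / (64 * Gamma) * (1 - rho)); last first.
  by field; rewrite !gt_eqF ?Gamma_gt0.
rewrite (_ : b ^+ 2 * _ / 8 = b ^+ 2 * sigma ^+ 2 / 8 * (1 - rho) * (nsq u + nsq v)); last first.
  by field.
apply; last by rewrite ler_wpM2r // ltW.
  by rewrite !mulr_ge0 // ltW.
exact: (conditional_variance mE bounded_cond0 bU1 bU2 bV1 bV2 s20 rho_lt1 hu hv (Xcorr ij)).
Qed.

(** For a single entry the covariance term of [mean_nsq] vanishes, so no factor [1 - rho] is
    lost. *)
Lemma single_lower (u v : C) : (u = 1 /\ v = 0) \/ (u = 0 /\ v = 1) ->
  b ^+ 2 * sigma ^+ 2 / (64 * Gamma) <=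
    pair_prob mu (i, j) (fun w w' => b ^+ 2 * sigma ^+ 2 / 8 <=
      nsq (u * (val w.1 - val w'.1) + v * (val w.2 - val w'.2))).
Proof.
move=> uv; have S1 : nsq u + nsq v = 1.
  by case: uv => -[-> ->]; rewrite nsq0 nsq1 ?addr0 ?add0r.
have s20 : 0 <= sigma ^+ 2 by rewrite sqr_ge0.
have [[bU1 bU2 bV1 bV2] [hu hv]] := bounded_entries.
have := @pair_spread u v (sigma ^+ 2); rewrite S1 !mulr1; apply => //.
  move=> z; have [k [-> bF]] := mean_nsq mE bounded_cond0 bU1 bU2 bV1 bV2 u v z.
  split=> //; rewrite (_ : u * _ = 0) ?mul0r ?subrr ?mulr0 ?addr0.
    have := nsq_ge0 k.
    by case: uv => -[-> ->]; rewrite nsq0 nsq1 mul0r mul1r ?addr0 ?add0r; move: hu hv; lra.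
  case: uv => -[-> ->]; rewrite ?mul0r // mul1r; apply/eqP.
  by rewrite eq_complex /= oppr0 !eqxx.
by apply: le_trans eps_small _; rewrite ler_piMr // gerBl.
Qed.

End Pair.

Variables (M : 'M[C]_n) (th : R).

Definition entry_key (i j : 'I_n) : K := if (i < j)%N then (i, j) else (j, i).
(** The random pair [w] is used only off the diagonal; on it the codes [v] are frozen and the
    generic shift [th] is added. *)
Definition discrete_entry (v : {ffun 'I_n -> V}) (i j : 'I_n) (w : W) : C :=
  (if (i < j)%N then val w.1 else if (j < i)%N then val w.2 else val (v i) + th%:C)
  + M i j.

Lemma discrete_entry_diff v (i j : 'I_n) w w' : (i < j)%N ->
  discrete_entry v i j w - discrete_entry v i j w' = val w.1 - val w'.1 /\
  discrete_entry v j i w - discrete_entry v j i w' = val w.2 - val w'.2.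
Proof.
move=> h; rewrite /discrete_entry h ltnNge (ltnW h) /=.
by split; rewrite opprD addrACA subrr addr0.
Qed.

Lemma discretized_independent_entries v p :
  0 <= p -> p <= b ^+ 2 * sigma ^+ 2 / (64 * Gamma) -> p <= 1 ->
  independent_entries mu entry_key (discrete_entry v) p (b ^+ 2 * sigma ^+ 2 / 8) (1 - rho).
Proof.
move=> p0 pp p1; have r1 : 0 <= 1 - rho by rewrite subr_ge0 ltW.
split.
- by split => [k w|k]; [exact: pair_law_ge0|exact: pair_law_sum].
- by move=> i j; rewrite /entry_key; case: ltngtP => // /val_inj ->.
- move=> i j i' j'; rewrite /entry_key.
  by case: ifP => _; case: ifP => _ [-> ->]; [left|right|right|left].
- move=> i j ij; apply: le_trans pp _; move: ij; rewrite neq_ltn => /orP[] h;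
    rewrite /entry_key ?h ?[(i < j)%N]ltnNge ?(ltnW h) /=.
    apply: le_trans (single_lower h (or_introl _ (conj erefl erefl))) _.
    apply: pair_prob_sub => [k w|w w']; first exact: pair_law_ge0.
    by rewrite (discrete_entry_diff v w w' h).1 mul1r mul0r addr0.
  apply: le_trans (single_lower h (or_intror _ (conj erefl erefl))) _.
  apply: pair_prob_sub => [k w|w w']; first exact: pair_law_ge0.
  by rewrite (discrete_entry_diff v w w' h).2 mul1r mul0r add0r.
(* If both coefficients vanish, the threshold is zero and the probability is one, which exceeds
   [p * (1 - rho)]. *)
- have zero k (g : W -> W -> C) r u v' : nsq u + nsq v' = 0 ->
      p * (1 - rho) <= pair_prob mu k (fun w w' => r * (nsq u + nsq v') <= nsq (g w w')).
    move=> ->; apply: (@le_trans _ _ 1).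
      by apply: le_trans p1; rewrite ler_piMr // gerBl.
    rewrite /pair_prob -{1}[1]mulr1 -(pair_law_sum k) mulr_suml; apply: ler_sum => w _.
    rewrite mulr_sumr; apply: ler_sum => w' _.
    by rewrite mulr0 nsq_ge0 /= pair_law_sum mulr1.
  move=> i j ij u v'.
  have [S0|S0] := eqVneq (nsq u + nsq v') 0; first exact: zero.
  apply: le_trans (ler_wpM2r r1 pp) _.
  move: ij; rewrite neq_ltn => /orP[] h;
    rewrite /entry_key ?h ?[(i < j)%N]ltnNge ?(ltnW h) /=.
    have [hh|hh] := pair_lower h u v'; last by rewrite hh eqxx in S0.
    apply: le_trans hh _; apply: pair_prob_sub => [k w|w w']; first exact: pair_law_ge0.
    by have [-> ->] := discrete_entry_diff v w w' h.
  have [hh|hh] := pair_lower h v' u; last by rewrite addrC hh eqxx in S0.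
  apply: le_trans hh _; apply: pair_prob_sub => [k w|w w']; first exact: pair_law_ge0.
  by have [-> ->] := discrete_entry_diff v w w' h; rewrite [nsq u + _]addrC [u * _ + _]addrC.
Qed.

End DiscretizedEntries.

Section Tightness.
Context d (T : measurableType d) (R : realType) (P : probability T R).
Local Notation C := R[i].
Variables (n : nat) (X : 'I_n -> 'I_n -> {RV P >-> R[i]}).

Lemma measurable_nsq (U : T -> C) : measurable_fun setT U ->
  measurable_fun setT (fun w => nsq (U w)).
Proof.
by move=> /measurable_ReIm[m1 m2]; apply: measurable_funD; apply: measurable_funX.
Qed.

(** The events that the total squared size exceeds [l] decrease to the empty set, so continuity from
    above makes one of them improbable. This allows a bounded grid although the entries are
    unbounded. *)
Lemma tightness (eta : R) : 0 < eta -> exists (l : nat) (A : set T),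
  [/\ measurable A, (P A <= eta%:E)%E &
      forall w, ~ A w -> forall i j, nsq (X i j w) <= l%:R].
Proof.
move=> eta0; pose S w := \sum_i \sum_j nsq (X i j w).
pose F (l : nat) := [set w | l%:R < S w].
have mS : measurable_fun setT S.
  apply: measurable_sum => i; apply: measurable_sum => j; apply: measurable_nsq.
  exact: measurable_funPT.
have mF l : measurable (F l).
  rewrite (_ : F l = setT `&` S @^-1` `]l%:R, +oo[); first by apply: mS.
  by rewrite setTI; apply/seteqP; split => w /=; rewrite in_itv /= andbT.
have cap : \bigcap_l F l = set0.
  apply/seteqP; split => // w h.
  have := h (Num.trunc (S w)).+1 Logic.I; rewrite /F /= ltNge => /negP; apply.
  by rewrite ltW // truncnS_gt.
have := @nonincreasing_cvg_mu _ _ _ P F; rewrite cap measure0 => cv.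
have {}cv : (P \o F) @ \oo --> 0%E.
  apply: cv => //.
  - by rewrite (le_lt_trans (probability_le1 P (mF 0))) // ltry.
  - move=> k l kl; apply/subsetPset => w; rewrite /F /=; apply: le_lt_trans.
    by rewrite ler_nat.
have : nbhs (0%E : \bar R) [set y | (y < eta%:E)%E].
  by apply: open_nbhs_nbhs; split; [exact: open_ereal_lt_ereal|rewrite /= lte_fin].
move=> /cv [l _ hl]; exists l, (F l); split => //; first by rewrite ltW // hl //=.
move=> w /negP; rewrite -leNgt => hw i j; apply: le_trans hw.
rewrite /S (bigD1 i) //= (bigD1 j) //= -addrA lerDl addr_ge0 //.
  by apply: sumr_ge0 => k _; apply: nsq_ge0.
by apply: sumr_ge0 => k _; apply: sumr_ge0 => m _; apply: nsq_ge0.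
Qed.

End Tightness.

(** * Transfer of the bound to the original matrix *)

Section Discretization.
Variable R : realType.
Local Notation C := R[i].

Lemma minor_shift n (V : finType) (val : V -> C) (M : 'M[C]_n.+1) th v o k :
  minor_mx (rmx (@entry_key n.+1) (discrete_entry val M th v) o) k =
  minor_mx (rmx (@entry_key n.+1) (discrete_entry val M 0 v) o) k + (th%:C)%:M.
Proof.
apply/matrixP => i j; rewrite !mxE /discrete_entry.
have [->|ij] := eqVneq i j; first by rewrite ltnn addr0 mulr1n; ring.
have : lift k i != lift k j by rewrite (inj_eq lift_inj).
by rewrite neq_ltn => /orP[] h; rewrite ?h ?[in (_ < _)%N]ltnNge ?(ltnW h) /= ?h mulr0n addr0.
Qed.

Lemma rate_scale (D s t : R) n : 0 < D -> 1 <= s -> 0 < t ->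
  Num.sqrt (Num.sqrt (rate D (2 * s) (2 * t) n)) <= 8 * Num.sqrt (Num.sqrt (rate D s t n)).
Proof.
move=> D0 s1 t0; have q0 : 0 <= s ^+ 5 * t.
  by rewrite mulr_ge0 ?(ltW t0) // exprn_ge0 // (le_trans ler01).
have h : rate D (2 * s) (2 * t) n <= 8 * rate D s t n.
  rewrite /rate [leRHS]mulrA ler_wpM2r ?invr_ge0 ?(ltW D0) //.
  rewrite (_ : (2 * s) ^+ 5 * (2 * t) = 8 ^+ 2 * (s ^+ 5 * t)); last by ring.
  rewrite sqrtrM ?sqr_ge0 // sqrtr_sqr ger0_norm // mulrDr lerD2l.
  by rewrite ler_peMl ?invr_ge0 ?sqrtr_ge0 // ler1n.
have c8 : 1 <= 8 :> R by rewrite ler1n.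
have sq8 : Num.sqrt 8 <= 8 :> R.
  by rewrite -[leRHS]ger0_norm // -sqrtr_sqr ler_wsqrtr // expr2 ler_peMl.
have sqM (x : R) : Num.sqrt (8 * x) <= 8 * Num.sqrt x.
  by rewrite sqrtrM ?ler0n // ler_wpM2r ?sqrtr_ge0.
apply: le_trans (ler_wsqrtr (ler_wsqrtr h)) _.
exact: le_trans (ler_wsqrtr (sqM _)) (sqM _).
Qed.

Lemma rate_gt0 (D s t : R) N : 0 < D -> 0 < rate D s t N.+1.
Proof.
by move=> D0; rewrite divr_gt0 // ltr_wpDl ?sqrtr_ge0 // invr_gt0 sqrtr_gt0 ltr0Sn.
Qed.

Lemma discretization_error d (T : measurableType d) (P : probability T R) n
    (X : 'I_n -> 'I_n -> {RV P >-> R[i]}) (V : finType) (code : C -> V) (val : V -> C)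
    (M : 'M[C]_n) (th eps : R) w :
  0 <= th <= eps ->
  (forall i j, nsq (X i j w - val (code (X i j w))) <= eps ^+ 2) ->
  forall i j, nsq (rmx (@entry_key n)
      (discrete_entry val M th (diag_code X code w)) (off_code X code w) i j
    - (random_matrix X w + M) i j) <= 4 * eps ^+ 2.
Proof.
move=> /andP[th0 the] hX i j; rewrite !mxE opprD addrACA subrr addr0 ffunE.
have e0 := sqr_ge0 eps.
have th2 : th ^+ 2 <= eps ^+ 2 by apply: lerXn2r; rewrite ?nnegrE // (le_trans th0).
have small z : nsq z <= eps ^+ 2 -> nsq z <= 4 * eps ^+ 2.
  by move: e0; clear; lra.
rewrite /entry_key /pair_code; case: ltngtP => h.
- by rewrite /= h /= -nsqN opprB; apply/small/hX.
- by rewrite /= h /= -nsqN opprB; apply/small/hX.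
rewrite (val_inj h) ffunE addrAC.
apply: le_trans (nsqD_le _ _) _; rewrite -[nsq (_ - _)]nsqN opprB nsq_real.
by have := hX j j; move: e0 th2; clear; lra.
Qed.

(** Truncation level, grid and shift are chosen after the law, [M], [s] and [t]; this is harmless
    because [finite_bound] is uniform in the finite law. The exceptional event is allowed a
    probability equal to the target [eta], the summand 1 in the constant; the factor 8 pays for
    doubling [s] and [t]. *)
Lemma singular_event_bound (a b sigma : R) : 0 < b -> 0 < sigma ->
  exists2 C0 : R, 0 < C0 &
  forall N d (T : measurableType d) (P : probability T R)
    (X : 'I_N.+1 -> 'I_N.+1 -> {RV P >-> R[i]}) (rho : R),
  pairs_independent X -> diagonal_independent X -> 0 <= rho -> rho < 1 ->
  (forall i j : 'I_N.+1, (i < j)%N -> b <= fine (P (bounded_event X a i j))) ->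
  (forall i j, i != j -> sigma ^+ 2 <= cvar (cond_bounded X a i j) (X i j)) ->
  (forall i j : 'I_N.+1, (i < j)%N ->
     normc (ccorr (cond_bounded X a i j) (X i j) (X j i)) <= rho) ->
  forall (M : 'M[C]_N.+1) (s t : R), 1 <= s -> 0 < t -> t <= 1 ->
  (P [set w | (singular_value (random_matrix X w + M) N.+1 <= t / Num.sqrt N.+1%:R)%R /\
              (singular_value (random_matrix X w + M) 1 <= s)%R]
   <= (C0 * Num.sqrt (Num.sqrt (rate (Num.sqrt (1 - rho)) s t N.+1)))%:E)%E.
Proof.
move=> b0 sg0; pose q := b ^+ 2 * sigma ^+ 2 / (64 * (2 * a ^+ 2 + 2)).
have q0 : 0 < q.
  have G0 := Gamma_gt0 a.
  by rewrite /q divr_gt0 // mulr_gt0 // exprn_gt0.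
pose p := Num.min 1 q.
have p0 : 0 < p by rewrite lt_min ltr01.
have p1 : p <= 1 by rewrite ge_min lexx.
have pq : p <= q by rewrite ge_min lexx orbT.
have r20 : 0 < b ^+ 2 * sigma ^+ 2 / 8 by rewrite divr_gt0 // mulr_gt0 // exprn_gt0.
have [C0 C00 hC0] := finite_bound p0 p1 r20.
exists (1 + C0 * 8); first by rewrite addr_gt0 // mulr_gt0.
move=> N d T P X rho Xp Xd rho0 rho1 Xb Xvar Xcorr M s t s1 t0 t1.
have u0 : 0 < 1 - rho by rewrite subr_gt0.
pose D := Num.sqrt (1 - rho); have D0 : 0 < D by rewrite sqrtr_gt0.
have DD : D ^+ 2 = 1 - rho by rewrite sqr_sqrtr // ltW.
have D1 : D <= 1 by rewrite -sqrtr1 ler_wsqrtr // gerBl.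
set eta := Num.sqrt (Num.sqrt _).
have eta0 : 0 < eta by rewrite !sqrtr_gt0 rate_gt0.
have [l [A [mA PA hA]]] := tightness X eta0.
pose L := l%:R + `|a| + 1.
have [l0 a0] : 0 <= l%:R :> R /\ 0 <= `|a| by [].
have L1 : 1 <= L by rewrite lerDr addr_ge0.
have L0 : 0 < L by rewrite (lt_le_trans ltr01).
have LL : L <= L ^+ 2 by rewrite expr2 ler_peMl // ltW.
have aL : a ^+ 2 <= L ^+ 2.
  rewrite -[a ^+ 2]ger0_norm ?sqr_ge0 // normrX; apply: lerXn2r; rewrite ?nnegrE ?(ltW L0) //.
  by rewrite /L; move: l0; lra.
have lL : l%:R <= L ^+ 2 by apply: le_trans LL; rewrite /L; move: a0; lra.
have n0 : 0 < N.+1%:R :> R by rewrite ltr0Sn.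
have s0 : 0 < s by rewrite (lt_le_trans ltr01).
(* The four terms ensure, in order, bounded rounding errors, an error below the conditional variance
   including the factor [1 - rho], and perturbations small against [s] and against [t / sqrt n]. *)
pose kap := Num.min (Num.min 1 (sigma ^+ 2 * (1 - rho) / 8))
  (Num.min (s ^+ 2 / (4 * N.+1%:R ^+ 2)) (t ^+ 2 / N.+1%:R / (4 * N.+1%:R ^+ 2))).
have kap0 : 0 < kap.
  have n40 : 0 < 4 * N.+1%:R ^+ 2 :> R by rewrite mulr_gt0 // exprn_gt0.
  rewrite !lt_min ltr01 !divr_gt0 ?mulr_gt0 ?exprn_gt0 //.
pose eps := Num.min 1 kap.
have eps0 : 0 < eps by rewrite lt_min ltr01.
have epsk : eps ^+ 2 <= kap.
  apply: (@le_trans _ _ eps); last by rewrite ge_min lexx orbT.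
  by rewrite expr2 ler_piMl ?(ltW eps0) // ge_min lexx.
have eps1 : eps ^+ 2 <= 1 by apply: le_trans epsk _; rewrite !ge_min lexx.
have eps2 : 8 * eps ^+ 2 <= sigma ^+ 2 * (1 - rho).
  by rewrite mulrC -ler_pdivlMr //; apply: le_trans epsk _; rewrite !ge_min lexx orbT.
have eps3 : N.+1%:R ^+ 2 * (4 * eps ^+ 2) <= s ^+ 2.
  rewrite mulrA mulrC [_ * 4]mulrC -ler_pdivlMr ?mulr_gt0 ?exprn_gt0 //.
  by apply: le_trans epsk _; rewrite !ge_min lexx !orbT.
have eps4 : N.+1%:R ^+ 2 * (4 * eps ^+ 2) <= t ^+ 2 / N.+1%:R.
  rewrite mulrA mulrC [_ * 4]mulrC -ler_pdivlMr ?mulr_gt0 ?exprn_gt0 //.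
  by apply: le_trans epsk _; rewrite !ge_min lexx !orbT.
have [V [code [val [mc hval]]]] := complex_grid eps0 L0.
pose B (x : {ffun 'I_N.+1 * 'I_N.+1 -> V * V} * {ffun 'I_N.+1 -> V} * 'I_N.+1) :=
  minor_mx (rmx (@entry_key N.+1) (discrete_entry val M 0 x.1.2) x.1.1) x.2.
(* One shift serves all outcomes, all diagonal codes and all minors at once, because the discretized
   matrices are finitely many. *)
have [th /andP[th0 the] hth] := generic_shift B eps0.
have hvala z : nsq z <= a ^+ 2 -> nsq (z - val (code z)) <= eps ^+ 2.
  by move=> hz; apply: hval; apply: le_trans aL.
pose E o v := nearly_singular (rmx (@entry_key N.+1) (discrete_entry val M th v) o)
  ((2 * t) ^+ 2 / N.+1%:R) ((2 * s) ^+ 2).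
have [|mE PE] := @discretized_event_le _ _ _ _ _ X Xp Xd V code mc E
    (C0 * Num.sqrt (Num.sqrt (rate D (2 * s) (2 * t) N.+1))).
  move=> v; apply: (hC0 _ _ _ _ _ _ D) => //.
  - rewrite DD; apply: (discretized_independent_entries b0 sg0 rho0 rho1 Xb Xvar Xcorr
      mc hvala eps1 eps2 M th v (ltW p0) pq p1).
  - by move=> k o; rewrite minor_shift; apply: (hth (o, v, k)).
  - by rewrite -[leLHS]mulr1 ler_pM // ler1n.
  - by rewrite mulr_gt0.
  - by rewrite -[leRHS]mulr1 ler_wpM2l.
set F := [set w | _ /\ _].
have mF : measurable F.
  apply: (measurable_singular_values (A := fun w => random_matrix X w + M)).
  - by rewrite divr_ge0 ?sqrtr_ge0 // ltW.
  - exact: ltW.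
  - move=> i j; have [m1 m2] := measurable_ReIm (@measurable_funPT _ _ _ _ (X i j)).
    apply: measurable_complex.
      rewrite (_ : (fun w => _) = (fun w => complex.Re (X i j w) + complex.Re (M i j))).
        exact: measurable_funD.
      by apply/funext => w; rewrite !mxE; case: (X i j w) (M i j) => [? ?] [].
    rewrite (_ : (fun w => _) = (fun w => complex.Im (X i j w) + complex.Im (M i j))).
      exact: measurable_funD.
    by apply/funext => w; rewrite !mxE; case: (X i j w) (M i j) => [? ?] [].
have FE : F `<=` A `|` [set w | E (off_code X code w) (diag_code X code w)].
  move=> w [h1 h2]; have [Aw|/hA nA] := pselect (A w); [by left|right].
  have tn0 : 0 <= t / Num.sqrt N.+1%:R by rewrite divr_ge0 ?sqrtr_ge0 // ltW.
  apply: (@nearly_singular_perturb _ _ (random_matrix X w + M) _ _ _ (4 * eps ^+ 2)) => //.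
  - by rewrite mulr_ge0 // sqr_ge0.
  - apply: discretization_error; first by rewrite (ltW th0).
    by move=> i j; apply: hval; apply: le_trans (nA i j) lL.
  - split; first by apply/(singular_value_firstP _ (ltW s0)).
    move/(singular_value_lastP _ tn0): h1 => [x x1 hx]; exists x => //.
    by rewrite expr_div_n sqr_sqrtr ?ler0n in hx.
apply: le_trans (le_measure P _ _ FE) _; rewrite ?inE //; first exact: measurableU.
apply: le_trans (measureU2 P mA mE) _.
rewrite mulrDl mul1r EFinD; apply: leeD => //.
apply: le_trans PE _; rewrite lee_fin -mulrA ler_wpM2l ?(ltW C00) //.
exact: rate_scale.
Qed.

End Discretization.

Theorem theorem5p1 (R : realType) (a b sigma : R) :
  0 < a -> 0 < b -> 0 < sigma ->
  exists2 C : R, 0 < C &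
  forall (n : nat) (d : measure_display) (T : measurableType d)
    (P : probability T R) (X : 'I_n -> 'I_n -> {RV P >-> R[i]}) (rho : R),
  pairs_independent X ->
  diagonal_independent X ->
  is_min [set fine (P (bounded_event X a ij.1 ij.2))
         | ij in [set ij : 'I_n * 'I_n | (ij.1 < ij.2)%N]] b ->
  is_min [set cvar (cond_bounded X a ij.1 ij.2) (X ij.1 ij.2)
         | ij in [set ij : 'I_n * 'I_n | ij.1 != ij.2]] (sigma ^+ 2) ->
  is_max [set normc (ccorr (cond_bounded X a ij.1 ij.2)
                       (X ij.1 ij.2) (X ij.2 ij.1))
         | ij in [set ij : 'I_n * 'I_n | (ij.1 < ij.2)%N]] rho ->
  rho < 1 ->
  C <= n%:R ->
  forall (M : 'M[R[i]]_n) (s t : R), 1 <= s -> 0 < t -> t <= 1 ->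
  (P [set w | (singular_value (random_matrix X w + M) n <= t / Num.sqrt n%:R)%R /\
              (singular_value (random_matrix X w + M) 1 <= s)%R]
   <= (C * (ln (C * n%:R * s) / Num.sqrt (1 - rho)
              * (Num.sqrt (s ^+ 5 * t) + (Num.sqrt n%:R)^-1)) `^ (4^-1))%:E)%E.
Proof.
move=> a0 b0 sg0; have [C0 C00 hC0] := singular_event_bound a b0 sg0.
(* With [C >= e] the logarithm is at least one, so inserting it only enlarges the bound. *)
pose C := Num.max (expR 1) C0; have C_gt0 : 0 < C by rewrite lt_max expR_gt0.
exists C => // -[|N] d T P X rho Xp Xd [_ hb] [_ hv] [[ij0 _ rhoE] hr] rho1 Cn.
  (* The case [n = 0], excluded by [0 < C <= n]. *)
  by move: C_gt0; rewrite ltNge Cn.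
move=> M s t s1 t0 t1.
(* As a maximum, [rho] is attained, hence is the modulus of a correlation. *)
have rho0 : 0 <= rho by rewrite -rhoE; case: (ccorr _ _ _) => *; apply: sqrtr_ge0.
apply: le_trans (hC0 N d T P X rho Xp Xd rho0 rho1 _ _ _ M s t s1 t0 t1) _.
- by move=> i j ij; apply: hb; exists (i, j).
- by move=> i j ij; apply: hv; exists (i, j).
- by move=> i j ij; apply: hr; exists (i, j).
have D0 : 0 < Num.sqrt (1 - rho) by rewrite sqrtr_gt0 subr_gt0.
set r := rate _ _ _ _; have r0 : 0 < r by apply: rate_gt0.
have C1 : 1 <= C by rewrite le_max -{1}expR0 ler_expR ler01.
have ln1C : 1 <= ln (C * N.+1%:R * s).
  rewrite -[leLHS]expRK ler_ln ?posrE ?expR_gt0 ?mulr_gt0 ?ltr0Sn //; last first.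
    exact: lt_le_trans s1.
  apply: (@le_trans _ _ C); first by rewrite le_max lexx.
  rewrite -mulrA ler_peMr ?(ltW C_gt0) // mulr_ege1 // ler1n //.
have rE : ln (C * N.+1%:R * s) / Num.sqrt (1 - rho) *
    (Num.sqrt (s ^+ 5 * t) + (Num.sqrt N.+1%:R)^-1) = ln (C * N.+1%:R * s) * r.
  by rewrite /r /rate; ring.
rewrite lee_fin rE (_ : 4^-1 = 2^-1 * 2^-1); last by field.
have lr0 : 0 <= ln (C * N.+1%:R * s) * r by rewrite mulr_ge0 ?(ltW r0) // (le_trans ler01).
rewrite powRrM !powR12_sqrt ?sqrtr_ge0 //; apply: ler_pM; rewrite ?sqrtr_ge0 ?(ltW C00) //.
  by rewrite le_max lexx orbT.
by do 2 apply: ler_wsqrtr; rewrite ler_peMl // ltW.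
Qed.
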